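(* Let $\mathcal{A}=\mathbb{C}$ and let $X=\ell^2(\mathbb{N})$, regarded as a $\mathrm{C}^*$-correspondence over $\mathbb{C}$ (with left action by scalar multiplication), so that $\mathcal{O}_X=\mathcal{O}_\infty$. For every countable non-amenable discrete group $G$, there is a generalized gauge action $\alpha:G\curvearrowright(\mathcal{A},X)$ such that the induced generator-preserving surjective $*$-homomorphism $\mathcal{O}_X\rtimes_\alpha G\rightarrow\mathcal{O}_{X\rtimes_\alpha G}$ fails to be injective.
   Context: A $\mathrm{C}^*$-correspondence $(\mathcal{A},X)$ is a right Hilbert module $X$ over a $\mathrm{C}^*$-algebra $\mathcal{A}$ with a left action $\varphi_X:\mathcal{A}\to\mathcal{L}(X)$ by adjointable operators, assumed non-degenerate: $\overline{\varphi_X(\mathcal{A})X}=X$. $\mathcal{K}(X)\subset\mathcal{L}(X)$ is the closed span of the operators $\theta_{x,y}(z)=x\langle y,z\rangle$. Katsura's ideal is $J_X=\{a\in\mathcal{A}:\varphi_X(a)\in\mathcal{K}(X),\ ab=0\text{ for all }b\in\ker\varphi_X\}$. A rigged representation of $(\mathcal{A},X)$ in a $\mathrm{C}^*$-algebra $\mathcal{B}$ is a pair $(\rho,t)$ with $\rho:\mathcal{A}\to\mathcal{B}$ a (non-degenerate) $*$-homomorphism and $t:X\to\mathcal{B}$ linear and completely contractive such that $\rho(a_1)t(x)\rho(a_2)=t(a_1xa_2)$ and $t(x)^*t(y)=\rho(\langle x,y\rangle)$. It induces a $*$-homomorphism $\psi_t:\mathcal{K}(X)\to\mathcal{B}$,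 $\psi_t(\theta_{x,y})=t(x)t(y)^*$, and it is covariant if $\psi_t(\varphi_X(a))=\rho(a)$ for all $a\in J_X$. The Toeplitz algebra $\mathcal{T}_X$ is the universal $\mathrm{C}^*$-algebra generated by rigged representations, and the Cuntz--Pimsner algebra $\mathcal{O}_X$ is the universal $\mathrm{C}^*$-algebra generated by rigged covariant representations; $\mathcal{O}_X$ is a quotient of $\mathcal{T}_X$, and both contain canonical copies of $\mathcal{A}$ and $X$. A generalized gauge action $\alpha:G\curvearrowright(\mathcal{A},X)$ of a locally compact Hausdorff group $G$ is a point-norm continuous action of $G$ on $\mathcal{T}_X$ by $*$-automorphisms with $\alpha_g(\mathcal{A})=\mathcal{A}$ and $\alpha_g(X)=X$ for all $g\in G$; it induces an action on $\mathcal{O}_X$, also denoted $\alpha$. $\rtimes_\alpha$ denotes the full crossed product. The full crossed product correspondence $(\mathcal{A}\rtimes_\alpha G,X\rtimes_\alpha G)$ consists of the closures of $C_c(G;\mathcal{A})$ and $C_c(G;X)$ in $\mathcal{T}_X\rtimes_\alpha G$, with bimodule actions given by multiplication and inner product $\langle f,h\rangle=f^*h$. $\mathcal{O}_{X\rtimes_\alpha G}$ is its Cuntz--Pimsner algebra. A $*$-homomorphism between $\mathrm{C}^*$-algebras generated by representations of $(\mathcal{A}\rtimes_\alpha G,X\rtimes_\alpha G)$ (such as $\mathcal{O}_X\rtimes_\alpha G$ and $\mathcal{O}_{X\rtimes_\alpha G}$) is generator-preserving if it is the identity on the canonical copies of $C_c(G;\mathcal{A})$ and $C_c(G;X)$.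 *)

(* Defs.v *)
From HB Require Import structures.
From mathcomp Require Import all_boot all_order all_algebra.
From mathcomp Require Import all_classical all_reals all_analysis.
From mathcomp Require Import complex.

Set Implicit Arguments.
Unset Strict Implicit.
Unset Printing Implicit Defensive.

Import Order.TTheory GRing.Theory Num.Theory.
Import numFieldNormedType.Exports.

Local Open Scope classical_set_scope.
Local Open Scope ring_scope.

(* C*-algebras need not be unital, so the product is not the one of a
   MathComp ring.  All norms take their values in R[i]. *)
HB.mixin Record isCStarAlgebra (R : realType) A
    & CompleteNormedModule R[i] A := {
  cmul : A -> A -> A;
  star : A -> A;
  cmulA : associative cmul;
  cmulDl : left_distributive cmul +%R;
  cmulDr : right_distributive cmul +%R;
  cmulZl : forall (c : R[i]) (a b : A), cmul (c *: a) b = c *: cmul a b;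
  cmulZr : forall (c : R[i]) (a b : A), cmul a (c *: b) = c *: cmul a b;
  starK : involutive star;
  starD : {morph star : a b / a + b};
  starZ : forall (c : R[i]) (a : A), star (c *: a) = conjc c *: star a;
  starM : forall a b : A, star (cmul a b) = cmul (star b) (star a);
  norm_cmul : forall a b : A, `|cmul a b| <= `|a| * `|b|;
  cstar_identity : forall a : A, `|cmul (star a) a| = `|a| ^+ 2
}.

#[short(type="cstarAlgType")]
HB.structure Definition CStarAlgebra (R : realType) :=
  {A of isCStarAlgebra R A & CompleteNormedModule R[i] A}.

Notation "a ** b" := (cmul a b) (at level 40, left associativity) : ring_scope.

Definition cpositive (R : realType) (A : cstarAlgType R) (a : A) : Prop :=
  exists b : A, a = star b ** b.

Definition star_hom (R : realType) (A B : cstarAlgType R) (f : A -> B) : Prop :=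
  [/\ linear f, {morph f : a b / a ** b} & {morph f : a / star a}].

Definition closed_span (R : realType) (V : completeNormedModType R[i])
    (S : set V) : set V :=
  closure [set x | exists n (c : 'I_n -> R[i]) (s : 'I_n -> V),
    (forall i, S (s i)) /\ x = \sum_i c i *: s i].

Definition star_subalgebra (R : realType) (B : cstarAlgType R)
    (S : set B) : Prop :=
  [/\ S 0,
      forall (c : R[i]) (a b : B), S a -> S b -> S (c *: a + b),
      forall a b : B, S a -> S b -> S (a ** b) &
      forall a : B, S a -> S (star a)].

Definition generates (R : realType) (B : cstarAlgType R) (S : set B) : Prop :=
  forall C : set B, closed C -> star_subalgebra C -> S `<=` C -> C = setT.

(* A (right) Hilbert A-module with a non-degenerate left action of A by
   adjointable operators.  The inner product is linear in its second variable;
   [lactJ] says that the adjoint of the left action of a is that of a^*. *)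
HB.mixin Record isCorrespondence (R : realType) (A : cstarAlgType R) X
    & CompleteNormedModule R[i] X := {
  ract : X -> A -> X;
  inner : X -> X -> A;
  lact : A -> X -> X;
  ractDl : forall (x y : X) (a : A), ract (x + y) a = ract x a + ract y a;
  ractDr : forall (x : X) (a b : A), ract x (a + b) = ract x a + ract x b;
  ractZl : forall (c : R[i]) (x : X) (a : A), ract (c *: x) a = c *: ract x a;
  ractZr : forall (c : R[i]) (x : X) (a : A), ract x (c *: a) = c *: ract x a;
  ractM : forall (x : X) (a b : A), ract x (a ** b) = ract (ract x a) b;
  innerP : forall (c : R[i]) (x y z : X),
    inner x (c *: y + z) = c *: inner x y + inner x z;
  inner_ract : forall (x y : X) (a : A), inner x (ract y a) = inner x y ** a;
  innerJ : forall x y : X, star (inner x y) = inner y x;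
  inner_positive : forall x : X, cpositive (inner x x);
  norm_inner : forall x : X, `|x| ^+ 2 = `|inner x x|;
  lactP : forall (c : R[i]) (a b : A) (x : X),
    lact (c *: a + b) x = c *: lact a x + lact b x;
  lactM : forall (a b : A) (x : X), lact (a ** b) x = lact a (lact b x);
  lactJ : forall (a : A) (x y : X), inner (lact a x) y = inner x (lact (star a) y);
  lact_nondegenerate :
    closed_span [set z | exists (a : A) (x : X), z = lact a x] = setT
}.

#[short(type="corrType")]
HB.structure Definition Correspondence (R : realType) (A : cstarAlgType R) :=
  {X of isCorrespondence R A X & CompleteNormedModule R[i] X}.

Section Correspondence.
Context (R : realType) (A : cstarAlgType R) (X : corrType A).

Definition theta (x y z : X) : X := ract x (inner y z).

Definition adjoint_pair (S T : X -> X) : Prop :=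
  forall x y : X, inner (S x) y = inner x (T y) :> A.

Definition compact_op (T : X -> X) : Prop :=
  (exists S, adjoint_pair T S) /\
  forall e : R[i], 0 < e ->
    exists n (c : 'I_n -> R[i]) (x y : 'I_n -> X),
      forall z, `|T z - \sum_i c i *: theta (x i) (y i) z| <= e * `|z|.

Definition katsura_ideal : set A :=
  [set a | compact_op (lact a) /\
    forall b : A, (forall x : X, lact b x = 0) -> a ** b = 0].

End Correspondence.

(* The norm of b in M_n(B) is at most r.  M_n(B) acts isometrically on the
   Hilbert B-module B^n, so its C*-norm is the supremum of |<c, b d>| over the
   unit ball of B^n. *)
Definition mx_norm_le (R : realType) (B : cstarAlgType R) (n : nat)
    (b : 'I_n -> 'I_n -> B) (r : R[i]) : Prop :=
  forall c d : 'I_n -> B,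
    `|\sum_i star (c i) ** c i| <= 1 -> `|\sum_i star (d i) ** d i| <= 1 ->
    `|\sum_i \sum_j star (c i) ** b i j ** d j| <= r.

Section Representations.
Context (R : realType) (A : cstarAlgType R) (X : corrType A).
Variables (B : cstarAlgType R) (rho : A -> B) (t : X -> B).

(* The norm of (x_ij) in M_n(X), a Hilbert module over M_n(A), is the square
   root of the norm of its Gram matrix. *)
Definition completely_contractive : Prop :=
  forall (n : nat) (x : 'I_n -> 'I_n -> X) (r : R[i]), 0 <= r ->
    mx_norm_le (fun i j => \sum_k inner (x k i) (x k j) : A) (r ^+ 2) ->
    mx_norm_le (fun i j => t (x i j)) r.

Definition rigged : Prop :=
  [/\ star_hom rho /\
        closed_span [set z | exists (a : A) (b : B), z = rho a ** b] = setT,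
      linear t /\ completely_contractive,
      forall (a1 a2 : A) (x : X),
        rho a1 ** t x ** rho a2 = t (lact a1 (ract x a2)) &
      forall x y : X, star (t x) ** t y = rho (inner x y)].

(* The values of psi outside of K(X) are irrelevant. *)
Definition is_psi (psi : (X -> X) -> B) : Prop :=
  [/\ forall x y : X, psi (theta x y) = t x ** star (t y),
      forall (c : R[i]) (S T : X -> X), compact_op S -> compact_op T ->
        psi (fun z => c *: S z + T z) = c *: psi S + psi T,
      forall S T : X -> X, compact_op S -> compact_op T ->
        psi (S \o T) = psi S ** psi T &
      forall S T : X -> X, compact_op S -> adjoint_pair S T ->
        psi T = star (psi S)].

Definition covariant : Prop :=
  exists psi, is_psi psi /\
    forall a : A, katsura_ideal X a -> psi (lact a) = rho a.

End Representations.

Section UniversalAlgebras.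
Context (R : realType) (A : cstarAlgType R) (X : corrType A).

Definition is_toeplitz_algebra (T : cstarAlgType R)
    (rho : A -> T) (t : X -> T) : Prop :=
  [/\ rigged rho t,
      generates (range rho `|` range t) &
      forall (D : cstarAlgType R) (rho' : A -> D) (t' : X -> D),
        rigged rho' t' ->
        exists P : T -> D,
          [/\ star_hom P, forall a, P (rho a) = rho' a &
              forall x, P (t x) = t' x]].

Definition is_cuntz_pimsner_algebra (O : cstarAlgType R)
    (rho : A -> O) (t : X -> O) : Prop :=
  [/\ rigged rho t /\ covariant rho t,
      generates (range rho `|` range t) &
      forall (D : cstarAlgType R) (rho' : A -> D) (t' : X -> D),
        rigged rho' t' -> covariant rho' t' ->
        exists P : O -> D,
          [/\ star_hom P, forall a, P (rho a) = rho' a &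
              forall x, P (t x) = t' x]].

End UniversalAlgebras.

Definition is_action (R : realType) (G : groupType) (B : cstarAlgType R)
    (alpha : G -> B -> B) : Prop :=
  [/\ forall g, star_hom (alpha g),
      forall b, alpha 1%g b = b &
      forall g h b, alpha (g * h)%g b = alpha g (alpha h b)].

(* For a discrete group, point-norm continuity is no condition. *)
Definition generalized_gauge_action (R : realType) (G : groupType)
    (A : cstarAlgType R) (X : corrType A) (T : cstarAlgType R)
    (rho : A -> T) (t : X -> T) (alpha : G -> T -> T) : Prop :=
  [/\ is_action alpha,
      forall g, alpha g @` range rho = range rho &
      forall g, alpha g @` range t = range t].

(* The action on O_X induced by an action on T_X: the canonical quotient map
   is the one intertwining the canonical copies of A and X. *)
Definition induced_action (R : realType) (G : groupType)
    (A : cstarAlgType R) (X : corrType A)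
    (T : cstarAlgType R) (rhoT : A -> T) (tT : X -> T)
    (O : cstarAlgType R) (rhoO : A -> O) (tO : X -> O)
    (alpha : G -> T -> T) (beta : G -> O -> O) : Prop :=
  is_action beta /\
  exists q : T -> O,
    [/\ star_hom q, forall a, q (rhoT a) = rhoO a, forall x, q (tT x) = tO x &
        forall g z, beta g (q z) = q (alpha g z)].

(* C_c(G; V) for G discrete. *)
Definition fin_supp (G : groupType) (V : zmodType) : set (G -> V) :=
  [set f | finite_set [set g | f g <> 0]].

Section CrossedProduct.
Context (R : realType) (G : groupType) (B : cstarAlgType R).
Variable alpha : G -> B -> B.

Definition convolution (f h : G -> B) : G -> B :=
  fun g => \sum_(k \in [set: G]) f k ** alpha k (h (k^-1 * g)%g).

Definition involution (f : G -> B) : G -> B :=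
  fun g => alpha g (star (f g^-1%g)).

Definition Cc_star_hom (D : cstarAlgType R) (p : (G -> B) -> D) : Prop :=
  [/\ forall (c : R[i]) (f h : G -> B), fin_supp f -> fin_supp h ->
        p (fun g => c *: f g + h g) = c *: p f + p h,
      forall f h : G -> B, fin_supp f -> fin_supp h ->
        p (convolution f h) = p f ** p h &
      forall f : G -> B, fin_supp f -> p (involution f) = star (p f)].

(* C is the full crossed product of B by the discrete group G, i.e. the
   enveloping C*-algebra of C_c(G; B) (for discrete G every *-representation of
   C_c(G; B) is bounded in the L^1-norm and comes from a covariant pair); the
   values of j outside of C_c(G; B) are irrelevant. *)
Definition is_full_crossed_product (C : cstarAlgType R)
    (j : (G -> B) -> C) : Prop :=
  [/\ Cc_star_hom j,
      closure (j @` @fin_supp G B) = setT &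
      forall (D : cstarAlgType R) (p : (G -> B) -> D), Cc_star_hom p ->
        exists P : C -> D, star_hom P /\ forall f, fin_supp f -> P (j f) = p f].

End CrossedProduct.

(* (AG, XG) is the full crossed product correspondence, given through the
   embeddings iA and iX onto the closures of C_c(G; A) and C_c(G; X) in the
   full crossed product TG of T_X. *)
Definition is_crossed_correspondence (R : realType) (G : groupType)
    (A : cstarAlgType R) (X : corrType A)
    (T : cstarAlgType R) (rho : A -> T) (t : X -> T)
    (TG : cstarAlgType R) (j : (G -> T) -> TG)
    (AG : cstarAlgType R) (XG : corrType AG)
    (iA : AG -> TG) (iX : XG -> TG) : Prop :=
  [/\ [/\ star_hom iA, forall a, `|iA a| = `|a| &
          range iA = closure [set j (rho \o f) | f in @fin_supp G A]],
      [/\ linear iX, forall x, `|iX x| = `|x| &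
          range iX = closure [set j (t \o f) | f in @fin_supp G X]],
      forall (a : AG) (x : XG), iX (lact a x) = iA a ** iX x,
      forall (x : XG) (a : AG), iX (ract x a) = iX x ** iA a &
      forall x y : XG, iA (inner x y) = star (iX x) ** iX y].

(* A map OG -> O' between algebras generated by (AG, XG) that is the identity
   on C_c(G; A) and C_c(G; X): here jO, rhoO, tO give the copies in OG, while
   the copies in O' are obtained through AG and XG. *)
Definition generator_preserving (R : realType) (G : groupType)
    (A : cstarAlgType R) (X : corrType A)
    (T : cstarAlgType R) (rhoT : A -> T) (tT : X -> T)
    (TG : cstarAlgType R) (jT : (G -> T) -> TG)
    (AG : cstarAlgType R) (XG : corrType AG)
    (iA : AG -> TG) (iX : XG -> TG)
    (O : cstarAlgType R) (rhoO : A -> O) (tO : X -> O)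
    (OG : cstarAlgType R) (jO : (G -> O) -> OG)
    (O' : cstarAlgType R) (rho' : AG -> O') (t' : XG -> O')
    (pi : OG -> O') : Prop :=
  (forall (f : G -> A) (a : AG), fin_supp f -> iA a = jT (rhoT \o f) ->
     pi (jO (rhoO \o f)) = rho' a) /\
  (forall (f : G -> X) (x : XG), fin_supp f -> iX x = jT (tT \o f) ->
     pi (jO (tO \o f)) = t' x).

Definition amenable (R : realType) (G : groupType) : Prop :=
  let bounded (f : G -> R) := exists M : R, forall g, `|f g| <= M in
  exists m : (G -> R) -> R,
    [/\ forall (c : R) (f h : G -> R), bounded f -> bounded h ->
          m (fun g => c * f g + h g) = c * m f + m h,
        forall f : G -> R, bounded f -> (forall g, 0 <= f g) -> 0 <= m f,
        m (fun=> 1) = 1 &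
        forall (f : G -> R) (k : G), bounded f ->
          m (fun g => f (k * g)%g) = m f].

Local Notation Re := complex.Re.
Local Notation Im := complex.Im.

Section Normc.
Context {R : realType}.
Implicit Types x y : R[i].
Local Notation nc := (@Normc.normc R).

Lemma normr_normc x : `|x| = (nc x)%:C%C.
Proof. by []. Qed.

Lemma normc_ge0 x : 0 <= nc x.
Proof. by rewrite -ler0c -normr_normc normr_ge0. Qed.

Lemma normcD x y : nc (x + y) <= nc x + nc y.
Proof. by rewrite -lecR rmorphD /= -!normr_normc ler_normD. Qed.

Lemma sqr_normc x : nc x ^+ 2 = Re x ^+ 2 + Im x ^+ 2.
Proof. by case: x => a b /=; rewrite sqr_sqrtr // addr_ge0 ?sqr_ge0. Qed.

Lemma normc_conjc x : nc (conjc x) = nc x.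
Proof. by case: x => a b /=; rewrite sqrrN. Qed.

Lemma normcN x : nc (- x) = nc x.
Proof. by apply: complexI; rewrite -!normr_normc normrN. Qed.

Lemma Re_le_normc x : `|Re x| <= nc x.
Proof.
rewrite -(@ler_pXn2r _ 2) ?nnegrE ?normc_ge0 //.
by rewrite sqr_normc real_normK ?num_real // lerDl sqr_ge0.
Qed.

Lemma Im_le_normc x : `|Im x| <= nc x.
Proof.
rewrite -(@ler_pXn2r _ 2) ?nnegrE ?normc_ge0 //.
by rewrite sqr_normc real_normK ?num_real // lerDr sqr_ge0.
Qed.

Lemma normc_le_ReIm x : nc x <= `|Re x| + `|Im x|.
Proof.
rewrite -(@ler_pXn2r _ 2) ?nnegrE ?normc_ge0 ?addr_ge0 //.
rewrite sqr_normc sqrrD !real_normK ?num_real // lerD2r lerDl.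
by rewrite mulrn_wge0 // mulr_ge0.
Qed.

End Normc.

(* The C*-algebra of complex numbers: an alias of R[i]^o. *)
Definition scalars (R : realType) : Type := R[i].

HB.instance Definition _ (R : realType) :=
  NormedModule.copy (scalars R) (R[i]^o).

Lemma Re_Im_cauchy (R : realType) (V : normedModType R[i]) (F : set_system V)
    (p : V -> R) :
  (forall x y : V, (`|p x - p y|%:C%C : R[i]) <= `|x - y|) ->
  ProperFilter F -> cauchy F -> cvg (p @ F).
Proof.
move=> pL FF /cauchyP Fc; apply: R_complete; apply: cauchy_exP => e e0.
have /Fc [x Fx] : (0 : R[i]) < e%:C%C by rewrite ltcR.
exists (p x); suff : F (p @^-1` ball (p x) e) by [].
apply: filterS Fx => y; rewrite /preimage -!ball_normE /= => xy.
by rewrite -ltcR; apply: le_lt_trans xy; apply: pL.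
Qed.

Lemma scalars_complete (R : realType) (F : set_system (scalars R)) :
  ProperFilter F -> cauchy F -> cvg F.
Proof.
move=> FF Fc.
have /cvgrPdist_lt cRe : cvg ((fun x : scalars R => Re (x : R[i])) @ F).
  apply: Re_Im_cauchy => // x y.
  rewrite -[`|x - y|]/((Normc.normc (x - y : R[i]))%:C%C) lecR.
  by rewrite -raddfB Re_le_normc.
have /cvgrPdist_lt cIm : cvg ((fun x : scalars R => Im (x : R[i])) @ F).
  apply: Re_Im_cauchy => // x y.
  rewrite -[`|x - y|]/((Normc.normc (x - y : R[i]))%:C%C) lecR.
  by rewrite -raddfB Im_le_normc.
apply/cvg_ex; exists (Complex (lim ((fun x : scalars R => Re (x : R[i])) @ F))
  (lim ((fun x : scalars R => Im (x : R[i])) @ F))).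
apply/cvgrPdist_lt => e e0.
have [eIm eRe] : Im e = 0 /\ 0 < Re e.
  by move: e0; rewrite ltcE /= => /andP[/eqP -> ->].
have e2 : 0 < Re e / 2 by rewrite divr_gt0.
near=> x.
rewrite -[`| _ |]/((Normc.normc ((Complex _ _ : R[i]) - (x : R[i])))%:C%C).
rewrite [e]complexE eIm mulr0 addr0 ltcR.
apply: le_lt_trans (normc_le_ReIm _) _.
rewrite !raddfB /= [ltRHS]splitr ltrD //; near: x; [exact: cRe|exact: cIm].
Unshelve. all: by end_near. Qed.

HB.instance Definition _ (R : realType) :=
  Uniform_isComplete.Build (scalars R) (@scalars_complete R).

Section ScalarsCStarAlgebra.
Variable R : realType.
Local Notation C := (scalars R).

Definition scalars_mul (a b : C) : C := (a : R[i]) * (b : R[i]).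
Definition scalars_star (a : C) : C := conjc (a : R[i]).

Fact scalars_mulA : associative scalars_mul. Proof. exact: mulrA. Qed.
Fact scalars_mulDl : left_distributive scalars_mul +%R.
Proof. exact: mulrDl. Qed.
Fact scalars_mulDr : right_distributive scalars_mul +%R.
Proof. exact: mulrDr. Qed.
Fact scalars_mulZl (c : R[i]) (a b : C) :
  scalars_mul (c *: a) b = c *: scalars_mul a b.
Proof. by rewrite /scalars_mul -[RHS]/((c : R[i]) * (_ : R[i])) mulrA. Qed.
Fact scalars_mulZr (c : R[i]) (a b : C) :
  scalars_mul a (c *: b) = c *: scalars_mul a b.
Proof. by rewrite /scalars_mul -[RHS]/((c : R[i]) * (_ : R[i])) mulrCA. Qed.
Fact scalars_starK : involutive scalars_star. Proof. exact: conjcK. Qed.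
Fact scalars_starD : {morph scalars_star : a b / a + b}.
Proof. by move=> a b; rewrite /scalars_star -rmorphD. Qed.
Fact scalars_starZ (c : R[i]) (a : C) :
  scalars_star (c *: a) = conjc c *: scalars_star a.
Proof. exact: (rmorphM (@conjc R)). Qed.
Fact scalars_starM (a b : C) :
  scalars_star (scalars_mul a b) = scalars_mul (scalars_star b) (scalars_star a).
Proof. by rewrite /scalars_mul mulrC; exact: (rmorphM (@conjc R)). Qed.
Fact scalars_norm_mul (a b : C) : `|scalars_mul a b| <= `|a| * `|b|.
Proof. by rewrite -[leLHS]/(`|(a : R[i]) * (b : R[i])|) normrM. Qed.
Fact scalars_cstar (a : C) : `|scalars_mul (scalars_star a) a| = `|a| ^+ 2.
Proof.
rewrite -[LHS]/(`|conjc (a : R[i]) * (a : R[i])|) normrM expr2.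
by congr (_ * _); rewrite normr_normc normc_conjc.
Qed.

HB.instance Definition _ := isCStarAlgebra.Build R C
  scalars_mulA scalars_mulDl scalars_mulDr scalars_mulZl scalars_mulZr
  scalars_starK scalars_starD scalars_starZ scalars_starM
  scalars_norm_mul scalars_cstar.

End ScalarsCStarAlgebra.

Section SquareSummable.
Variable R : realType.
Implicit Types (f g : nat -> R[i]) (N : nat) (M : R).
Local Notation nc := (@Normc.normc R).

Definition square_summable f := cvgn (series (fun n => nc (f n) ^+ 2)).

Definition l2norm f : R := Num.sqrt (limn (series (fun n => nc (f n) ^+ 2))).

(* Meaningful for absolutely convergent series. *)
Definition csum (u : nat -> R[i]) : R[i] :=
  Complex (limn (series (fun n => Re (u n)))) (limn (series (fun n => Im (u n)))).

Definition pnorm f N : R := Num.sqrt (\sum_(0 <= n < N) nc (f n) ^+ 2).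

Lemma pnorm_ge0 f N : 0 <= pnorm f N. Proof. exact: sqrtr_ge0. Qed.

Lemma psum_ge0 f N : 0 <= \sum_(0 <= n < N) nc (f n) ^+ 2.
Proof. by apply: sumr_ge0 => i _; apply: sqr_ge0. Qed.

Lemma psum_nd f : nondecreasing_seq (series (fun n => nc (f n) ^+ 2)).
Proof.
apply/nondecreasing_seqP => n; rewrite /series /= big_nat_recr //= lerDl.
exact: sqr_ge0.
Qed.

Lemma square_summableP f :
  square_summable f <-> exists M, forall N, pnorm f N <= M.
Proof.
split=> [cf|[M fM]].
  exists (l2norm f) => N; rewrite ler_wsqrtr //.
  exact: (nondecreasing_cvgn_le (psum_nd f) cf N).
apply: nondecreasing_is_cvgn; first exact: psum_nd.
exists (M ^+ 2) => _ [N _ <-].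
rewrite /series /= -[leLHS]sqr_sqrtr ?psum_ge0 // lerXn2r ?nnegrE ?pnorm_ge0 ?fM //.
exact: le_trans (pnorm_ge0 f N) (fM N).
Qed.

Lemma pnorm_le_l2norm f N : square_summable f -> pnorm f N <= l2norm f.
Proof.
move=> cf; rewrite ler_wsqrtr //; exact: (nondecreasing_cvgn_le (psum_nd f) cf N).
Qed.

Lemma l2norm_le f M : (forall N, pnorm f N <= M) -> l2norm f <= M.
Proof.
move=> fM.
have M0 : 0 <= M by apply: le_trans (pnorm_ge0 f 0) (fM 0%N).
have cf : square_summable f by apply/square_summableP; exists M.
rewrite -[leRHS](ger0_norm M0) -sqrtr_sqr ler_wsqrtr //.
apply: limr_le => //; near=> N.
rewrite /series /= -[leLHS]sqr_sqrtr ?psum_ge0 // lerXn2r ?nnegrE ?pnorm_ge0 ?fM //.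
Unshelve. all: by end_near. Qed.

Lemma normc_le_pnorm f N i : (i < N)%N -> nc (f i) <= pnorm f N.
Proof.
move=> iN; rewrite -(ger0_norm (normc_ge0 (f i))) -sqrtr_sqr ler_wsqrtr //.
rewrite big_mkord (bigD1 (Ordinal iN)) //= lerDl.
by apply: sumr_ge0 => j _; apply: sqr_ge0.
Qed.

Lemma pnormD f g N : pnorm (f \+ g) N <= pnorm f N + pnorm g N.
Proof.
elim: N => [|N IH]; first by rewrite /pnorm !big_geq // sqrtr0 addr0.
have E h : pnorm h N.+1 = nc (Complex (pnorm h N) (nc (h N))).
  by rewrite /pnorm big_nat_recr //= sqr_sqrtr ?psum_ge0.
rewrite !E; apply: le_trans (normcD _ _) => /=.
rewrite ler_wsqrtr // lerD // lerXn2r ?nnegrE ?addr_ge0 ?pnorm_ge0 ?normc_ge0 ?normcD //.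
Qed.

Lemma pnormZ (c : R[i]) f N : pnorm (fun n => c * f n) N = nc c * pnorm f N.
Proof.
rewrite /pnorm -[in RHS](ger0_norm (normc_ge0 c)) -sqrtr_sqr -sqrtrM ?sqr_ge0 //.
by congr Num.sqrt; rewrite mulr_sumr; apply: eq_bigr => i _; rewrite Normc.normcM exprMn.
Qed.

Lemma pnorm_le_sum f N : pnorm f N <= \sum_(0 <= n < N) nc (f n).
Proof.
elim: N => [|N IH]; first by rewrite /pnorm !big_geq // sqrtr0.
have -> : pnorm f N.+1 = nc (Complex (pnorm f N) (nc (f N))).
  by rewrite /pnorm big_nat_recr //= sqr_sqrtr ?psum_ge0.
apply: (le_trans (normc_le_ReIm _)); rewrite big_nat_recr //=.
by rewrite !ger0_norm ?pnorm_ge0 ?normc_ge0 // lerD2r.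
Qed.

Lemma square_summable0 : square_summable (fun=> 0).
Proof.
apply/square_summableP; exists 0 => N.
by rewrite /pnorm big1 ?sqrtr0 // => i _; rewrite Normc.normc0 expr0n.
Qed.

Lemma square_summableD f g :
  square_summable f -> square_summable g -> square_summable (f \+ g).
Proof.
move=> cf cg; apply/square_summableP; exists (l2norm f + l2norm g) => N.
by apply: (le_trans (pnormD f g N)); rewrite lerD ?pnorm_le_l2norm.
Qed.

Lemma square_summableZ (c : R[i]) f :
  square_summable f -> square_summable (fun n => c * f n).
Proof.
move=> cf; apply/square_summableP; exists (nc c * l2norm f) => N.
by rewrite pnormZ ler_wpM2l ?normc_ge0 // pnorm_le_l2norm.
Qed.

Definition ell2_pred : pred (nat -> scalars R) :=
  fun f => `[< square_summable f >].

Fact ell2_submod_closed : subsemimod_closed ell2_pred.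
Proof.
split; first split.
- by apply/asboolP; exact: square_summable0.
- by move=> f g /asboolP cf /asboolP cg; apply/asboolP; exact: square_summableD.
- by move=> c f /asboolP cf; apply/asboolP; exact: square_summableZ.
Qed.

HB.instance Definition _ :=
  GRing.isSubmodClosed.Build R[i] (nat -> scalars R) ell2_pred ell2_submod_closed.

End SquareSummable.

Record ell2 (R : realType) := Ell2 {
  ell2_fun :> nat -> scalars R;
  ell2P : ell2_pred ell2_fun
}.

HB.instance Definition _ (R : realType) := [isSub for @ell2_fun R].
HB.instance Definition _ (R : realType) := [Choice of ell2 R by <:].
HB.instance Definition _ (R : realType) :=
  [SubChoice_isSubLmodule of ell2 R by <:].

Section Ell2Norm.
Variable R : realType.
Implicit Types x y z : ell2 R.
Local Notation nc := (@Normc.normc R).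

Lemma ell2_summable x : square_summable x.
Proof. exact/asboolP/ell2P. Qed.
Arguments ell2_summable x : clear implicits.

Definition mk_ell2 (f : nat -> R[i]) (cf : square_summable f) : ell2 R :=
  @Ell2 R f (asboolT cf).

Lemma ell2_funD x y : ell2_fun (x + y) = (x : nat -> R[i]) \+ (y : nat -> R[i]).
Proof. by []. Qed.

Lemma ell2_funZ (c : R[i]) x : ell2_fun (c *: x) = (fun n => c * (x n : R[i])).
Proof. by []. Qed.

Lemma ell2_funB x y : ell2_fun (x - y) = (fun n => (x n : R[i]) - (y n : R[i])).
Proof. by []. Qed.

Definition ell2_norm x : R[i] := (l2norm x)%:C%C.

Fact ell2_ler_normD x y : ell2_norm (x + y) <= ell2_norm x + ell2_norm y.
Proof.
rewrite -rmorphD lecR; apply: l2norm_le => N.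
rewrite ell2_funD; apply: (le_trans (pnormD x y N)).
by rewrite lerD // pnorm_le_l2norm //; exact: ell2_summable.
Qed.

Lemma ell2_normZ_le (c : R[i]) x : l2norm (c *: x) <= nc c * l2norm x.
Proof.
apply: l2norm_le => N.
rewrite ell2_funZ pnormZ.
by rewrite ler_wpM2l ?normc_ge0 // pnorm_le_l2norm //; exact: ell2_summable.
Qed.

Fact ell2_normrZ (c : R[i]) x : ell2_norm (c *: x) = `|c| * ell2_norm x.
Proof.
rewrite normr_normc -rmorphM; congr (_%:C)%C => /=.
apply/le_anti; rewrite ell2_normZ_le /=.
have [->|c0] := eqVneq c 0.
  by rewrite Normc.normc0 mul0r (le_trans (pnorm_ge0 (0 *: x) 0%N)) //;
    exact/pnorm_le_l2norm/ell2_summable.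
have nc0 : 0 < nc c by rewrite -ltcR -normr_normc normr_gt0.
rewrite -ler_pdivlMl // -Normc.normcV.
have cx : c^-1 *: (c *: x) = x by rewrite scalerA mulVf // scale1r.
by have := ell2_normZ_le c^-1 (c *: x); rewrite cx.
Qed.

Lemma ell2_ext x y : (forall n, x n = y n) -> x = y.
Proof. by move=> xy; apply: val_inj; apply/funext. Qed.

Fact ell2_normr0_eq0 x : ell2_norm x = 0 -> x = 0.
Proof.
move=> [x0]; apply: ell2_ext => n; apply: (@Normc.eq0_normc R).
apply/le_anti; rewrite normc_ge0 andbT.
apply: (le_trans (normc_le_pnorm x (ltnSn n))).
by rewrite -x0 pnorm_le_l2norm //; exact: ell2_summable.
Qed.

HB.instance Definition _ := Lmodule_isNormed.Build R[i] (ell2 R)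
  ell2_ler_normD ell2_normrZ ell2_normr0_eq0.

Lemma ell2_normE x : `|x| = (l2norm x)%:C%C. Proof. by []. Qed.

Lemma ell2_complete (F : set_system (ell2 R)) :
  ProperFilter F -> cauchy F -> cvg F.
Proof.
move=> FF Fc.
have nxy n x y : nc (x n - y n) <= l2norm (x - y).
  have h1 := pnorm_le_l2norm n.+1 (ell2_summable (x - y)).
  have := normc_le_pnorm (ell2_fun (x - y)) (ltnSn n).
  by rewrite {1}ell2_funB => h2; apply: le_trans h2 h1.
pose re n (x : ell2 R) := Re (x n : R[i]).
pose im n (x : ell2 R) := Im (x n : R[i]).
have cre n : cvg (re n @ F).
  apply: Re_Im_cauchy => // x y; rewrite ell2_normE lecR /re -raddfB.
  exact: le_trans (Re_le_normc _) (nxy n x y).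
have cim n : cvg (im n @ F).
  apply: Re_Im_cauchy => // x y; rewrite ell2_normE lecR /im -raddfB.
  exact: le_trans (Im_le_normc _) (nxy n x y).
pose l n : R[i] := Complex (lim (re n @ F)) (lim (im n @ F)).
have cl n (e : R) : 0 < e ->
    F [set y : ell2 R | nc ((y n : R[i]) - l n) <= e].
  move=> e0; have e2 : 0 < e / 2 by rewrite divr_gt0.
  have /cvgrPdist_le/(_ _ e2) cR := cre n.
  have /cvgrPdist_le/(_ _ e2) cI := cim n.
  near=> y.
  apply: (le_trans (normc_le_ReIm _)); rewrite !raddfB /= [leRHS]splitr lerD //.
    by rewrite distrC; near: y; exact: cR.
  by rewrite distrC; near: y; exact: cI.
have clN N (e : R) : 0 < e ->
    F [set y : ell2 R | pnorm (fun n => (y n : R[i]) - l n) N <= e].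
  move=> e0.
  have eN : 0 < e / N.+1%:R by rewrite divr_gt0.
  have H : F [set y : ell2 R |
      forall i : 'I_N, nc ((y i : R[i]) - l i) <= e / N.+1%:R].
    by apply: filter_forall => i; exact: cl.
  apply: filterS H => y H; apply: (le_trans (pnorm_le_sum _ _)).
  rewrite big_mkord; apply: (@le_trans _ _ (\sum_(i < N) e / N.+1%:R)).
    by apply: ler_sum => i _; exact: H.
  rewrite sumr_const card_ord -[leLHS]mulr_natr mulrAC ler_pdivrMr //.
  by rewrite ler_wpM2l ?ler_nat // ltW.
have key (e : R) : 0 < e -> exists2 A, F A &
    forall x, A x -> forall N, pnorm (fun n => (x n : R[i]) - l n) N <= e.
  move=> e0.
  have e3 : 0 < e / 3 by rewrite divr_gt0.
  have /cauchyP/(_ (e / 3)%:C%C) [|x0 Fx0] := Fc; first by rewrite ltcR.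
  exists (ball x0 (e / 3)%:C%C) => // x; rewrite -ball_normE /= => xx N.
  near F => y.
  have yN : pnorm (fun n => (y n : R[i]) - l n) N <= e / 3 by near: y; exact: clN.
  have yx : l2norm (x0 - y) < e / 3.
    rewrite -ltcR -ell2_normE.
    suff : ball x0 (e / 3)%:C%C y by rewrite -ball_normE.
    by near: y.
  have xx' : l2norm (x - x0) < e / 3 by rewrite -ltcR -ell2_normE distrC.
  pose a := fun n => (x n : R[i]) - x0 n; pose b := fun n => (x0 n : R[i]) - y n.
  have -> : (fun n => (x n : R[i]) - l n) =
      a \+ (b \+ (fun n => (y n : R[i]) - l n)).
    by apply/funext => n; rewrite /a /b /= !addrA subrK subrK.
  have e3E : e = e / 3 + (e / 3 + e / 3).
    by rewrite addrA -mulr2n -mulrSr -[RHS]mulr_natr divfK ?pnatr_eq0.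
  rewrite e3E; apply: (le_trans (pnormD _ _ _)); apply: lerD.
    apply: le_trans (ltW xx').
    exact: (pnorm_le_l2norm N (ell2_summable (x - x0))).
  apply: (le_trans (pnormD _ _ _)); apply: lerD => //.
  apply: le_trans (ltW yx).
  exact: (pnorm_le_l2norm N (ell2_summable (x0 - y))).
have sl : square_summable l.
  have [A FA HA] := key 1 ltr01.
  have [x Ax] := filter_ex FA.
  apply/square_summableP; exists (l2norm x + 1) => N.
  rewrite (_ : l = (x : nat -> R[i]) \+ (fun n => (-1) * ((x n : R[i]) - l n))).
    apply: (le_trans (pnormD _ _ _)); apply: lerD.
      exact/pnorm_le_l2norm/ell2_summable.
    by rewrite pnormZ normcN Normc.normc1 mul1r; exact: HA.
  by apply/funext => n /=; rewrite mulN1r opprB addrCA subrr addr0.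
apply/cvg_ex; exists (mk_ell2 sl); apply/cvgrPdist_le => e e0.
have [eIm eRe] : Im e = 0 /\ 0 < Re e.
  by move: e0; rewrite ltcE /= => /andP[/eqP -> ->].
have [A FA HA] := key _ eRe.
apply: filterS FA => x Ax.
rewrite distrC ell2_normE [e]complexE eIm mulr0 addr0 lecR.
by apply: l2norm_le => N; exact: HA.
Unshelve. all: by end_near. Qed.

HB.instance Definition _ := Uniform_isComplete.Build (ell2 R) ell2_complete.

End Ell2Norm.

Section AbsoluteSums.
Variable R : realType.
Implicit Types u v : nat -> R[i].
Local Notation nc := (@Normc.normc R).

Definition abs_summable u := cvgn (series (fun n => nc (u n))).

Lemma abs_summable_Re u : abs_summable u -> cvgn (series (fun n => Re (u n))).
Proof.
move=> cu; apply: normed_cvg; apply: series_le_cvg cu => n //=.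
- exact: normc_ge0.
- exact: Re_le_normc.
Qed.

Lemma abs_summable_Im u : abs_summable u -> cvgn (series (fun n => Im (u n))).
Proof.
move=> cu; apply: normed_cvg; apply: series_le_cvg cu => n //=.
- exact: normc_ge0.
- exact: Im_le_normc.
Qed.

Lemma limn_series_lin (c d : R) (a b e : nat -> R) :
  cvgn (series a) -> cvgn (series b) -> cvgn (series e) ->
  limn (series (fun n => c * a n + d * b n + e n)) =
  c * limn (series a) + d * limn (series b) + limn (series e).
Proof.
move=> ca cb ce; apply/cvg_lim => //.
rewrite (_ : series _ =
  (fun N => c * series a N + d * series b N + series e N)); last first.
  apply/funext => N; rewrite /series /= !big_split /=.
  by rewrite -!mulr_sumr.
apply: cvgD; last exact: ce.
by apply: cvgD; apply: cvgMr.
Qed.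

Lemma csumP (c : R[i]) u v : abs_summable u -> abs_summable v ->
  csum (fun n => c * u n + v n) = c * csum u + csum v.
Proof.
move=> cu cv; case: c => c d; rewrite /csum.
have [uR uI] := (abs_summable_Re cu, abs_summable_Im cu).
have [vR vI] := (abs_summable_Re cv, abs_summable_Im cv).
have -> : (fun n => Re (Complex c d * u n + v n)) =
    (fun n => c * Re (u n) + (- d) * Im (u n) + Re (v n)).
  by apply/funext => n; case: (u n) (v n) => [? ?] [? ?] /=; rewrite mulNr.
have -> : (fun n => Im (Complex c d * u n + v n)) =
    (fun n => c * Im (u n) + d * Re (u n) + Im (v n)).
  by apply/funext => n; case: (u n) (v n) => [? ?] [? ?] /=.
by rewrite !limn_series_lin // mulNr.
Qed.

Lemma csum_conjc u : abs_summable u ->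
  csum (fun n => conjc (u n)) = conjc (csum u).
Proof.
move=> cu; rewrite /csum /=.
have -> : (fun n => Re (conjc (u n))) = (fun n => Re (u n)).
  by apply/funext => n; case: (u n).
congr Complex.
have -> : (fun n => Im (conjc (u n))) = - (fun n => Im (u n)).
  by apply/funext => n; rewrite opprfctE; case: (u n).
rewrite seriesN limN //; exact: abs_summable_Im.
Qed.

End AbsoluteSums.

Section Ell2Correspondence.
Variable R : realType.
Implicit Types x y z : ell2 R.
Local Notation nc := (@Normc.normc R).

Definition ell2_inner x y : scalars R :=
  csum (fun n => conjc (x n : R[i]) * (y n : R[i])).

Lemma ell2_abs_summable x y :
  abs_summable (fun n => conjc (x n : R[i]) * (y n : R[i])).
Proof.
have cxy : cvgn (series (fun n => nc (x n) ^+ 2 + nc (y n) ^+ 2)).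
  rewrite (_ : series _ =
    series (fun n => nc (x n) ^+ 2) + series (fun n => nc (y n) ^+ 2)).
    by apply: is_cvgD; exact: ell2_summable.
  by apply/funext => N; rewrite /series /= big_split.
apply: series_le_cvg cxy => n //.
- exact: normc_ge0.
- by rewrite addr_ge0 ?sqr_ge0.
rewrite Normc.normcM normc_conjc.
set a := nc _; set b := nc _.
have ab : 0 <= (a - b) ^+ 2 by exact: sqr_ge0.
have a0 : 0 <= a * b by rewrite mulr_ge0 ?normc_ge0.
rewrite sqrrB addrAC subr_ge0 in ab; apply: le_trans ab.
by rewrite mulr2n lerDl.
Qed.

Fact ell2_innerP (c : R[i]) x y z :
  ell2_inner x (c *: y + z) = c *: ell2_inner x y + ell2_inner x z.
Proof.
rewrite -[RHS]/(c * csum _ + csum _) -csumP; try exact: ell2_abs_summable.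
congr csum; apply/funext => n.
by rewrite ell2_funD ell2_funZ /= mulrDr mulrCA.
Qed.

Fact ell2_innerJ x y : star (ell2_inner x y) = ell2_inner y x.
Proof.
rewrite -[LHS]/(conjc (csum _)) -csum_conjc; last exact: ell2_abs_summable.
by congr csum; apply/funext => n; rewrite rmorphM /= conjcK mulrC.
Qed.

Lemma ell2_innerxx x : ell2_inner x x = ((l2norm x) ^+ 2)%:C%C.
Proof.
have E n : conjc (x n : R[i]) * (x n : R[i]) = (nc (x n) ^+ 2)%:C%C.
  rewrite sqr_normc; case: (x n : R[i]) => a b /=.
  by simpc; rewrite -!expr2 mulrC subrr.
rewrite /ell2_inner /csum; apply/eqP; rewrite eq_complex /=; apply/andP; split.
  rewrite sqr_sqrtr; last first.
    apply: limr_ge; first exact: ell2_summable.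
    by near=> N; exact: psum_ge0.
  by apply/eqP; congr (limn (series _)); apply/funext => n; rewrite E.
rewrite (_ : series _ = fun=> 0) ?lim_cst //.
by apply/funext => N; rewrite /series /= big1 // => i _; rewrite E.
Unshelve. all: by end_near. Qed.

Lemma l2norm_ge0 x : 0 <= l2norm x. Proof. exact: sqrtr_ge0. Qed.

Fact ell2_inner_positive x : cpositive (ell2_inner x x).
Proof.
exists ((l2norm x)%:C%C : R[i]); rewrite ell2_innerxx.
rewrite -[RHS]/(conjc (l2norm x)%:C%C * (l2norm x)%:C%C).
by rewrite expr2 rmorphM /= /real_complex_def oppr0.
Qed.

Fact ell2_norm_inner x : `|x| ^+ 2 = `|ell2_inner x x|.
Proof.
rewrite ell2_innerxx ell2_normE -[RHS]/(`|((l2norm x) ^+ 2)%:C%C : R[i]|).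
by rewrite ger0_norm ?ler0c ?sqr_ge0 // rmorphXn.
Qed.

(* ell^2(N) as a correspondence over C: both actions are multiplication by
   scalars. *)
Definition ell2_ract x (a : scalars R) : ell2 R := (a : R[i]) *: x.
Definition ell2_lact (a : scalars R) x : ell2 R := (a : R[i]) *: x.

Fact ell2_ractDl x y (a : scalars R) :
  ell2_ract (x + y) a = ell2_ract x a + ell2_ract y a.
Proof. exact: scalerDr. Qed.
Fact ell2_ractDr x (a b : scalars R) :
  ell2_ract x (a + b) = ell2_ract x a + ell2_ract x b.
Proof. exact: scalerDl. Qed.
Fact ell2_ractZl (c : R[i]) x (a : scalars R) :
  ell2_ract (c *: x) a = c *: ell2_ract x a.
Proof. by rewrite /ell2_ract !scalerA mulrC. Qed.
Fact ell2_ractZr (c : R[i]) x (a : scalars R) :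
  ell2_ract x (c *: a) = c *: ell2_ract x a.
Proof. by rewrite /ell2_ract scalerA. Qed.
Fact ell2_ractM x (a b : scalars R) :
  ell2_ract x (a ** b) = ell2_ract (ell2_ract x a) b.
Proof. by rewrite /ell2_ract scalerA mulrC. Qed.
Fact ell2_inner_ract x y (a : scalars R) :
  ell2_inner x (ell2_ract y a) = ell2_inner x y ** a.
Proof.
have := ell2_innerP a x y 0.
rewrite addr0 => ->.
have -> : ell2_inner x 0 = 0.
  have := ell2_innerP 1 x 0 0; rewrite scaler0 addr0 scale1r.
  by move/eqP; rewrite -[X in X == _]add0r (inj_eq (addIr _)) => /eqP <-.
by rewrite addr0 -[LHS]/((a : R[i]) * (_ : R[i])) mulrC.
Qed.
Fact ell2_lactP (c : R[i]) (a b : scalars R) x :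
  ell2_lact (c *: a + b) x = c *: ell2_lact a x + ell2_lact b x.
Proof. by rewrite /ell2_lact scalerDl scalerA. Qed.
Fact ell2_lactM (a b : scalars R) x :
  ell2_lact (a ** b) x = ell2_lact a (ell2_lact b x).
Proof. by rewrite /ell2_lact scalerA. Qed.
Fact ell2_lactJ (a : scalars R) x y :
  ell2_inner (ell2_lact a x) y = ell2_inner x (ell2_lact (star a) y).
Proof.
congr csum; apply/funext => n.
by rewrite /ell2_lact !ell2_funZ rmorphM /= mulrCA mulrA.
Qed.
Fact ell2_lact_nondegenerate :
  closed_span [set z | exists (a : scalars R) x, z = ell2_lact a x] = setT.
Proof.
apply/seteqP; split=> // x _; apply: subset_closure.
exists 1%N, (fun=> 1), (fun=> x); split.
  by move=> _; exists (1 : R[i]), x; rewrite /ell2_lact scale1r.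
by rewrite big_ord1 scale1r.
Qed.

HB.instance Definition _ := isCorrespondence.Build R (scalars R) (ell2 R)
  ell2_ractDl ell2_ractDr ell2_ractZl ell2_ractZr ell2_ractM
  ell2_innerP ell2_inner_ract ell2_innerJ ell2_inner_positive ell2_norm_inner
  ell2_lactP ell2_lactM ell2_lactJ ell2_lact_nondegenerate.

End Ell2Correspondence.

(* Main.v *)
Require Import Defs.
From HB Require Import structures.
From mathcomp Require Import all_boot all_order all_algebra.
From mathcomp Require Import all_classical all_reals all_analysis.
From mathcomp Require Import complex ring lra spectral sesquilinear.

(** The action comes from a permutation action of G on the basis of l^2(N)
    which fixes one basis vector and is free on the others, so that G acts on
    l^2(N) by the sum of the trivial representation and of copies of the
    regular representation lambda.  Write s_n for the canonical isometries,
    with s_0 the fixed one, ' for adjoints, and eps for the trivial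
    representation of C*(G).

    The correspondence of the crossed product is l^2(N) x C*(G) over C*(G).  Let
    a be an element of C*(G) with lambda(a) = 0.  For n <> 0 freeness gives
    s_n' c s_n = tau(c), where tau is the canonical trace; taking c = a' a yields
    a s_n = 0.  Hence a acts as the rank one operator theta(s_0 a, s_0), which
    is compact; and the left action is faithful, because of the fixed vector.
    So a lies in the Katsura ideal, and covariance imposes the relation
    a = s_0 a s_0' in the Cuntz-Pimsner algebra of the crossed product
    (lact_a0, katsura_a0).  No such relation holds in the crossed product of
    O_X: on Fock space, with G acting by second quantization, the vacuum Om is
    fixed by G and killed by s_0', so (a - s_0 a s_0') Om = eps(a) Om
    (fock_exists).  It remains to find a with lambda(a) = 0 and eps(a) <> 0
    (separating_element).  If there were none, eps would factor through
    lambda, hence |eps(b)| <= ||lambda(b)|| for all b (dominated_of_ker).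
    Applied to sums of group elements this produces almost invariant vectors in
    l^2(N), and the limit along an ultrafilter of the states that they define
    on the bounded functions on G is an invariant mean (amenable_of_norm).

    The homomorphism itself, and the action, are obtained from universal
    properties.  Since l^2(N) is infinite dimensional, no non-zero scalar acts
    on it by a compact operator, so the Katsura ideal of l^2(N) is zero and
    both T_X and O_X are universal for isometric maps t with
    t(x)' t(y) = <x, y> (universal_rep).  That such a t is automatically
    completely contractive and induces a homomorphism on compact operators
    (cc_of_inner, psi_map_is_psi), and that the comparison map is onto
    (lift_closure_range), rests on some general theory of C*-algebras, which
    is developed by elementary means: a square root of 1 - y by iteration
    (sqrt_exists), the remark that p is a real part of a unitary when
    p^2 + q^2 = 1 with p and q commuting (commuting_squares_le), and the fact
    that the C*-identity turns bounds on powers of a self-adjoint element into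
    bounds on its norm (power_trick).  They give the contractivity of
    homomorphisms, the positivity of b' b (pos_cstar) and the Cauchy-Schwarz
    inequality (cauchy_schwarz). *)

Set Implicit Arguments.
Unset Strict Implicit.
Unset Printing Implicit Defensive.

Import Order.TTheory GRing.Theory Num.Theory.
Import numFieldNormedType.Exports.

Local Open Scope classical_set_scope.
Local Open Scope ring_scope.
Local Open Scope sesquilinear_scope.

(** * Real-valued norms and limits *)

Lemma normcr (R : realType) (r : R) : Normc.normc r%:C%C = `|r|.
Proof. by rewrite /= expr0n addr0 sqrtr_sqr. Qed.

Section RealNorm.
Variables (R : realType) (V : normedModType R[i]).
Implicit Types (x y z : V) (e : R).

(** Norms take their values in R[i]; the real number behind them is accessible
    to linear arithmetic. *)
Definition nm x : R := complex.Re `|x|.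

Lemma nmE x : `|x| = (nm x)%:C%C.
Proof.
have := normr_ge0 x; rewrite /nm; case: (`|x|) => a b.
by rewrite lecE /= => /andP[/eqP -> _].
Qed.

Lemma nm_ge0 x : 0 <= nm x.
Proof. by rewrite -ler0c -nmE normr_ge0. Qed.

Lemma nm_le x (r : R) : (`|x| <= r%:C%C) = (nm x <= r).
Proof. by rewrite nmE lecR. Qed.

Lemma nmD x y : nm (x + y) <= nm x + nm y.
Proof. by rewrite -nm_le rmorphD /= -!nmE ler_normD. Qed.

Lemma nmN x : nm (- x) = nm x.
Proof. by rewrite /nm normrN. Qed.

Lemma nmB x y : nm (x - y) <= nm x + nm y.
Proof. by rewrite -(nmN y) nmD. Qed.

Lemma nm_dist x y : nm (x - y) = nm (y - x).
Proof. by rewrite -nmN opprB. Qed.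

Lemma nm_tri y x z : nm (x - z) <= nm (x - y) + nm (y - z).
Proof. by have := nmD (x - y) (y - z); rewrite addrA subrK. Qed.

Lemma nm0 : nm (0 : V) = 0.
Proof. by rewrite /nm normr0. Qed.

Lemma nm_eq0 x : nm x = 0 -> x = 0.
Proof. by move=> h; apply: normr0_eq0; rewrite nmE h. Qed.

Lemma nm_le0 x : nm x <= 0 -> x = 0.
Proof. by move=> h; apply/nm_eq0/le_anti; rewrite h nm_ge0. Qed.

Lemma nmZ (c : R[i]) x : nm (c *: x) = Normc.normc c * nm x.
Proof. by apply: complexI; rewrite -nmE normrZ normr_normc nmE -rmorphM. Qed.

Lemma nmZr (r : R) x : 0 <= r -> nm (r%:C%C *: x) = r * nm x.
Proof. by move=> r0; rewrite nmZ normcr ger0_norm. Qed.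

Lemma nm_sum (I : Type) (s : seq I) (F : I -> V) :
  nm (\sum_(i <- s) F i) <= \sum_(i <- s) nm (F i).
Proof.
elim/big_ind2: _ => [|a b c d ab cd|//]; first by rewrite nm0.
by apply: le_trans (nmD _ _) _; apply: lerD.
Qed.

Definition tends (u : nat -> V) x : Prop :=
  forall e, 0 < e -> exists N, forall n, (N <= n)%N -> nm (u n - x) <= e.

Lemma closure_nmP (S : set V) x :
  closure S x <-> forall e, 0 < e -> exists2 y, S y & nm (y - x) <= e.
Proof.
split=> [cS e e0|h B /nbhs_ballP [e /= e0]].
  have eC : (0 : R[i]) < e%:C%C by rewrite ltcR.
  have [y [Sy]] := cS _ (nbhsx_ballx x e%:C%C eC).
  rewrite -ball_normE /= nmE ltcR nm_dist => /ltW; by exists y.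
have [eI eR] : complex.Im e = 0 /\ 0 < complex.Re e.
  by move: e0; rewrite ltcE /= => /andP[/eqP -> ->].
have [//|y Sy yx] := h (complex.Re e / 2); first by rewrite divr_gt0.
move/(_ y) => By; exists y; split=> //; apply: By.
rewrite -ball_normE /= nmE [e]complexE eI mulr0 addr0 ltcR nm_dist.
by apply: le_lt_trans yx _; lra.
Qed.

Lemma closedP (S : set V) : closed S <->
  (forall x, (forall e, 0 < e -> exists2 y, S y & nm (y - x) <= e) -> S x).
Proof.
split=> [cS x h|h x /closure_nmP]; last exact: h.
by apply: cS; apply/closure_nmP.
Qed.

Lemma tends_cst x : tends (fun=> x) x.
Proof. by move=> e e0; exists 0%N => n _; rewrite subrr nm0 ltW. Qed.

Lemma tendsD u v x y : tends u x -> tends v y ->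
  tends (fun n => u n + v n) (x + y).
Proof.
move=> ux vy e e0; have e2 : 0 < e / 2 by rewrite divr_gt0.
have [N uN] := ux _ e2; have [M vM] := vy _ e2.
exists (maxn N M) => n; rewrite geq_max => /andP[Nn Mn].
rewrite opprD addrACA; apply: le_trans (nmD _ _) _.
by have := uN _ Nn; have := vM _ Mn; lra.
Qed.

Lemma tends_unique u x y : tends u x -> tends u y -> x = y.
Proof.
move=> ux uy; apply/eqP; rewrite -subr_eq0; apply/eqP/nm_le0/ler_addgt0Pr => e e0.
have e2 : 0 < e / 2 by rewrite divr_gt0.
have [N uN] := ux _ e2; have [M vM] := uy _ e2.
have := uN (maxn N M) (leq_maxl _ _); have := vM (maxn N M) (leq_maxr _ _).
have := nm_tri (u (maxn N M)) x y; have := nm_dist x (u (maxn N M)); lra.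
Qed.

Lemma tends_eq u v x : (forall n, u n = v n) -> tends u x -> tends v x.
Proof. by move=> /funext ->. Qed.

Lemma tends_nm_le u x (r : R) : tends u x -> (forall n, nm (u n) <= r) -> nm x <= r.
Proof.
move=> ux ur; apply/ler_addgt0Pr => e e0; have [N /(_ N (leqnn N)) h] := ux _ e0.
have := nm_tri (u N) x 0; rewrite !subr0 nm_dist; have := ur N; lra.
Qed.

Lemma tendsS u x : tends u x -> tends (fun n => u n.+1) x.
Proof.
by move=> ux e /ux [N uN]; exists N => n Nn; apply: uN; apply: leqW.
Qed.

End RealNorm.

Lemma tends_lip (R : realType) (V W : normedModType R[i]) (f : V -> W) (k : R)
    (u : nat -> V) x : (forall y, nm (f y - f x) <= k * nm (y - x)) ->
  tends u x -> tends (f \o u) (f x).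
Proof.
move=> fk ux e e0.
have k1 : 0 < `|k| + 1 by rewrite ltr_wpDl.
have [N uN] : exists N, forall n, (N <= n)%N -> nm (u n - x) <= e / (`|k| + 1).
  by apply: ux; rewrite divr_gt0.
exists N => n /uN h; apply: le_trans (fk _) _.
apply: (@le_trans _ _ ((`|k| + 1) * nm (u n - x))).
  by rewrite ler_wpM2r ?nm_ge0 // (le_trans (ler_norm k)) // lerDl.
by rewrite -ler_pdivlMl // mulrC.
Qed.

Section Complete.
Variables (R : realType) (V : completeNormedModType R[i]).

Lemma cauchy_tends (u : nat -> V) :
  (forall e : R, 0 < e -> exists N, forall n m, (N <= n)%N -> (N <= m)%N ->
     nm (u n - u m) <= e) ->
  exists x, tends u x.
Proof.
move=> cu.
have : cvgn u.
  apply: cauchy_cvg; apply: cauchy_exP => e e0.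
  have [eI eR] : complex.Im e = 0 /\ 0 < complex.Re e.
    by move: e0; rewrite ltcE /= => /andP[/eqP -> ->].
  have [|N uN] := cu (complex.Re e / 2); first by rewrite divr_gt0.
  exists (u N); exists N => // n /= Nn.
  rewrite -ball_normE /= nmE [e]complexE eI mulr0 addr0 ltcR.
  by apply: le_lt_trans (uN _ _ _ Nn) _ => //; lra.
move=> cvu; exists (limn u) => e e0.
have /cvgrPdist_le := cvu => /(_ e%:C%C); rewrite ltcR => /(_ e0) [N _ uN].
by exists N => n Nn; have := uN n Nn; rewrite nmE lecR nm_dist.
Qed.

(** The scalar sequence r is nondecreasing and bounded, hence Cauchy, and the
    increments of u are dominated by those of r. *)
Lemma dominated_tends (u : nat -> V) (r : nat -> R) (M : R) :
  (forall n, nm (u n.+1 - u n) <= r n.+1 - r n) -> (forall n, r n <= M) ->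
  exists x, tends u x.
Proof.
move=> ur rM.
have ur2 n k : nm (u (n + k)%N - u n) <= r (n + k)%N - r n.
  elim: k => [|k IH]; first by rewrite addn0 !subrr nm0.
  rewrite addnS; have := ur (n + k)%N; move: IH.
  have := nm_tri (u (n + k)%N) (u (n + k).+1) (u n); lra.
have rnd : nondecreasing_seq r.
  by apply/nondecreasing_seqP => n; have := ur n; have := nm_ge0 (u n.+1 - u n); lra.
have cr : cvgn r.
  by apply: nondecreasing_is_cvgn => //; exists M => _ [n _ <-].
apply: cauchy_tends => e e0.
have /cvgrPdist_le /(_ (e / 2)) [|N _ rN] := cr; first by rewrite divr_gt0.
exists N => n m Nn Nm.
wlog nm' : n m Nn Nm / (n <= m)%N.
  move=> H; case: (leqP n m) => [|/ltnW] h; first exact: H.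
  by rewrite nm_dist; apply: H.
rewrite nm_dist -(subnKC nm'); apply: le_trans (ur2 _ _) _.
rewrite subnKC //; have /= := rN n Nn; have /= := rN m Nm.
rewrite !ler_norml => /andP[? _] /andP[_ ?]; lra.
Qed.

End Complete.

(** * Elementary facts on C*-algebras *)

Section CStarBasics.
Variables (R : realType) (B : cstarAlgType R).
Implicit Types (x y z : B) (c : R[i]).

Lemma cmul0l x : 0 ** x = 0.
Proof. by have := cmulZl 0 0 x; rewrite !scale0r. Qed.
Lemma cmul0r x : x ** 0 = 0.
Proof. by have := cmulZr 0 x 0; rewrite !scale0r. Qed.
Lemma cmulNl x y : (- x) ** y = - (x ** y).
Proof. by rewrite -scaleN1r cmulZl scaleN1r. Qed.
Lemma cmulNr x y : x ** (- y) = - (x ** y).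
Proof. by rewrite -scaleN1r cmulZr scaleN1r. Qed.
Lemma cmulBl x y z : (x - y) ** z = x ** z - y ** z.
Proof. by rewrite cmulDl cmulNl. Qed.
Lemma cmulBr x y z : x ** (y - z) = x ** y - x ** z.
Proof. by rewrite cmulDr cmulNr. Qed.
Lemma cmul_suml (I : Type) (s : seq I) (F : I -> B) x :
  (\sum_(i <- s) F i) ** x = \sum_(i <- s) F i ** x.
Proof.
by elim/big_rec2: _ => [|i a b _ <-]; rewrite ?cmul0l ?cmulDl.
Qed.
Lemma cmul_sumr (I : Type) (s : seq I) (F : I -> B) x :
  x ** (\sum_(i <- s) F i) = \sum_(i <- s) x ** F i.
Proof.
by elim/big_rec2: _ => [|i a b _ <-]; rewrite ?cmul0r ?cmulDr.
Qed.

Lemma star0 : star (0 : B) = 0.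
Proof. by have := starZ 0 (0 : B); rewrite rmorph0 !scale0r. Qed.
Lemma starN x : star (- x) = - star x.
Proof. by rewrite -scaleN1r starZ rmorphN1 scaleN1r. Qed.
Lemma starB x y : star (x - y) = star x - star y.
Proof. by rewrite starD starN. Qed.
Lemma star_sum (I : Type) (s : seq I) (F : I -> B) :
  star (\sum_(i <- s) F i) = \sum_(i <- s) star (F i).
Proof. by elim/big_rec2: _ => [|i a b _ <-]; rewrite ?star0 ?starD. Qed.
Lemma starZr (r : R) x : star (r%:C%C *: x) = r%:C%C *: star x.
Proof. by rewrite starZ conjc_real. Qed.

Lemma nmM x y : nm (x ** y) <= nm x * nm y.
Proof. by rewrite -nm_le rmorphM /= -!nmE norm_cmul. Qed.

Lemma nm_cstar x : nm (star x ** x) = nm x ^+ 2.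
Proof. by apply: complexI; rewrite -nmE cstar_identity nmE rmorphXn. Qed.

(** From |y|^2 = |y' y| <= |y'| |y|, for y = x and for y = x'. *)
Lemma nm_star x : nm (star x) = nm x.
Proof.
have le y : nm y <= nm (star y).
  have [->|y0] := eqVneq (nm y) 0; first exact: nm_ge0.
  have yp : 0 < nm y by rewrite lt_def y0 nm_ge0.
  by rewrite -(ler_pM2r yp) -expr2 -nm_cstar nmM.
by apply/le_anti; rewrite le -{2}(starK x) le.
Qed.


Lemma cstar_eq0 x : star x ** x = 0 -> x = 0.
Proof.
move=> h; have := nm_cstar x; rewrite h nm0 => /esym/eqP.
by rewrite expf_eq0 /= => /eqP /nm_eq0.
Qed.

Lemma tends_mull (u : nat -> B) x y : tends u x -> tends (fun n => y ** u n) (y ** x).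
Proof.
by apply: (@tends_lip _ _ _ _ (nm y)) => z; rewrite -cmulBr nmM.
Qed.

Lemma tends_mulr (u : nat -> B) x y : tends u x -> tends (fun n => u n ** y) (x ** y).
Proof.
by apply: (@tends_lip _ _ _ (fun z => z ** y) (nm y)) => z; rewrite -cmulBl mulrC nmM.
Qed.

Lemma tends_star (u : nat -> B) x : tends u x -> tends (fun n => star (u n)) (star x).
Proof.
by apply: (@tends_lip _ _ _ _ 1) => z; rewrite -starB nm_star mul1r.
Qed.

Lemma tendsM (u v : nat -> B) x y : tends u x -> tends v y ->
  tends (fun n => u n ** v n) (x ** y).
Proof.
move=> ux vy e e0.
have [K hK] := ux _ ltr01.
have Mp : 0 < nm x + 1 by rewrite ltr_wpDl ?nm_ge0.
have yp : 0 < nm y + 1 by rewrite ltr_wpDl ?nm_ge0.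
have [N uN] : exists N, forall n, (N <= n)%N -> nm (u n - x) <= e / 2 / (nm y + 1).
  by apply: ux; rewrite !divr_gt0.
have [M vM] : exists N, forall n, (N <= n)%N -> nm (v n - y) <= e / 2 / (nm x + 1).
  by apply: vy; rewrite !divr_gt0.
exists (maxn K (maxn N M)) => n; rewrite !geq_max => /and3P[Kn Nn Mn].
have -> : u n ** v n - x ** y = u n ** (v n - y) + (u n - x) ** y.
  by rewrite cmulBr cmulBl addrA subrK.
have := nmD (u n ** (v n - y)) ((u n - x) ** y).
have h1 : nm (u n) <= nm x + 1.
  by have := nm_tri x (u n) 0; rewrite !subr0; have := hK _ Kn; lra.
have h2 : nm (u n ** (v n - y)) <= e / 2.
  apply: le_trans (nmM _ _) _; apply: (@le_trans _ _ ((nm x + 1) * nm (v n - y))).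
    by rewrite ler_wpM2r ?nm_ge0.
  by rewrite -ler_pdivlMl // mulrC vM.
have h3 : nm ((u n - x) ** y) <= e / 2.
  apply: le_trans (nmM _ _) _; apply: (@le_trans _ _ (nm (u n - x) * (nm y + 1))).
    by rewrite ler_wpM2l ?nm_ge0 // lerDl.
  by rewrite -ler_pdivlMr // uN.
lra.
Qed.

Definition selfadj x := star x = x.

Lemma selfadjD x y : selfadj x -> selfadj y -> selfadj (x + y).
Proof. by rewrite /selfadj starD => -> ->. Qed.
Lemma selfadjB x y : selfadj x -> selfadj y -> selfadj (x - y).
Proof. by rewrite /selfadj starB => -> ->. Qed.
Lemma selfadjZ (r : R) x : selfadj x -> selfadj (r%:C%C *: x).
Proof. by rewrite /selfadj starZr => ->. Qed.
Lemma selfadjM x y : selfadj x -> selfadj y -> x ** y = y ** x -> selfadj (x ** y).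
Proof. by rewrite /selfadj starM => -> -> ->. Qed.
Lemma selfadj_cstar x : selfadj (star x ** x).
Proof. by rewrite /selfadj starM starK. Qed.
Lemma selfadj_tends (u : nat -> B) x : (forall n, selfadj (u n)) -> tends u x -> selfadj x.
Proof.
move=> su ux; apply: (tends_unique _ ux); apply: tends_eq (tends_star ux) => n.
exact: su.
Qed.

Lemma nm_sq x : selfadj x -> nm (x ** x) = nm x ^+ 2.
Proof. by move=> sx; rewrite -nm_cstar sx. Qed.

Lemma selfadj_sq_eq0 x : selfadj x -> x ** x = 0 -> x = 0.
Proof. by move=> sx x0; apply: cstar_eq0; rewrite sx. Qed.

Definition commutes x y := x ** y = y ** x.

Lemma commutesM x y z : commutes x z -> commutes y z -> commutes (x ** y) z.
Proof. by rewrite /commutes => xz yz; rewrite -cmulA yz !cmulA xz. Qed.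
Lemma commutesD x y z : commutes x z -> commutes y z -> commutes (x + y) z.
Proof. by rewrite /commutes cmulDl cmulDr => -> ->. Qed.
Lemma commutesZ c x z : commutes x z -> commutes (c *: x) z.
Proof. by rewrite /commutes cmulZl cmulZr => ->. Qed.
Lemma commutesB x y z : commutes x z -> commutes y z -> commutes (x - y) z.
Proof. by rewrite /commutes cmulBl cmulBr => -> ->. Qed.
Lemma commutes_tends (u : nat -> B) x z : (forall n, commutes (u n) z) ->
  tends u x -> commutes x z.
Proof.
move=> cu ux; apply: (@tends_unique _ _ (fun n => u n ** z)).
  exact: tends_mulr.
by apply: tends_eq (tends_mull z ux) => n; rewrite cu.
Qed.

Definition is_unit e := (forall x, e ** x = x) /\ (forall x, x ** e = x).

End CStarBasics.

Section StarHom.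
Variables (R : realType) (B D : cstarAlgType R) (P : B -> D).
Hypothesis hP : star_hom P.

Lemma star_homD x y : P (x + y) = P x + P y.
Proof. by have [L _ _] := hP; have := L 1 x y; rewrite !scale1r. Qed.
Lemma star_hom0 : P 0 = 0.
Proof. by apply: (addrI (P 0)); rewrite -star_homD !addr0. Qed.
Lemma star_homZ c x : P (c *: x) = c *: P x.
Proof. by have [L _ _] := hP; have := L c x 0; rewrite !addr0 star_hom0 addr0. Qed.
Lemma star_homN x : P (- x) = - P x.
Proof. by rewrite -scaleN1r star_homZ scaleN1r. Qed.
Lemma star_homB x y : P (x - y) = P x - P y.
Proof. by rewrite star_homD star_homN. Qed.
Lemma star_homM x y : P (x ** y) = P x ** P y.
Proof. by have [_ M _] := hP; apply: M. Qed.
Lemma star_homS x : P (star x) = star (P x).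
Proof. by have [_ _ S] := hP; apply: S. Qed.
Lemma star_hom_selfadj x : selfadj x -> selfadj (P x).
Proof. by rewrite /selfadj -star_homS => ->. Qed.
Lemma star_hom_sum (I : Type) (s : seq I) (F : I -> B) :
  P (\sum_(i <- s) F i) = \sum_(i <- s) P (F i).
Proof. by elim/big_rec2: _ => [|i a b _ <-]; rewrite ?star_hom0 ?star_homD. Qed.
End StarHom.

Lemma star_hom_comp (R : realType) (B D E : cstarAlgType R) (P : D -> E) (Q : B -> D) :
  star_hom P -> star_hom Q -> star_hom (P \o Q).
Proof.
move=> [pl pm ps] [ql qm qs]; split=> [c x y|x y|x] /=.
- by rewrite ql pl.
- by rewrite qm pm.
- by rewrite qs ps.
Qed.

Lemma bernoulli (R : realFieldType) (d : R) n : 0 <= d -> 1 + n%:R * d <= (1 + d) ^+ n.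
Proof.
move=> d0; elim: n => [|n IH]; first by rewrite mul0r addr0 expr0.
rewrite exprS -natr1; have : 0 <= n%:R * d * d by rewrite !mulr_ge0.
have : (1 + d) * (1 + n%:R * d) <= (1 + d) * (1 + d) ^+ n.
  by rewrite ler_wpM2l // addr_ge0.
lra.
Qed.

(** Squaring the Bernoulli bound makes the left-hand side quadratic in 2^m. *)
Lemma no_exp_growth (R : realType) (d C D : R) : 0 < d -> 0 <= C -> 0 <= D ->
  (forall m, (1 + d) ^+ (2 ^ m) <= C + D * (2 ^ m)%:R) -> False.
Proof.
move=> d0 C0 D0 h.
have key m : m%:R * d ^+ 2 <= C + 2 * D.
  have N1 : 1 <= (2 ^ m)%:R :> R by rewrite ler1n expn_gt0.
  have mN : m%:R <= (2 ^ m)%:R :> R by rewrite ler_nat ltnW // ltn_expl.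
  set N : R := (2 ^ m)%:R in N1 mN *.
  have b := bernoulli (2 ^ m) (ltW d0).
  have := h m.+1; rewrite expnSr exprM natrM -/N => h2.
  have h3 : (1 + N * d) ^+ 2 <= C + D * (N * 2).
    by apply: le_trans h2; rewrite lerXn2r ?nnegrE ?addr_ge0 ?mulr_ge0 ?exprn_ge0 ?addr_ge0 // ltW.
  apply: (@le_trans _ _ (N * d ^+ 2)); first by rewrite ler_wpM2r ?sqr_ge0.
  rewrite -(ler_pM2l (lt_le_trans ltr01 N1)).
  have : 0 <= N * d by rewrite mulr_ge0 // ltW.
  have : 0 <= (N - 1) * C by rewrite mulr_ge0 // subr_ge0.
  move: h3; rewrite !expr2; lra.
have [m] : exists m : nat, (C + 2 * D) / d ^+ 2 < m%:R.
  by exists (Num.truncn ((C + 2 * D) / d ^+ 2)).+1; rewrite truncnS_gt.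
by rewrite ltr_pdivrMr ?exprn_gt0 // ltNge key.
Qed.

Section Unital.
Variables (R : realType) (B : cstarAlgType R) (e : B).
Hypothesis he : is_unit e.
Implicit Types (x y z : B) (c : R[i]) (r : R).

Let mul1 x : e ** x = x. Proof. by case: he. Qed.
Let mulr1 x : x ** e = x. Proof. by case: he. Qed.

Lemma selfadj_unit : selfadj e.
Proof. by rewrite /selfadj -[star e]mulr1 -{2}(starK e) -starM mulr1 starK. Qed.

Lemma nm_unit : nm e <= 1.
Proof.
have := nm_sq selfadj_unit; rewrite mul1; have := nm_ge0 e; nra.
Qed.

Lemma commutes_unit x : commutes e x.
Proof. by rewrite /commutes mul1 mulr1. Qed.

Definition upow x n := iter n (cmul x) e.

Lemma upowS x n : upow x n.+1 = x ** upow x n. Proof. by []. Qed.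

Lemma upowD x n m : upow x (n + m) = upow x n ** upow x m.
Proof. by elim: n => [|n IH]; rewrite ?mul1 // addSn !upowS IH cmulA. Qed.

Lemma upowSr x n : upow x n.+1 = upow x n ** x.
Proof. by rewrite -addn1 upowD /= mulr1. Qed.

Lemma selfadj_upow x n : selfadj x -> selfadj (upow x n).
Proof.
move=> sx; elim: n => [|n IH]; first exact: selfadj_unit.
by apply: selfadjM => //; rewrite -upowS upowSr.
Qed.

Lemma nm_upow2 x m : selfadj x -> nm (upow x (2 ^ m)) = nm x ^+ (2 ^ m).
Proof.
move=> sx; elim: m => [|m IH]; first by rewrite /= mulr1 expr1.
rewrite expnS mul2n -addnn upowD nm_sq; last exact: selfadj_upow.
by rewrite IH expr2 exprD.
Qed.

(** The C*-identity makes the norm of a self-adjoint element its spectral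
    radius, so that bounds on powers need only hold up to a linear factor. *)
Lemma power_trick x r (C D : R) : selfadj x -> 0 < r -> 0 <= C -> 0 <= D ->
  (forall n, nm (upow x n) <= (C + D * n%:R) * r ^+ n) -> nm x <= r.
Proof.
move=> sx r0 C0 D0 h; rewrite leNgt; apply/negP => rx.
apply: (@no_exp_growth _ (nm x / r - 1) C D) => //.
  by rewrite subr_gt0 ltr_pdivlMr // mul1r.
move=> m; rewrite addrC subrK expr_div_n ler_pdivrMr ?exprn_gt0 // -nm_upow2 //.
Qed.

End Unital.

(** * Square roots and positivity without spectral theory *)

Section SquareRoot.
Variables (R : realType) (B : cstarAlgType R).
Implicit Types (x y z : B) (r : R).

Local Notation half := ((2^-1 : R)%:C%C).

Lemma half_twice x : half *: (x + x) = x.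
Proof.
rewrite -mulr2n -[x *+ 2]scaler_nat scalerA -[X in _ * X](rmorph_nat (real_complex R)).
by rewrite -rmorphM /= mulVf ?pnatr_eq0 // scale1r.
Qed.

Fixpoint sqrt_iter y n : B :=
  if n is n'.+1 then half *: (y + sqrt_iter y n' ** sqrt_iter y n') else 0.

Fixpoint sqrt_bound n : R :=
  if n is n'.+1 then 2^-1 * (1 + sqrt_bound n' * sqrt_bound n') else 0.

Lemma sqrt_bound01 n : 0 <= sqrt_bound n <= 1.
Proof. by elim: n => [|n /andP[IH0 IH1]] /=; [lra | nra]. Qed.

Lemma sqrt_iter_commutes y z n : commutes y z -> commutes (sqrt_iter y n) z.
Proof.
move=> yz; elim: n => [|n IH] /=; first by rewrite /commutes cmul0l cmul0r.
by apply/commutesZ/commutesD => //; apply: commutesM.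
Qed.

Lemma sqrt_iter_le y n : nm y <= 1 -> nm (sqrt_iter y n) <= sqrt_bound n.
Proof.
move=> y1; elim: n => [|n IH] /=; first by rewrite nm0.
rewrite nmZr ?invr_ge0 // ler_wpM2l ?invr_ge0 //.
apply: le_trans (nmD _ _) _; apply: lerD => //; apply: le_trans (nmM _ _) _.
by rewrite ler_pM ?nm_ge0.
Qed.

Lemma sqrt_iter_step y n : nm y <= 1 ->
  nm (sqrt_iter y n.+1 - sqrt_iter y n) <= sqrt_bound n.+1 - sqrt_bound n.
Proof.
move=> y1; elim: n => [|n IH].
  rewrite /= cmul0l !subr0 addr0 mul0r addr0 nmZr ?invr_ge0 //.
  by rewrite ler_wpM2l ?invr_ge0.
set c := sqrt_iter y in IH *.
have -> : c n.+2 - c n.+1 = half *: ((c n.+1 - c n) ** (c n.+1 + c n)).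
  rewrite -[c n.+2]/(half *: (y + c n.+1 ** c n.+1)) -{2}[c n.+1]/(half *: (y + c n ** c n)).
  rewrite -scalerBr; congr (_ *: _); rewrite opprD addrACA subrr add0r.
  have cc : c n.+1 ** c n = c n ** c n.+1.
    apply: sqrt_iter_commutes; apply/esym; exact: sqrt_iter_commutes.
  by rewrite cmulBl !cmulDr cc opprD addrA addrK.
rewrite nmZr ?invr_ge0 //.
have h1 := sqrt_iter_le n y1; have h2 := sqrt_iter_le n.+1 y1.
have h3 := nmM (c n.+1 - c n) (c n.+1 + c n).
have h4 : nm (c n.+1 - c n) * nm (c n.+1 + c n) <=
    (sqrt_bound n.+1 - sqrt_bound n) * (sqrt_bound n.+1 + sqrt_bound n).
  rewrite ler_pM ?nm_ge0 //; apply: le_trans (nmD _ _) _; exact: lerD.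
have -> : sqrt_bound n.+2 = 2^-1 * (1 + sqrt_bound n.+1 * sqrt_bound n.+1) by [].
have -> : sqrt_bound n.+1 = 2^-1 * (1 + sqrt_bound n * sqrt_bound n) by [].
move: h3 h4; rewrite [sqrt_bound n.+1]/=; nra.
Qed.

(** The binomial series of 1 - sqrt (1 - y), obtained as a limit of iterates
    that are polynomials in y with non-negative coefficients; hence their
    increments are dominated by those of the scalar iteration at y = 1, which
    covers the boundary case of norm 1 as well. *)
Lemma sqrt_exists y : selfadj y -> nm y <= 1 ->
  exists c, [/\ selfadj c, nm c <= 1, c ** c = c + c - y &
    forall z, commutes y z -> commutes c z].
Proof.
move=> sy y1.
have [c cc] : exists c, tends (sqrt_iter y) c.
  apply: (@dominated_tends _ _ _ sqrt_bound 1) => n; first exact: sqrt_iter_step.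
  by case/andP: (sqrt_bound01 n).
exists c; split.
- apply: selfadj_tends cc; elim=> [|n IH] /=; first exact: star0.
  by apply: selfadjZ; apply: selfadjD => //; apply: selfadjM.
- apply: tends_nm_le cc _ => n; apply: le_trans (sqrt_iter_le n y1) _.
  by case/andP: (sqrt_bound01 n).
- have := tendsS cc; have : tends (fun n => sqrt_iter y n.+1) (half *: (y + c ** c)).
    rewrite /=; have hc := tendsD (tends_cst y) (tendsM cc cc).
    apply: (@tends_lip _ _ _ (fun x => half *: x) 2^-1 _ _ _ hc) => x.
    by rewrite -scalerBr nmZr ?invr_ge0.
  move=> h1 h2; have E := tends_unique h2 h1.
  have -> : c + c = y + c ** c by rewrite {1 2}E -scalerDr half_twice.
  by rewrite addrC addKr.
- by move=> z yz; apply: commutes_tends cc => n; apply: sqrt_iter_commutes.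
Qed.

End SquareRoot.

Section Cartesian.
Variables (R : realType) (B : cstarAlgType R).
Implicit Types (x y z : B) (c : R[i]) (r M : R).

Local Notation "'i" := ((Complex 0 1 : R[i])).
Local Notation half := ((2^-1 : R)%:C%C).

Lemma conji : conjc 'i = - 'i :> R[i].
Proof. by apply/eqP; rewrite eq_complex /= oppr0 !eqxx. Qed.

Lemma normci : Normc.normc 'i = 1 :> R.
Proof. by rewrite /= expr0n expr1n add0r sqrtr1. Qed.

Lemma sqri : 'i * 'i = -1 :> R[i].
Proof. by apply/eqP; rewrite eq_complex /=; apply/andP; split; apply/eqP; ring. Qed.

Lemma cartesian x : exists p q : B, [/\ selfadj p, selfadj q, x = p + 'i *: q,
  nm p <= nm x & nm q <= nm x].
Proof.
exists (half *: (x + star x)), (half *: ('i *: (star x - x))); split.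
- by apply: selfadjZ; rewrite /selfadj starD starK addrC.
- by apply: selfadjZ; rewrite /selfadj starZ conji starB starK scaleNr -scalerN opprB.
- rewrite [_ *: (half *: _)]scalerA mulrC -scalerA ['i *: ('i *: _)]scalerA sqri scaleN1r.
  by rewrite opprB -scalerDr addrACA subrr addr0 half_twice.
- rewrite nmZr ?invr_ge0 //; have := nmD x (star x); rewrite nm_star; lra.
- rewrite nmZr ?invr_ge0 // nmZ normci mul1r.
  have := nmB (star x) x; rewrite nm_star; lra.
Qed.

(** When p^2 + q^2 is the scalar r^2, p is the real part of r times the unitary
    (p + i q) / r.  The bound itself is the C*-identity for the normal element
    p + i q. *)
Lemma commuting_squares_le (p q : B) r : selfadj p -> selfadj q -> commutes p q -> 0 <= r ->
  nm (p ** p + q ** q) <= r ^+ 2 -> nm p <= r.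
Proof.
move=> sp sq pq r0 h; pose u := p + 'i *: q.
have su : star u = p - 'i *: q by rewrite starD starZ sp sq conji scaleNr.
have uu : star u ** u = p ** p + q ** q.
  rewrite su cmulBl !cmulDr !cmulZl !cmulZr pq scalerA sqri scaleN1r.
  by rewrite opprD opprK addrA addrK.
have ur : nm u <= r.
  by rewrite -(@ler_pXn2r _ 2) ?nnegrE ?nm_ge0 // -nm_cstar uu.
have -> : p = half *: (u + star u).
  by rewrite su /u addrACA subrr addr0 half_twice.
rewrite nmZr ?invr_ge0 //; have := nmD u (star u); rewrite nm_star; lra.
Qed.

End Cartesian.

Section Unital.
Variables (R : realType) (B : cstarAlgType R) (e : B).
Hypothesis he : is_unit e.
Implicit Types (x y z a b : B) (c : R[i]) (r M : R).

Let emul x : e ** x = x. Proof. by case: he. Qed.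
Let mule x : x ** e = x. Proof. by case: he. Qed.

Local Notation "'i" := ((Complex 0 1 : R[i])).
Local Notation half := ((2^-1 : R)%:C%C).

Definition sc r : B := r%:C%C *: e.

Lemma selfadj_sc r : selfadj (sc r). Proof. exact/selfadjZ/selfadj_unit. Qed.
Lemma scD r1 r2 : sc (r1 + r2) = sc r1 + sc r2.
Proof. by rewrite /sc rmorphD scalerDl. Qed.
Lemma scB r1 r2 : sc (r1 - r2) = sc r1 - sc r2.
Proof. by rewrite /sc rmorphB scalerBl. Qed.
Lemma sc0 : sc 0 = 0. Proof. by rewrite /sc rmorph0 scale0r. Qed.
Lemma nm_sc r : 0 <= r -> nm (sc r) <= r.
Proof. by move=> r0; rewrite nmZr // ler_piMr // nm_unit. Qed.
Lemma sc_mull r x : sc r ** x = r%:C%C *: x. Proof. by rewrite cmulZl emul. Qed.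
Lemma sc_mulr r x : x ** sc r = r%:C%C *: x. Proof. by rewrite cmulZr mule. Qed.
Lemma commutes_sc r x : commutes (sc r) x.
Proof. by rewrite /commutes sc_mull sc_mulr. Qed.

Lemma root_one_sub y : selfadj y -> nm y <= 1 ->
  exists k, [/\ selfadj k, nm (e - k) <= 1, k ** k = e - y &
    forall z, commutes y z -> commutes k z].
Proof.
move=> sy /(sqrt_exists sy) [c [sc' c1 cc cz]]; exists (e - c); split.
- by apply: selfadjB => //; apply: selfadj_unit.
- by rewrite opprB addrC subrK.
- rewrite cmulBl !cmulBr !emul !mule cc opprB.
  by rewrite [c + c - y - c]addrAC addrK addrA subrK.
- by move=> z yz; apply: commutesB; [exact: commutes_unit|exact: cz].
Qed.

(** For self-adjoint x of norm at most 1 choose k with x^2 + k^2 = 1.  The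
    images of x and k have squares adding up to a projection, so that the image
    of x has norm at most 1, although P is not known to be continuous. *)
Lemma star_hom_contractive (D : cstarAlgType R) (P : B -> D) :
  star_hom P -> forall x, nm (P x) <= nm x.
Proof.
move=> hP.
have unitc x : selfadj x -> nm x <= 1 -> nm (P x) <= 1.
  move=> sx x1.
  have y1 : nm (x ** x) <= 1 by rewrite nm_sq // expr_le1 ?nm_ge0.
  have [k [sk _ kk kc]] := root_one_sub (selfadjM sx sx erefl) y1.
  apply: (@commuting_squares_le _ _ (P x) (P k)) => //; try exact: star_hom_selfadj.
    by rewrite /commutes -!star_homM // (kc x) // /commutes cmulA.
  rewrite -!star_homM // -star_homD // kk addrC subrK expr1n.
  have sPe : selfadj (P e) by apply: star_hom_selfadj => //; apply: selfadj_unit.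
  by have := nm_sq sPe; rewrite -star_homM // emul; have := nm_ge0 (P e); nra.
have sac x : selfadj x -> nm (P x) <= nm x.
  move=> sx; have [x0|x0] := eqVneq (nm x) 0.
    by rewrite (nm_eq0 x0) star_hom0 // !nm0.
  have xp : 0 < nm x by rewrite lt_def x0 nm_ge0.
  have := unitc ((nm x)^-1%:C%C *: x) (selfadjZ _ sx).
  by rewrite star_homZ // !nmZr ?invr_ge0 ?nm_ge0 // mulVf // lexx ler_pdivrMl // mulr1 => ->.
move=> x; rewrite -(@ler_pXn2r _ 2) ?nnegrE ?nm_ge0 // -!nm_cstar -star_homS // -star_homM //.
exact/sac/selfadj_cstar.
Qed.

(** That is, the spectrum of a lies in [0, 2 M]: positivity expressed by the
    norm alone, which makes sums of positive elements obviously positive. *)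
Definition pos a := selfadj a /\ exists2 M, 0 <= M & nm (sc M - a) <= M.

Lemma pos_bound a M : 0 <= M -> nm (sc M - a) <= M ->
  forall M', M <= M' -> nm (sc M' - a) <= M'.
Proof.
move=> M0 h M' MM'.
have -> : sc M' - a = sc (M' - M) + (sc M - a) by rewrite scB addrA subrK.
have := nmD (sc (M' - M)) (sc M - a).
have : nm (sc (M' - M)) <= M' - M by apply: nm_sc; rewrite subr_ge0.
lra.
Qed.

Lemma posD a b : pos a -> pos b -> pos (a + b).
Proof.
move=> [sa' [M M0 hM]] [sb [N N0 hN]]; split; first exact: selfadjD.
exists (M + N); first exact: addr_ge0.
rewrite scD opprD addrACA; have := nmD (sc M - a) (sc N - b); lra.
Qed.

Lemma pos0 : pos 0.
Proof. by split; [exact: star0|exists 0; rewrite // sc0 subr0 nm0]. Qed.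

Lemma pos_sum (I : Type) (s : seq I) (F : I -> B) :
  (forall i, pos (F i)) -> pos (\sum_(i <- s) F i).
Proof. by move=> h; elim/big_ind: _ => //; [exact: pos0|exact: posD]. Qed.

Lemma pos_sub_nm a r : selfadj a -> nm a <= r -> pos (sc r - a).
Proof.
move=> sa' ar; have r0 := le_trans (nm_ge0 a) ar.
split; first exact: selfadjB (selfadj_sc _) sa'.
by exists r => //; rewrite opprB addrC subrK.
Qed.

Lemma pos_root a : pos a -> exists b, [/\ selfadj b, b ** b = a, pos b &
  forall z, commutes a z -> commutes b z].
Proof.
move=> [sa' [M M0 hM]].
have [M1 hM1] : 0 < M + 1 /\ nm (sc (M + 1) - a) <= M + 1.
  by split; [rewrite ltr_wpDl|apply: pos_bound hM _ _ => //; rewrite lerDl].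
set N := M + 1 in M1 hM1.
have [||k [sk k1 kk kc]] := @root_one_sub (e - N^-1%:C%C *: a).
- by apply: selfadjB; [exact: selfadj_unit|exact: selfadjZ].
- have -> : e - N^-1%:C%C *: a = N^-1%:C%C *: (sc N - a).
    by rewrite scalerBr /sc scalerA -rmorphM /= mulVf ?gt_eqF // scale1r.
  by rewrite nmZr ?invr_ge0 ?(ltW M1) // ler_pdivrMl // mulr1.
have sN : 0 <= Num.sqrt N by exact: sqrtr_ge0.
exists ((Num.sqrt N)%:C%C *: k); split; first exact: selfadjZ.
- rewrite cmulZl cmulZr kk scalerA -rmorphM /= -expr2 sqr_sqrtr ?(ltW M1) //.
  by rewrite opprB addrC subrK scalerA -rmorphM /= mulfV ?gt_eqF // scale1r.
- split; first exact: selfadjZ.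
  exists (Num.sqrt N) => //; rewrite /sc -scalerBr nmZr //.
  by rewrite ler_piMr.
- move=> z az; apply/commutesZ/kc; apply: commutesB; first exact: commutes_unit.
  exact: commutesZ.
Qed.

(** By scaling |a| < 1, and 1 - a^2 = k^2 with k^2 + a^2 = 1, so |k| <= 1. *)
Lemma pos_sq a : selfadj a -> pos (a ** a).
Proof.
move=> sa'; split; first exact: selfadjM.
pose r := nm a + 1; have r0 : 0 < r by rewrite ltr_wpDl ?nm_ge0.
pose x := r^-1%:C%C *: a.
have sx : selfadj x by apply: selfadjZ.
have x1 : nm x <= 1.
  by rewrite nmZr ?invr_ge0 ?(ltW r0) // ler_pdivrMl // mulr1 lerDl.
have y1 : nm (x ** x) <= 1 by rewrite nm_sq // expr_le1 ?nm_ge0.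
have [k [sk _ kk kc]] := root_one_sub (selfadjM sx sx erefl) y1.
have k1 : nm k <= 1.
  apply: (@commuting_squares_le _ _ k x) => //.
    by apply: kc; rewrite /commutes cmulA.
  by rewrite kk subrK expr1n nm_unit.
exists (r ^+ 2); first exact: sqr_ge0.
have -> : sc (r ^+ 2) - a ** a = (r ^+ 2)%:C%C *: (k ** k).
  rewrite kk scalerBr cmulZl cmulZr !scalerA -!rmorphM /=; congr (_ - _).
  by rewrite expr2 -mulrA [r * (_ / _)]mulrA mulfV ?gt_eqF // mul1r mulfV ?gt_eqF // scale1r.
rewrite nmZr ?sqr_ge0 // ler_piMr ?sqr_ge0 // nm_sq //.
by rewrite expr_le1 ?nm_ge0.
Qed.

(** With L = |a + b|, both a and L - a = (L - (a + b)) + b are positive, hence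
    squares of commuting elements q and p; then q^2 + p^2 = L bounds q. *)
Lemma pos_le_norm a b : pos a -> pos b -> nm a <= nm (a + b).
Proof.
move=> pa pb; set L := nm (a + b).
have L0 : 0 <= L by exact: nm_ge0.
have pL : pos (sc L - a).
  have -> : sc L - a = (sc L - (a + b)) + b by rewrite opprD addrA subrK.
  apply: posD => //; apply: pos_sub_nm => //.
  by case: pa => sa' _; case: pb => sb _; apply: selfadjD.
have [p [sp pp _ pc]] := pos_root pL; have [q [sq qq _ qc]] := pos_root pa.
have qp : commutes q p.
  apply: qc; apply/esym/pc; apply: commutesB => //; exact: commutes_sc.
have sL : 0 <= Num.sqrt L by exact: sqrtr_ge0.
have : nm q <= Num.sqrt L.
  apply: (commuting_squares_le sq sp qp sL).
  by rewrite qq pp addrC subrK sqr_sqrtr // nm_sc.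
move=> h; rewrite -qq nm_sq // -[leRHS]sqr_sqrtr //.
by rewrite lerXn2r ?nnegrE ?nm_ge0.
Qed.

(** The non-zero spectra of b' b and b b' agree, where b' is the adjoint of b.
    In norm terms: b' b (M - b' b)^n = b' (M - b b')^n b is O(M^n), so that
    consecutive powers of M - b' b divided by M^n differ by a bounded amount,
    hence grow at most linearly. *)
Lemma pos_swap b : pos (b ** star b) -> pos (star b ** b).
Proof.
move=> [_ [M0 M00 hM0]]; split; first exact: selfadj_cstar.
pose M := M0 + 1; have Mp : 0 < M by rewrite ltr_wpDl.
have hM : nm (sc M - b ** star b) <= M by apply: pos_bound hM0 _ _; rewrite ?lerDl.
exists M; first exact: ltW.
set v' := sc M - b ** star b in hM; set v := sc M - star b ** b.
have sv : selfadj v by apply: selfadjB; [exact: selfadj_sc|exact: selfadj_cstar].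
have vb : v ** star b = star b ** v'.
  by rewrite cmulBl cmulBr sc_mull sc_mulr !cmulA.
have pvb n : upow e v n ** star b = star b ** upow e v' n.
  elim: n => [|n IH]; first by rewrite /= emul mule.
  by rewrite !upowS -cmulA IH cmulA vb cmulA.
have pv' n : nm (upow e v' n) <= M ^+ n.
  elim: n => [|n IH]; first exact: nm_unit.
  by rewrite upowS exprS; apply: le_trans (nmM _ _) _; rewrite ler_pM ?nm_ge0.
have step n : nm (sc M ** upow e v n - upow e v n.+1) <= nm b ^+ 2 * M ^+ n.
  have -> : sc M ** upow e v n - upow e v n.+1 = star b ** upow e v' n ** b.
    rewrite -pvb upowSr // -[upow e v n ** star b ** b]cmulA commutes_sc -cmulBr.
    by rewrite opprB addrC subrK.
  apply: le_trans (nmM _ _) _; rewrite expr2 -mulrA [nm b * (nm b * _)]mulrC -mulrA.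
  rewrite [nm b * (_ * _)]mulrA.
  rewrite ler_wpM2r ?nm_ge0 //; apply: le_trans (nmM _ _) _.
  by rewrite nm_star ler_wpM2l ?nm_ge0.
apply: (@power_trick _ _ e he v M 1 (nm b ^+ 2 / M)) => //.
  by rewrite divr_ge0 ?sqr_ge0 ?ltW.
elim=> [|n IH]; first by rewrite mulr0 addr0 mul1r expr0; exact: nm_unit.
have -> : upow e v n.+1 = sc M ** upow e v n - (sc M ** upow e v n - upow e v n.+1).
  by rewrite opprB addrC subrK.
apply: le_trans (nmB _ _) _; rewrite sc_mull nmZr ?(ltW Mp) // -sc_mull.
have -> : (1 + nm b ^+ 2 / M * n.+1%:R) * M ^+ n.+1 =
  M * ((1 + nm b ^+ 2 / M * n%:R) * M ^+ n) + nm b ^+ 2 * M ^+ n.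
  have M1 : M != 0 by rewrite gt_eqF.
  rewrite -natr1 [M ^+ n.+1]exprS; move: (nm b ^+ 2) (M ^+ n) (n%:R : R) => B2 Mn N.
  by field.
by apply: lerD => //; rewrite ler_wpM2l ?(ltW Mp).
Qed.

(** Kaplansky's argument.  With s = b' b and m twice its negative part, c = b m
    has c' c = m s m <= 0, whereas c c' + c' c is a sum of squares; so c' c is
    both positive and negative, and m vanishes. *)
Theorem pos_cstar b : pos (star b ** b).
Proof.
set s := star b ** b; have ss : selfadj s by exact: selfadj_cstar.
have [r [sr rr pr rc]] := pos_root (pos_sq ss).
have rs : commutes r s by apply: rc; rewrite /commutes cmulA.
have [k [sk kk _ kc]] := pos_root pr.
have ks : commutes k s by apply: kc.
pose m := r - s.
have sm : selfadj m by apply: selfadjB.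
have mr : commutes m r by apply: commutesB => //; apply/esym.
have km : commutes k m.
  apply/esym; apply: commutesB; apply/esym => //.
  by apply: kc.
(* m (r + s) = 0, that is m s = - m r *)
have ms : m ** s = - (m ** r).
  apply/eqP; rewrite -addr_eq0 -cmulDr cmulBl !cmulDr rr rs.
  by rewrite [s ** r + _]addrC subrr.
pose c := b ** m.
have cc : star c ** c = - ((m ** k) ** (m ** k)).
  rewrite /c starM sm -cmulA [star b ** _]cmulA -/s [m ** (s ** m)]cmulA ms.
  by rewrite cmulNl -kk !cmulA -[m ** k ** m ** k]cmulA -[m ** k ** k ** m]cmulA km !cmulA.
have smk : selfadj (m ** k) by apply: selfadjM => //; rewrite km.
have pm : pos ((m ** k) ** (m ** k)) by exact: pos_sq.
have pcc : pos (star c ** c).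
  apply: pos_swap; have [x [y [sx sy cxy _ _]]] := cartesian c.
  have sc' : star c = x - 'i *: y by rewrite cxy starD starZ sx sy conji scaleNr.
  have E : c ** star c + star c ** c = (x ** x + x ** x) + (y ** y + y ** y).
    rewrite sc' cxy; set w := 'i *: y.
    have -> : y ** y = - (w ** w) by rewrite cmulZl cmulZr scalerA sqri scaleN1r opprK.
    rewrite cmulDl cmulBl !cmulBr !cmulDr addrACA.
    rewrite [x ** x - _ + _]addrACA addNr addr0; congr (_ + _).
    by rewrite opprD addrACA subrr add0r.
  have -> : c ** star c = (x ** x + x ** x) + (y ** y + y ** y) + (m ** k) ** (m ** k).
    by rewrite -E cc subrK.
  by apply: posD => //; do ![apply: posD]; exact: pos_sq.
have mk0 : m ** k = 0.
  apply: selfadj_sq_eq0 => //; apply: nm_le0.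
  have := pos_le_norm pm pcc; rewrite cc subrr nm0; exact.
have m0 : m = 0.
  apply: selfadj_sq_eq0 => //.
  have mr0 : m ** r = 0 by rewrite -kk cmulA mk0 cmul0l.
  by rewrite {2}/m cmulBr ms mr0 !oppr0 addr0.
by have -> : s = r by apply/esym/eqP; rewrite -subr_eq0; apply/eqP.
Qed.

End Unital.

(** * Cauchy-Schwarz and complete contractivity *)

(** The spectral theorem written with coordinates, for sums over finite
    families of elements of a C*-algebra. *)
Lemma hermitian_diagonal (R : realType) n (M : 'I_n -> 'I_n -> R[i]) :
  (forall i j, M j i = conjc (M i j)) ->
  exists (P : 'M[R[i]]_n) (D : 'I_n -> R),
    [/\ forall i j, M i j = \sum_k conjc (P k i) * (D k)%:C%C * P k j,
        forall i j, \sum_k conjc (P k i) * P k j = (i == j)%:R,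
        forall k l, \sum_i P k i * conjc (P l i) = (k == l)%:R &
        forall k, (D k)%:C%C = \sum_i P k i * \sum_j M i j * conjc (P k j)].
Proof.
move=> hM; pose A : 'M[R[i]]_n := \matrix_(i, j) M i j.
have hA : A \is hermsymmx.
  apply/is_hermitianmxP; rewrite expr0 scale1r; apply/matrixP => i j.
  by rewrite !mxE hM.
have uP := spectral_unitarymx A; set P := spectralmx A in uP.
have Areal := hermitian_spectral_diag_real hA.
have := orthomx_spectralP (hermitian_normalmx hA); rewrite -/P invmx_unitary //.
set d := spectral_diag A in Areal * => dA.
have PP : P *m P^t* = 1%:M by apply/unitarymxP.
have PP' : P^t* *m P = 1%:M by rewrite -(invmx_unitary uP) mulVmx // unitarymx_unit.
have dk k : d 0 k = (complex.Re (d 0 k))%:C%C.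
  apply/eqP; rewrite eq_complex /= eqxx /=; move/mxOverP: Areal => /(_ 0 k).
  by rewrite realE !lecE /= => /orP[|] /andP[] // /eqP <-.
exists P, (fun k => complex.Re (d 0 k)); split => [i j|i j|k l|k].
- have := congr1 (fun X : 'M[R[i]]_n => X i j) dA; rewrite mxE => ->.
  rewrite mxE; apply: eq_bigr => k _; rewrite -dk; congr (_ * _).
  by rewrite mul_mx_diag !mxE.
- have := congr1 (fun X : 'M[R[i]]_n => X i j) PP'; rewrite !mxE => <-.
  by apply: eq_bigr => k _; rewrite !mxE.
- have := congr1 (fun X : 'M[R[i]]_n => X k l) PP; rewrite !mxE => <-.
  by apply: eq_bigr => i _; rewrite !mxE.
- rewrite -dk.
  have E : P *m (A *m P^t*) = diag_mx d.
    by rewrite {1}dA !mulmxA PP mul1mx -mulmxA PP mulmx1.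
  have := congr1 (fun X : 'M[R[i]]_n => X k k) E; rewrite !mxE eqxx mulr1n => <-.
  apply: eq_bigr => i _; rewrite mxE; congr (_ * _).
  by apply: eq_bigr => j _; rewrite !mxE.
Qed.

Section Unital.
Variables (R : realType) (B : cstarAlgType R) (e : B).
Hypothesis he : is_unit e.
Implicit Types (x y z a b : B) (c : R[i]) (r M : R).

Let emul x : e ** x = x. Proof. by case: he. Qed.
Let mule x : x ** e = x. Proof. by case: he. Qed.
Local Notation pos := (pos e).
Local Notation sc := (sc e).

Lemma posZ r a : 0 <= r -> pos a -> pos (r%:C%C *: a).
Proof.
move=> r0 [sa' [M M0 hM]]; split; first exact: selfadjZ.
exists (r * M); first exact: mulr_ge0.
by rewrite /sc rmorphM -scalerA -scalerBr nmZr // ler_wpM2l.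
Qed.

Lemma pos_conj a x : pos a -> pos (star x ** a ** x).
Proof.
move=> /(pos_root he) [b [sb <- _ _]].
have -> : star x ** (b ** b) ** x = star (b ** x) ** (b ** x).
  by rewrite starM sb !cmulA.
exact: pos_cstar.
Qed.

(** Cauchy-Schwarz in the Hilbert module B^n.  For l > |c' c| the element
    l^2 y' y - l z' z, with z = c' y, is the sum of the squares of the entries
    c_i z - l y_i and of z' (l - c' c) z, so that l z' z <= l^2 y' y. *)
Lemma cauchy_schwarz n (c y : 'I_n -> B) :
  nm (\sum_i star (c i) ** y i) ^+ 2 <=
  nm (\sum_i star (c i) ** c i) * nm (\sum_i star (y i) ** y i).
Proof.
set z := \sum_i star (c i) ** y i; set C := \sum_i star (c i) ** c i.
set Y := \sum_i star (y i) ** y i.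
have pC : pos C by apply: pos_sum => i; exact: pos_cstar.
have key l : nm C < l -> nm z ^+ 2 <= l * nm Y.
  move=> Cl; have l0 : 0 < l by apply: le_lt_trans Cl; apply: nm_ge0.
  pose v i := c i ** z - l%:C%C *: y i.
  have starz : star z = \sum_i star (y i) ** c i.
    by rewrite star_sum; apply: eq_bigr => i _; rewrite starM starK.
  have sv : \sum_i star (v i) ** v i =
      star z ** C ** z - l%:C%C *: (star z ** z) - l%:C%C *: (star z ** z) +
      (l ^+ 2)%:C%C *: Y.
    have -> : \sum_i star (v i) ** v i = \sum_i (star z ** (star (c i) ** c i) ** z
       - l%:C%C *: (star z ** (star (c i) ** y i))
       - l%:C%C *: ((star (y i) ** c i) ** z) + (l ^+ 2)%:C%C *: (star (y i) ** y i)).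
      apply: eq_bigr => i _; rewrite /v starB starZr starM cmulBl !cmulBr !cmulZl !cmulZr.
      by rewrite scalerA -rmorphM /= -expr2 opprB !cmulA !addrA addrAC.
    rewrite big_split !sumrB /= -!scaler_sumr -!cmul_sumr -!cmul_suml -/C -/z -/Y.
    by rewrite -cmul_sumr -starz.
  have E : (l ^+ 2)%:C%C *: Y = l%:C%C *: (star z ** z) +
      (\sum_i star (v i) ** v i + star z ** (sc l - C) ** z).
    rewrite sv cmulBr cmulBl sc_mulr // cmulZl.
    set A := star z ** C ** z; set W := l%:C%C *: (star z ** z).
    by rewrite [_ + (W - A)]addrC !addrA subrK addrK subrr add0r.
  have h : nm (l%:C%C *: (star z ** z)) <= nm ((l ^+ 2)%:C%C *: Y).
    rewrite E; apply: (@pos_le_norm _ _ _ he).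
      by apply: posZ; [exact: ltW|exact: pos_cstar].
    apply: posD; first by apply: pos_sum => i; exact: pos_cstar.
    apply: pos_conj; apply: pos_sub_nm => //; last exact: ltW.
    by case: pC.
  by move: h; rewrite !nmZr ?sqr_ge0 ?(ltW l0) // nm_cstar expr2 -mulrA ler_pM2l.
apply/ler_addgt0Pr => d d0.
have Y1 : 0 < nm Y + 1 by rewrite ltr_wpDl ?nm_ge0.
have := key (nm C + d / (nm Y + 1)); rewrite ltrDl divr_gt0 // => /(_ isT).
move=> h; apply: le_trans h _; rewrite mulrDl lerD2l mulrAC ler_pdivrMr //.
by rewrite ler_wpM2l ?(ltW d0) // lerDl.
Qed.

Variable X : corrType (scalars R).
Variable t : X -> B.
Hypothesis tinner : forall x y : X, star (t x) ** t y = (inner x y : R[i]) *: e.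

(** By Cauchy-Schwarz it is enough to bound the inner square of the vector with
    entries y_k = sum_j t(x_kj) d_j.  It is the value at d of the quadratic form
    of the scalar Gram matrix, which diagonalization compares with
    r^2 sum_i d_i' d_i. *)
Lemma cc_of_inner : completely_contractive t.
Proof.
move=> n x r r0 hM c d hc hd.
have [rI rR] : complex.Im r = 0 /\ 0 <= complex.Re r.
  by move: r0; rewrite lecE /= => /andP[/eqP -> ->].
have rE : r = (complex.Re r)%:C%C by rewrite [LHS]complexE rI mulr0 addr0.
set s := complex.Re r in rE rR; rewrite rE in hM *.
pose M i j : R[i] := \sum_k inner (x k i) (x k j).
have hherm i j : M j i = conjc (M i j).
  by rewrite rmorph_sum; apply: eq_bigr => k _; exact: (esym (innerJ (x k i) (x k j))).
have [P [D [MP P1 P2 DP]]] := hermitian_diagonal hherm.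
(* an eigenvalue is the value of the form at a unit vector of scalars *)
have Dle k : D k <= s ^+ 2.
  pose v i : scalars R := conjc (P k i).
  have v1 : \sum_i star (v i) ** v i = (1 : R[i]).
    transitivity (\sum_i P k i * conjc (P k i)); last by rewrite P2 eqxx.
    apply: eq_bigr => i _; exact: (congr1 (fun z : R[i] => z * conjc (P k i)) (conjcK _)).
  have := hM v v; rewrite v1 normr1 lexx => /(_ isT isT).
  have -> : \sum_i \sum_j star (v i) ** (\sum_k inner (x k i) (x k j)) ** v j =
      (D k)%:C%C :> R[i].
    rewrite DP; apply: eq_bigr => i _; rewrite mulr_sumr; apply: eq_bigr => j _.
    rewrite mulrA.
    exact: (congr1 (fun z : R[i] => z * M i j * conjc (P k j)) (conjcK _)).
  rewrite normr_normc normcr -rmorphXn lecR => h.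
  by apply: le_trans h; exact: ler_norm.
rewrite nm_le.
pose y k := \sum_j t (x k j) ** d j.
have -> : \sum_i \sum_j star (c i) ** t (x i j) ** d j = \sum_i star (c i) ** y i.
  by apply: eq_bigr => i _; rewrite cmul_sumr; apply: eq_bigr => j _; rewrite cmulA.
pose w k := \sum_j P k j *: d j.
have wE (F : 'I_n -> R[i]) : \sum_k F k *: (star (w k) ** w k) =
    \sum_i \sum_j (\sum_k conjc (P k i) * F k * P k j) *: (star (d i) ** d j).
  transitivity (\sum_k \sum_i \sum_j (conjc (P k i) * F k * P k j) *: (star (d i) ** d j)).
    apply: eq_bigr => k _; rewrite /w star_sum cmul_suml scaler_sumr.
    apply: eq_bigr => i _; rewrite cmul_sumr scaler_sumr; apply: eq_bigr => j _.
    by rewrite starZ cmulZl cmulZr !scalerA [conjc _ * F k]mulrC mulrA.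
  rewrite exchange_big; apply: eq_bigr => i _; rewrite exchange_big.
  by apply: eq_bigr => j _; rewrite scaler_suml.
have yE : \sum_k star (y k) ** y k = \sum_k (D k)%:C%C *: (star (w k) ** w k).
  rewrite wE.
  transitivity (\sum_k \sum_i \sum_j inner (x k i) (x k j) *: (star (d i) ** d j)).
    apply: eq_bigr => k _; rewrite star_sum cmul_suml; apply: eq_bigr => i _.
    rewrite cmul_sumr; apply: eq_bigr => j _.
    by rewrite starM cmulA -[star _ ** _ ** _]cmulA tinner cmulZr mule cmulZl.
  rewrite exchange_big; apply: eq_bigr => i _; rewrite exchange_big.
  by apply: eq_bigr => j _; rewrite -MP -scaler_suml.
have dE : \sum_k star (w k) ** w k = \sum_k star (d k) ** d k.
  transitivity (\sum_k 1 *: (star (w k) ** w k)).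
    by apply: eq_bigr => k _; rewrite scale1r.
  have S i j : \sum_k conjc (P k i) * 1 * P k j = (i == j)%:R.
    by rewrite -P1; apply: eq_bigr => k _; rewrite mulr1.
  rewrite (wE (fun=> 1)); apply: eq_bigr => i _.
  rewrite (bigD1 i) //= S eqxx scale1r big1 ?addr0 // => j ji.
  by rewrite S eq_sym (negbTE ji) scale0r.
have Y2 : nm (\sum_k star (y k) ** y k) <= s ^+ 2.
  have E : (s ^+ 2)%:C%C *: (\sum_k star (d k) ** d k) = \sum_k star (y k) ** y k +
      \sum_k (s ^+ 2 - D k)%:C%C *: (star (w k) ** w k).
    rewrite yE -big_split -dE scaler_sumr; apply: eq_bigr => k _ /=.
    by rewrite -scalerDl -rmorphD addrC subrK.
  apply: (@le_trans _ _ (nm ((s ^+ 2)%:C%C *: (\sum_k star (d k) ** d k)))).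
    rewrite E; apply: (@pos_le_norm _ _ _ he); apply: pos_sum => k.
      exact: pos_cstar.
    by apply: posZ; [rewrite subr_ge0|exact: pos_cstar].
  rewrite nmZr ?sqr_ge0 // ler_piMr ?sqr_ge0 //.
  by rewrite -lecR -nmE; exact: hd.
rewrite -(@ler_pXn2r _ 2) ?nnegrE ?nm_ge0 //; apply: le_trans (cauchy_schwarz _ _) _.
rewrite -[leRHS]mul1r ler_pM ?nm_ge0 //.
by rewrite -lecR -nmE; exact: hc.
Qed.

End Unital.

(** * Ranges of *-homomorphisms are closed *)

(** A substitute for (1 + t)^n <= exp (n t), from (1 + t) (1 - t) <= 1 and the
    Bernoulli inequality. *)
Lemma one_add_pow_le (R : realFieldType) (t : R) n : 0 <= t -> n%:R * t < 1 ->
  (1 + t) ^+ n <= (1 - n%:R * t)^-1.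
Proof.
move=> t0; elim: n => [|n IH]; first by rewrite mul0r subr0 invr1 expr0.
rewrite -natr1 => h.
have h' : n%:R * t < 1 by rewrite mulrDl mul1r in h; lra.
have p1 : 0 < 1 - n%:R * t by lra.
have p2 : 0 < 1 - (n%:R + 1) * t by lra.
rewrite exprS -[leRHS]mul1r ler_pdivlMr //.
apply: (@le_trans _ _ ((1 + t) * (1 - n%:R * t)^-1 * (1 - (n%:R + 1) * t))).
  by rewrite ler_wpM2r ?(ltW p2) // ler_wpM2l ?addr_ge0 // IH.
rewrite mulrAC ler_pdivrMr // mul1r.
have : 0 <= n%:R * t * t by rewrite !mulr_ge0.
have : 0 <= t * t by rewrite mulr_ge0.
lra.
Qed.

Lemma geometric_small (R : realType) (d : R) : 0 < d -> 
  exists N, forall n, (N <= n)%N -> (3/4 : R) ^+ n <= d.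
Proof.
move=> d0; exists (Num.truncn (3 / d)).+1 => n Nn.
have h : 3 / d < n%:R :> R.
  apply: lt_le_trans (truncnS_gt _) _; by rewrite ler_nat.
have b : 1 + n%:R * 3^-1 <= (4/3 : R) ^+ n.
  have := @bernoulli R 3^-1 n; rewrite invr_ge0 => /(_ (ler0n R 3)).
  by have -> : 1 + 3^-1 = 4 / 3 :> R by field.
have -> : (3/4 : R) = (4/3)^-1 by field.
rewrite exprVn -[leRHS]invrK lef_pV2 ?posrE ?invr_gt0 ?exprn_gt0 //.
apply: le_trans b; move: h; rewrite mulrC; set u := d^-1; lra.
Qed.

Section Lifting.
Variables (R : realType) (B D : cstarAlgType R) (e : B) (P : B -> D).
Hypotheses (he : is_unit e) (hP : star_hom P).
Implicit Types (x : B) (d : D).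

Let emul x : e ** x = x. Proof. by case: he. Qed.
Let mule x : x ** e = x. Proof. by case: he. Qed.
Local Notation "'i" := ((Complex 0 1 : R[i])).
Local Notation half := ((2^-1 : R)%:C%C).

(** This is (1 + w)^n - 1, written so as to make sense without a unit, because
    the target of a homomorphism need not have one. *)
Fixpoint expm1 (A : cstarAlgType R) (w : A) n : A :=
  if n is n'.+1 then expm1 w n' + w ** expm1 w n' + w else 0.

Lemma star_hom_expm1 w n : P (expm1 w n) = expm1 (P w) n.
Proof. by elim: n => [|n IH] /=; rewrite ?(star_hom0 hP) // !(star_homD hP) (star_homM hP) IH. Qed.

Lemma expm1_le w n : nm (expm1 w n : D) <= (1 + nm w) ^+ n - 1.
Proof.
elim: n => [|n IH] /=; first by rewrite nm0 subrr.
rewrite exprS; have := nmD (expm1 w n + w ** expm1 w n) w.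
have := nmD (expm1 w n) (w ** expm1 w n); have := nmM w (expm1 w n).
have : nm w * nm (expm1 w n) <= nm w * ((1 + nm w) ^+ n - 1).
  by rewrite ler_wpM2l ?nm_ge0.
lra.
Qed.

Lemma expm1_first_order w n :
  nm (expm1 w n - n%:R *: w : D) <= (1 + nm w) ^+ n - 1 - n%:R * nm w.
Proof.
elim: n => [|n IH]; first by rewrite /= scale0r subr0 nm0 mul0r subr0 subrr.
have -> : expm1 w n.+1 - n.+1%:R *: w = (expm1 w n - n%:R *: w) + w ** expm1 w n.
  by rewrite /= -natr1 scalerDl scale1r opprD addrACA subrr addr0 addrAC.
have := nmD (expm1 w n - n%:R *: w) (w ** expm1 w n).
have := nmM w (expm1 w n); have := expm1_le w n => h.
have : nm w * nm (expm1 w n) <= nm w * ((1 + nm w) ^+ n - 1).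
  by rewrite ler_wpM2l ?nm_ge0.
rewrite exprS -natr1; lra.
Qed.

Lemma expm1_unital w n : e + expm1 w n = upow e (e + w) n.
Proof.
elim: n => [|n IH] /=; first by rewrite addr0.
by rewrite -IH cmulDl emul cmulDr mule -!addrA [w ** _ + w]addrC.
Qed.

(** For self-adjoint x the element (1 + i x / n)^n is nearly unitary, so its
    imaginary part is bounded whatever the norm of x is, while on the image of
    x, if that is small, it acts nearly as the identity. *)
Lemma approx_lift_sa x : selfadj x -> nm (P x) = 4^-1 ->
  exists x', nm x' <= 2 /\ nm (P x - P x') <= 12^-1.
Proof.
move=> sx Px.
pose n := (Num.truncn (2 * nm x ^+ 2)).+1.
have hn : 2 * nm x ^+ 2 < n%:R by exact: truncnS_gt.
have n0 : 0 < n%:R :> R by rewrite ltr0n.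
have n1 : 1 <= n%:R :> R by rewrite ler1n.
pose y := (n%:R^-1 : R)%:C%C *: x; pose w := 'i *: y.
have sy : selfadj y by apply: selfadjZ.
have sw : star w = - w by rewrite starZ sy conji scaleNr.
have ny : nm y = nm x / n%:R by rewrite nmZr ?invr_ge0 ?ltW // mulrC.
have [g gE] : exists g, g = expm1 w n by exists (expm1 w n).
have gle : nm (e + g) <= 2.
  have h1 : nm (e + w) ^+ 2 <= 1 + nm y ^+ 2.
    rewrite -nm_cstar starD sw (selfadj_unit he) cmulBl cmulDr !mule emul.
    rewrite [w ** _]cmulDr mule opprD addrA addrK.
    have -> : w ** w = - (y ** y) by rewrite cmulZl cmulZr scalerA sqri scaleN1r.
    rewrite opprK; have := nmD e (y ** y); have := nm_unit he; rewrite nm_sq //.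
    lra.
  have h2 : nm (e + g) <= nm (e + w) ^+ n.
    rewrite gE expm1_unital; elim: (n) => [|k IH]; first exact: nm_unit.
    by rewrite exprS; apply: le_trans (nmM _ _) _; rewrite ler_wpM2l ?nm_ge0.
  have h3 : (1 + nm y ^+ 2) ^+ n <= 2.
    have ht : n%:R * nm y ^+ 2 <= 2^-1.
      have -> : n%:R * nm y ^+ 2 = nm x ^+ 2 / n%:R by rewrite ny; field; rewrite gt_eqF.
      by rewrite ler_pdivrMr //; lra.
    apply: le_trans (one_add_pow_le (sqr_ge0 _) _) _; first lra.
    by rewrite -[leRHS]invrK lef_pV2 ?posrE; lra.
  have h4 : (nm (e + w) ^+ n) ^+ 2 <= 2.
    rewrite -exprM mulnC exprM; apply: le_trans h3.
    by rewrite lerXn2r ?nnegrE ?addr_ge0 ?sqr_ge0.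
  have : 0 <= nm (e + w) ^+ n by rewrite exprn_ge0 ?nm_ge0.
  nra.
pose im (A : cstarAlgType R) (z : A) := half *: ('i *: (star z - z)).
have im_le (A : cstarAlgType R) (z : A) : nm (im A z) <= nm z.
  rewrite nmZr ?invr_ge0 // nmZ normci mul1r.
  by have := nmB (star z) z; rewrite nm_star; lra.
have imB (A : cstarAlgType R) (z z' : A) : im A (z - z') = im A z - im A z'.
  by rewrite /im starB -!scalerBr !opprD !opprK addrACA.
exists (im B g); split.
  have -> : im B g = im B (e + g).
    by rewrite /im starD (selfadj_unit he) opprD addrACA subrr add0r.
  exact: le_trans (im_le _ _) gle.
have Pim : P (im B g) = im D (P g) by rewrite /im (star_homZ hP) (star_homZ hP) (star_homB hP) (star_homS hP).
have Pw : P w = 'i *: P y by rewrite (star_homZ hP).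
have PwE : n%:R *: P w = 'i *: P x.
  rewrite Pw /y (star_homZ hP) scalerA [_ * 'i]mulrC -scalerA [n%:R *: (_ *: _)]scalerA.
  by rewrite -(rmorph_nat (real_complex R)) -rmorphM mulfV ?gt_eqF // scale1r.
have -> : P x = im D (n%:R *: P w).
  rewrite PwE /im starZ -(star_homS hP) sx conji scaleNr -opprD scalerN -scalerDr.
  by rewrite scalerA sqri scaleN1r opprK half_twice.
rewrite Pim gE star_hom_expm1 -imB; apply: le_trans (im_le _ _) _.
rewrite nm_dist; apply: le_trans (expm1_first_order _ _) _.
have nPw : n%:R * nm (P w) = 4^-1.
  rewrite Pw nmZ normci mul1r /y (star_homZ hP) nmZr ?invr_ge0 ?ltW // Px.
  by rewrite mulrA mulfV ?gt_eqF // mul1r.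
have := @one_add_pow_le R (nm (P w)) n (nm_ge0 _); rewrite nPw.
have -> : (1 - 4^-1)^-1 = 4 / 3 :> R by field.
have -> : (4^-1 < 1 :> R) by lra.
move=> /(_ isT); lra.
Qed.

(** The constant 1/4 is a radius at which the error 1/12 is a third of the norm. *)
Lemma approx_lift_sa_scaled d : selfadj d -> range P d ->
  exists x', nm x' <= 8 * nm d /\ nm (d - P x') <= 3^-1 * nm d.
Proof.
move=> sd [x _ xd].
have [d0|d0] := eqVneq (nm d) 0.
  by exists 0; rewrite nm0 (star_hom0 hP) subr0 d0 !mulr0.
have dp : 0 < nm d by rewrite lt_def d0 nm_ge0.
pose k : R := (4 * nm d)^-1; have k0 : 0 < k by rewrite invr_gt0 mulr_gt0.
pose y := k%:C%C *: (half *: (x + star x)).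
have Py : P y = k%:C%C *: d.
  by rewrite (star_homZ hP) (star_homZ hP) (star_homD hP) (star_homS hP) xd sd half_twice.
have [||y' [y1 y2]] := @approx_lift_sa y.
- by do 2!apply: selfadjZ; rewrite /selfadj starD starK addrC.
- by rewrite Py nmZr ?ltW // /k; field.
have kE : k^-1 = 4 * nm d by rewrite invrK.
have k1 : 0 <= k^-1 by rewrite kE mulr_ge0 ?nm_ge0.
exists ((k^-1)%:C%C *: y'); rewrite (nmZr _ k1).
split; first by rewrite kE; nra.
have -> : d - P (k^-1%:C%C *: y') = k^-1%:C%C *: (P y - P y').
  by rewrite (star_homZ hP) scalerBr Py scalerA -rmorphM /= mulVf ?gt_eqF // scale1r.
by rewrite (nmZr _ k1) kE; nra.
Qed.

(** Lift the real and the imaginary part of an element of the range close to d. *)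
Lemma approx_lift d : closure (range P) d ->
  exists x, nm x <= 17 * nm d /\ nm (d - P x) <= 3 / 4 * nm d.
Proof.
move=> cd; have [d0|d0] := eqVneq (nm d) 0.
  by exists 0; rewrite nm0 (star_hom0 hP) subr0 d0 !mulr0.
have dp : 0 < nm d by rewrite lt_def d0 nm_ge0.
have [|z [x _ xz] zd] := (closure_nmP _ _).1 cd (nm d / 24); first by rewrite divr_gt0.
have [p [q [sp sq zpq np nq]]] := cartesian z.
have [p' [q' [sp' sq' xpq _ _]]] := cartesian x.
have uniq_cart (a b a' b' : D) : selfadj a -> selfadj b -> selfadj a' -> selfadj b' ->
    a + 'i *: b = a' + 'i *: b' -> a = a' /\ b = b'.
  move=> sA sB sA' sB' E.
  have aa' : a = a'.
    have /(congr1 (fun z => half *: (z + star z))) := E.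
    rewrite !starD !starZ sA sB sA' sB' conji !scaleNr.
    have re_part (x' y' : D) : half *: (x' + 'i *: y' + (x' - 'i *: y')) = x'.
      by rewrite addrACA subrr addr0 half_twice.
    by rewrite !re_part.
  split=> //; move: E; rewrite aa' => /addrI /(congr1 (fun z => - 'i *: z)).
  by rewrite !scalerA mulNr sqri opprK !scale1r.
have E : P p' + 'i *: P q' = p + 'i *: q.
  rewrite -(star_homZ hP 'i q') -(star_homD hP p') -xpq xz; exact: zpq.
have [Pp Pq] := uniq_cart _ _ _ _ (star_hom_selfadj hP sp') (star_hom_selfadj hP sq') sp sq E.
have [||p1 [h1 h2]] := @approx_lift_sa_scaled p => //; first by exists p'.
have [||q1 [h3 h4]] := @approx_lift_sa_scaled q => //; first by exists q'.
have nz : nm z <= nm d + nm d / 24 by have := nm_tri d z 0; rewrite !subr0; lra.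
exists (p1 + 'i *: q1); split.
  have := nmD p1 ('i *: q1); rewrite nmZ normci mul1r; lra.
have -> : d - P (p1 + 'i *: q1) = (d - z) + ((p - P p1) + 'i *: (q - P q1)).
  rewrite (star_homD hP) (star_homZ hP) scalerBr [p - _ + _]addrACA -zpq -opprD addrA subrK.
  by [].
have := nmD (d - z) ((p - P p1) + 'i *: (q - P q1)).
have := nmD (p - P p1) ('i *: (q - P q1)); rewrite nmZ normci mul1r (nm_dist d z); lra.
Qed.

Lemma closure_range_linear (c : R[i]) d d' : closure (range P) d -> closure (range P) d' ->
  closure (range P) (c *: d + d').
Proof.
move=> /closure_nmP h /closure_nmP h'; apply/closure_nmP => r r0.
pose k := Normc.normc c + 1; have k0 : 0 < k by rewrite ltr_wpDl ?normc_ge0.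
have [|_ [x _ <-] hx] := h (r / 2 / k); first by rewrite !divr_gt0.
have [|_ [x' _ <-] hx'] := h' (r / 2); first by rewrite divr_gt0.
exists (P (c *: x + x')); first by exists (c *: x + x').
rewrite (star_homD hP) (star_homZ hP) opprD addrACA -scalerBr; apply: le_trans (nmD _ _) _.
rewrite nmZ.
have : Normc.normc c * nm (P x - d) <= k * (r / 2 / k).
  by rewrite ler_pM ?normc_ge0 ?nm_ge0 // lerDl.
have -> : k * (r / 2 / k) = r / 2 by field; rewrite gt_eqF.
lra.
Qed.

(** Iterating the approximate lifting, as in the proof of the open mapping
    theorem, gives an exact preimage; 68 is the sum of the geometric series
    17 (3/4)^k. *)
Theorem lift_closure_range d : closure (range P) d ->
  exists2 x, P x = d & nm x <= 68 * nm d.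
Proof.
move=> cd.
have /choice [g hg] : forall d, exists x, closure (range P) d ->
    nm x <= 17 * nm d /\ nm (d - P x) <= 3 / 4 * nm d.
  by move=> d'; have [/approx_lift [x hx]|h] := pselect (closure (range P) d'); [exists x|exists 0].
pose f k := iter k (fun d' => d' - P (g d')) d.
have cf k : closure (range P) (f k).
  elim: k => [//|k IH] /=; rewrite -scaleN1r addrC.
  by apply: closure_range_linear => //; apply: subset_closure; exists (g (f k)).
have fk k : nm (f k) <= (3/4) ^+ k * nm d.
  elim: k => [|k IH]; first by rewrite expr0 mul1r.
  rewrite exprS -mulrA; apply: le_trans (hg _ (cf k)).2 _.
  by rewrite ler_wpM2l.
pose X k := \sum_(0 <= j < k) g (f j).
have XS k : X k.+1 - X k = g (f k) by rewrite /X big_nat_recr // [LHS]addrAC subrr add0r.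
have PX k : P (X k) = d - f k.
  elim: k => [|k IH]; first by rewrite /X big_geq // (star_hom0 hP) subrr.
  have -> : X k.+1 = g (f k) + X k by rewrite -XS subrK.
  rewrite (star_homD hP) IH -[f k.+1]/(f k - P (g (f k))) opprB.
  exact: addrCA.
pose r k : R := 68 * nm d * (1 - (3/4) ^+ k).
have r_le k : r k <= 68 * nm d.
  by rewrite ler_piMr ?mulr_ge0 ?nm_ge0 // gerBl exprn_ge0.
have [x Xx] : exists x, tends X x.
  apply: (@dominated_tends _ _ _ r _ _ r_le) => k; rewrite XS.
  apply: le_trans (hg _ (cf k)).1 _; have := fk k; rewrite /r exprS; lra.
exists x.
  have h1 : tends (P \o X) (P x).
    apply: (@tends_lip _ _ _ _ 1) Xx => y; rewrite -(star_homB hP) mul1r.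
    exact: (star_hom_contractive he).
  apply: tends_unique h1 _ => e' e0.
  have n1 : 0 < nm d + 1 by rewrite ltr_wpDl ?nm_ge0.
  have [N hN] := geometric_small (divr_gt0 e0 n1).
  exists N => n /hN h; rewrite /= PX addrC addKr nmN.
  apply: le_trans (fk n) _; apply: (@le_trans _ _ ((3 / 4) ^+ n * (nm d + 1))).
    by rewrite ler_wpM2l ?exprn_ge0 // lerDl.
  by rewrite -ler_pdivlMr.
apply: tends_nm_le Xx _ => k.
suff : nm (X k) <= r k by move=> h; apply: le_trans h _.
elim: k => [|k IH]; first by rewrite /X big_geq // nm0 /r expr0 subrr mulr0.
have -> : X k.+1 = g (f k) + X k by rewrite -XS subrK.
have := nmD (g (f k)) (X k); have := (hg _ (cf k)).1; have := fk k.
move: IH; rewrite /r exprS; lra.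
Qed.

End Lifting.

(** A representation vanishing on the kernel of another one is dominated by
    it: replace x by a preimage of P x of comparable norm, and remove the
    constant by taking powers. *)
Lemma dominated_of_ker (R : realType) (B D E : cstarAlgType R) (e : B)
    (P : B -> D) (Q : B -> E) : is_unit e -> star_hom P -> star_hom Q ->
  (forall x, P x = 0 -> Q x = 0) -> forall x, nm (Q x) <= nm (P x).
Proof.
move=> he hP hQ PQ.
have lip x : nm (Q x) <= 68 * nm (P x).
  have [|y Py yx] := @lift_closure_range _ _ _ e P he hP (P x).
    by apply: subset_closure; exists x.
  have -> : Q x = Q y.
    by apply/eqP; rewrite -subr_eq0 -star_homB // PQ // star_homB // Py subrr.
  exact: le_trans (star_hom_contractive he hQ _) _.
move=> x; rewrite leNgt; apply/negP => lt.
pose h := star x ** x.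
have sh : selfadj h by exact: selfadj_cstar.
have lt2 : nm (P h) < nm (Q h).
  rewrite /h !star_homM // !star_homS // !nm_cstar ltrXn2r ?nm_ge0 //.
have pwle m : nm (Q h) ^+ (2 ^ m) <= 68 * nm (P h) ^+ (2 ^ m).
  pose sq (F : cstarAlgType R) (y : F) := iter m (fun z => z ** z) y.
  have sqE (F : cstarAlgType R) (S : B -> F) : star_hom S -> S (sq B h) = sq F (S h).
    by move=> hS; rewrite /sq; elim: (m) => [//|k IH] /=; rewrite star_homM // IH.
  have nmsq (F : cstarAlgType R) (y : F) : selfadj y -> nm (sq F y) = nm y ^+ (2 ^ m).
    move=> sy; suff [_ //] : selfadj (sq F y) /\ nm (sq F y) = nm y ^+ (2 ^ m).
    rewrite /sq; elim: (m) => [|k [IH1 IH2]] /=; first by rewrite expr1.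
    by split; [exact: selfadjM|rewrite nm_sq // IH2 -exprM expnSr].
  by rewrite -!nmsq -?sqE //; exact: star_hom_selfadj.
have P0 : 0 < nm (P h).
  rewrite lt_def nm_ge0 andbT; apply/eqP => P0.
  by have := lip h; rewrite P0 mulr0 leNgt -P0 lt2.
apply: (@no_exp_growth R (nm (Q h) / nm (P h) - 1) 68 0) => //.
  by rewrite subr_gt0 ltr_pdivlMr // mul1r.
move=> m; rewrite mul0r addr0 addrC subrK expr_div_n ler_pdivrMr ?exprn_gt0 //.
Qed.

(** * Compact operators on a Hilbert module *)

Section HilbertModule.
Variables (R : realType) (A : cstarAlgType R) (X : corrType A).
Implicit Types (x y z : X) (a : A) (c : R[i]).

Lemma inner0r x : inner x 0 = 0 :> A.
Proof. by apply: (addIr (inner x 0)); have := innerP 1 x 0 0; rewrite !scale1r addr0 add0r. Qed.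
Lemma innerDr x y z : inner x (y + z) = inner x y + inner x z :> A.
Proof. by have := innerP 1 x y z; rewrite !scale1r. Qed.
Lemma innerZr c x y : inner x (c *: y) = c *: inner x y :> A.
Proof. by have := innerP c x y 0; rewrite !addr0 inner0r addr0. Qed.
Lemma innerBr x y z : inner x (y - z) = inner x y - inner x z :> A.
Proof. by rewrite innerDr -scaleN1r innerZr scaleN1r. Qed.
Lemma innerDl x y z : inner (x + y) z = inner x z + inner y z :> A.
Proof. by rewrite -innerJ innerDr starD !innerJ. Qed.
Lemma innerBl x y z : inner (x - y) z = inner x z - inner y z :> A.
Proof. by rewrite -innerJ innerBr starB !innerJ. Qed.
Lemma innerZl c x y : inner (c *: x) y = conjc c *: inner x y :> A.
Proof. by rewrite -innerJ innerZr starZ !innerJ. Qed.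
Lemma inner0l x : inner 0 x = 0 :> A.
Proof. by rewrite -innerJ inner0r star0. Qed.
Lemma inner_suml (I : Type) (s : seq I) (F : I -> X) y :
  inner (\sum_(i <- s) F i) y = \sum_(i <- s) inner (F i) y :> A.
Proof. by elim/big_rec2: _ => [|i a b _ <-]; rewrite ?inner0l ?innerDl. Qed.
Lemma inner_sumr (I : Type) (s : seq I) (F : I -> X) y :
  inner y (\sum_(i <- s) F i) = \sum_(i <- s) inner y (F i) :> A.
Proof. by elim/big_rec2: _ => [|i a b _ <-]; rewrite ?inner0r ?innerDr. Qed.

Lemma nm_inner x : nm (inner x x : A) = nm x ^+ 2.
Proof. by apply: complexI; rewrite -nmE -norm_inner nmE rmorphXn. Qed.

Lemma innerI x y : (forall z, inner z x = inner z y :> A) -> x = y.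
Proof.
move=> h; apply/eqP; rewrite -subr_eq0; apply/eqP/nm_eq0.
apply/eqP; rewrite -sqrf_eq0 -nm_inner innerBr h subrr nm0 //.
Qed.


Lemma adjoint_sym (S T : X -> X) : adjoint_pair S T -> adjoint_pair T S.
Proof. by move=> h x y; rewrite -innerJ -h innerJ. Qed.

Lemma adjointD (S T : X -> X) x y : adjoint_pair S T -> S (x + y) = S x + S y.
Proof.
by move=> /adjoint_sym h; apply: innerI => z; rewrite innerDr -!h innerDr.
Qed.

Lemma adjointZ (S T : X -> X) c x : adjoint_pair S T -> S (c *: x) = c *: S x.
Proof.
by move=> /adjoint_sym h; apply: innerI => z; rewrite innerZr -!h innerZr.
Qed.

Lemma adjointB (S T : X -> X) x y : adjoint_pair S T -> S (x - y) = S x - S y.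
Proof. by move=> h; rewrite (adjointD _ _ h) -scaleN1r (adjointZ _ _ h) scaleN1r. Qed.

Lemma adjoint_ract (S T : X -> X) x a : adjoint_pair S T -> S (ract x a) = ract (S x) a.
Proof.
by move=> /adjoint_sym h; apply: innerI => z; rewrite inner_ract -!h inner_ract.
Qed.

(** The coefficients of a finite rank operator are absorbed into the first
    components of the pairs. *)
Definition finite_rank (s : seq (X * X)) z : X := \sum_(p <- s) theta p.1 p.2 z.

Definition flip (s : seq (X * X)) := [seq (p.2, p.1) | p <- s].

Lemma theta_adjoint x y : adjoint_pair (@theta _ _ X x y) (theta y x).
Proof. by move=> u v; rewrite /theta inner_ract -innerJ inner_ract starM innerJ !innerJ. Qed.

Lemma finite_rank_adjoint s : adjoint_pair (finite_rank s) (finite_rank (flip s)).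
Proof.
move=> u v; rewrite /finite_rank inner_suml inner_sumr big_map; apply: eq_bigr => p _.
exact: theta_adjoint.
Qed.


Hypothesis inner_le : forall x y, nm (inner x y : A) <= nm x * nm y.
Hypothesis ract_le : forall x a, nm (ract x a) <= nm x * nm a.

Definition op_le (S : X -> X) (k : R) := forall z, nm (S z) <= k * nm z.

(** |T z|^2 = |<S T z, z>| <= k |T z| |z|. *)
Lemma adjoint_le (S T : X -> X) k : adjoint_pair S T -> 0 <= k -> op_le S k -> op_le T k.
Proof.
move=> h k0 Sk z; have [->|T0] := eqVneq (nm (T z)) 0; first by rewrite mulr_ge0 ?nm_ge0.
have Tp : 0 < nm (T z) by rewrite lt_def T0 nm_ge0.
rewrite -(ler_pM2r Tp) -expr2 -nm_inner -h; apply: le_trans (inner_le _ _) _.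
have := Sk (T z); have := nm_ge0 z; nra.
Qed.

Lemma theta_le x y : op_le (theta x y) (nm x * nm y).
Proof.
by move=> z; apply: le_trans (ract_le _ _) _; rewrite -mulrA ler_wpM2l ?nm_ge0.
Qed.

Lemma finite_rank_bounded s : exists2 k, 0 <= k & op_le (finite_rank s) k.
Proof.
exists (\sum_(p <- s) nm p.1 * nm p.2).
  by apply: sumr_ge0 => p _; rewrite mulr_ge0 ?nm_ge0.
move=> z; apply: le_trans (nm_sum _ _) _; rewrite mulr_suml.
by apply: ler_sum => p _; apply: theta_le.
Qed.

Definition approx (S : X -> X) s (r : R) := op_le (fun z => S z - finite_rank s z) r.

Lemma compact_approx (S : X -> X) (r : R) : compact_op S -> 0 < r -> exists s, approx S s r.
Proof.
move=> [_ h] r0; have [|n [c [x [y hz]]]] := h r%:C%C; first by rewrite ltcR.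
exists [seq (c i *: x i, y i) | i <- enum 'I_n] => z.
have := hz z; rewrite [`|z|]nmE -rmorphM nm_le; congr (nm (_ - _) <= _).
rewrite /finite_rank big_map big_enum; apply: eq_bigr => i _ /=.
by rewrite /theta ractZl.
Qed.

Lemma compact_bounded (S : X -> X) : compact_op S -> exists2 k, 0 <= k & op_le S k.
Proof.
move=> /compact_approx /(_ ltr01) [s hs]; have [k k0 hk] := finite_rank_bounded s.
exists (1 + k); first exact: addr_ge0.
move=> z; have := hs z; have := hk z; have := nm_tri (finite_rank s z) (S z) 0.
rewrite !subr0; lra.
Qed.

Lemma compact_theta x y : compact_op (@theta _ _ X x y).
Proof.
split; first by exists (theta y x); exact: theta_adjoint.
move=> r r0; exists 1%N, (fun=> 1), (fun=> x), (fun=> y) => z.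
by rewrite big_ord1 scale1r subrr normr0 mulr_ge0 // ltW.
Qed.

Variables (B : cstarAlgType R) (rho : A -> B) (t : X -> B).
Hypothesis rho_le : forall a, nm (rho a) <= nm a.
Hypothesis tlin : linear t.
Hypothesis tract : forall x a, t (ract x a) = t x ** rho a.
Hypothesis tinner : forall x y, star (t x) ** t y = rho (inner x y).

Let tD x y : t (x + y) = t x + t y.
Proof. by have := tlin 1 x y; rewrite !scale1r. Qed.
Let t0 : t 0 = 0.
Proof. by apply: (addIr (t 0)); rewrite -tD addr0 add0r. Qed.
Let tZ c x : t (c *: x) = c *: t x.
Proof. by have := tlin c x 0; rewrite !addr0 t0 addr0. Qed.
Let tB x y : t (x - y) = t x - t y.
Proof. by rewrite tD -scaleN1r tZ scaleN1r. Qed.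

Lemma nm_rep x : nm (t x) <= nm x.
Proof.
rewrite -(@ler_pXn2r _ 2) ?nnegrE ?nm_ge0 // -nm_cstar tinner -nm_inner.
exact: rho_le.
Qed.

Definition finite_rank_rep (s : seq (X * X)) : B := \sum_(p <- s) t p.1 ** star (t p.2).

Lemma finite_rank_rep_mul s z : finite_rank_rep s ** t z = t (finite_rank s z).
Proof.
rewrite cmul_suml /finite_rank; elim: s => [|p s IH]; first by rewrite !big_nil t0.
by rewrite !big_cons IH tD -cmulA tinner -tract.
Qed.

Lemma star_finite_rank_rep s : star (finite_rank_rep s) = finite_rank_rep (flip s).
Proof.
rewrite star_sum /finite_rank_rep big_map; apply: eq_bigr => p _ /=.
by rewrite starM starK.
Qed.

(** The map K |-> finite_rank_rep K is not known to be bounded.  But for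
    h = K' K the powers h^(n+1) are sums of h^n t(y) t(x)' K, which are of norm at
    most C k^(2n); and the C*-identity removes the constant C. *)
Lemma finite_rank_rep_le s k : 0 < k -> op_le (finite_rank s) k -> nm (finite_rank_rep s) <= k.
Proof.
move=> k0 hk.
have hk' : op_le (finite_rank (flip s)) k.
  by apply: adjoint_le hk; [exact: finite_rank_adjoint|exact: ltW].
set K := finite_rank_rep s; pose h := star K ** K.
have htz n z : exists2 z', iter n (fun b => h ** b) (t z) = t z' & nm z' <= (k ^+ 2) ^+ n * nm z.
  elim: n => [|n [z' IH1 IH2]]; first by exists z; rewrite // expr0 mul1r.
  exists (finite_rank (flip s) (finite_rank s z')).
    by rewrite /= IH1 /h -cmulA finite_rank_rep_mul star_finite_rank_rep finite_rank_rep_mul.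
  apply: le_trans (hk' _) _; rewrite exprS -mulrA expr2 -mulrA.
  rewrite ler_wpM2l ?(ltW k0) //; apply: le_trans (hk _) _.
  by rewrite ler_wpM2l ?(ltW k0).
pose C := \sum_(p <- s) nm p.1 * nm p.2.
have C0 : 0 <= C by apply: sumr_ge0 => p _; rewrite mulr_ge0 ?nm_ge0.
have hpow n : nm (iter n (fun b => h ** b) h) <= C * nm K * (k ^+ 2) ^+ n.
  have -> : iter n (fun b => h ** b) h =
      \sum_(p <- s) iter n (fun b => h ** b) (t p.2) ** star (t p.1) ** K.
    elim: n => [|n IH]; last first.
      by rewrite /= IH cmul_sumr; apply: eq_bigr => p _; rewrite !cmulA.
    by rewrite /= {1}/h star_finite_rank_rep /finite_rank_rep big_map cmul_suml.
  apply: le_trans (nm_sum _ _) _; rewrite !mulr_suml; apply: ler_sum => p _.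
  have [z' -> hz'] := htz n p.2.
  apply: le_trans (nmM _ _) _; rewrite mulrAC ler_wpM2r ?nm_ge0 //.
  apply: le_trans (nmM _ _) _; rewrite nm_star mulrC -mulrA ler_pM ?nm_ge0 ?nm_rep //.
  by apply: le_trans (nm_rep _) _; rewrite mulrC.
have hsa : selfadj h by exact: selfadj_cstar.
have hD n m : iter (n + m).+1 (fun b => h ** b) h =
    iter n (fun b => h ** b) h ** iter m (fun b => h ** b) h.
  by elim: n => [//|n IH]; rewrite addSn iterS IH cmulA.
have hsq m : selfadj (iter (2 ^ m).-1 (fun b => h ** b) h) /\
    nm (iter (2 ^ m).-1 (fun b => h ** b) h) = nm h ^+ (2 ^ m).
  elim: m => [|m [IH1 IH2]]; first by rewrite /= expr1.
  have -> : (2 ^ m.+1).-1 = ((2 ^ m).-1 + (2 ^ m).-1).+1.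
    by rewrite -addnS prednK ?expn_gt0 // expnS mul2n -addnn; case: (2 ^ m)%N (expn_gt0 2 m).
  rewrite hD; split; first exact: selfadjM.
  by rewrite nm_sq // IH2 -exprM expnSr.
have k20 : 0 < k ^+ 2 by rewrite exprn_gt0.
have hle : nm h <= k ^+ 2.
  rewrite leNgt; apply/negP => lt.
  apply: (@no_exp_growth R (nm h / k ^+ 2 - 1) (C * nm K / k ^+ 2) 0) => //.
  - by rewrite subr_gt0 ltr_pdivlMr // mul1r.
  - by rewrite divr_ge0 ?mulr_ge0 ?nm_ge0 // ltW.
  move=> m; rewrite mul0r addr0 addrC subrK expr_div_n ler_pdivrMr ?exprn_gt0 //.
  rewrite -(hsq m).2; apply: le_trans (hpow _) _.
  move: (k ^+ 2) k20 => k2 k20.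
  rewrite -[X in _ <= _ * _ ^+ X](prednK (expn_gt0 2 m)) exprS.
  by rewrite mulrA divfK // gt_eqF.
by rewrite -(@ler_pXn2r _ 2) ?nnegrE ?nm_ge0 ?(ltW k0) // -nm_cstar.
Qed.


Definition scale_rank c (s : seq (X * X)) := [seq (c *: p.1, p.2) | p <- s].

Lemma finite_rank_cat s1 s2 z : finite_rank (s1 ++ s2) z = finite_rank s1 z + finite_rank s2 z.
Proof. exact: big_cat. Qed.
Lemma finite_rank_scale c s z : finite_rank (scale_rank c s) z = c *: finite_rank s z.
Proof.
by rewrite /finite_rank big_map scaler_sumr; apply: eq_bigr => p _; rewrite /theta ractZl.
Qed.
Lemma finite_rank_rep_cat s1 s2 : finite_rank_rep (s1 ++ s2) = finite_rank_rep s1 + finite_rank_rep s2.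
Proof. exact: big_cat. Qed.
Lemma finite_rank_rep_scale c s : finite_rank_rep (scale_rank c s) = c *: finite_rank_rep s.
Proof.
by rewrite /finite_rank_rep big_map scaler_sumr; apply: eq_bigr => p _; rewrite tZ cmulZl.
Qed.

Lemma finite_rank_rep_dist (S : X -> X) s1 s2 r1 r2 : 0 < r1 -> 0 < r2 ->
  approx S s1 r1 -> approx S s2 r2 -> nm (finite_rank_rep s1 - finite_rank_rep s2) <= r1 + r2.
Proof.
move=> r10 r20 h1 h2.
have -> : finite_rank_rep s1 - finite_rank_rep s2 = finite_rank_rep (s1 ++ scale_rank (-1) s2).
  by rewrite finite_rank_rep_cat finite_rank_rep_scale scaleN1r.
apply: finite_rank_rep_le; first exact: addr_gt0.
move=> z; rewrite finite_rank_cat finite_rank_scale scaleN1r mulrDl.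
apply: le_trans (nm_tri (S z) _ _) _; apply: lerD; last exact: h2.
by rewrite nm_dist; exact: h1.
Qed.

(** A relation instead of a limit: linearity, multiplicativity and so on are
    then checked on one well chosen approximant for every r. *)
Definition psi_rel (S : X -> X) b :=
  forall r, 0 < r -> exists2 s, approx S s r & nm (b - finite_rank_rep s) <= r.

Lemma psi_rel_unique S b b' : psi_rel S b -> psi_rel S b' -> b = b'.
Proof.
move=> hb hb'; apply/eqP; rewrite -subr_eq0; apply/eqP/nm_le0/ler_addgt0Pr => r r0.
have r4 : 0 < r / 4 by rewrite divr_gt0.
have [s hs bs] := hb _ r4; have [s' hs' bs'] := hb' _ r4.
have := nm_tri (finite_rank_rep s) b b'; have := nm_tri (finite_rank_rep s') (finite_rank_rep s) b'.
have := finite_rank_rep_dist r4 r4 hs hs'; rewrite (nm_dist (finite_rank_rep s') b'); lra.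
Qed.

Lemma psi_rel_exists S : compact_op S -> exists b, psi_rel S b.
Proof.
move=> cS.
have /choice [s hs] : forall n : nat, exists s, approx S s n.+1%:R^-1.
  move=> n; apply: compact_approx => //; rewrite invr_gt0.
have small (r : R) : 0 < r -> exists N, forall n, (N <= n)%N -> n.+1%:R^-1 <= r.
  move=> r0; exists (Num.truncn r^-1) => n Nn.
  rewrite -[leRHS]invrK lef_pV2 ?posrE ?invr_gt0 //.
  apply: le_trans (ltW (truncnS_gt _)) _; by rewrite ler_nat.
have inv0 n : 0 < n.+1%:R^-1 :> R by rewrite invr_gt0.
have [b hb] : exists b, tends (fun n => finite_rank_rep (s n)) b.
  apply: cauchy_tends => r r0; have [|N hN] := small (r / 2); first by rewrite divr_gt0.
  exists N => n m /hN hn /hN hm.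
  apply: le_trans (finite_rank_rep_dist (inv0 n) (inv0 m) (hs n) (hs m)) _.
  by rewrite [leRHS]splitr lerD.
exists b => r r0; have [N hN] := small r r0; have [M hM] := hb r r0.
exists (s (maxn N M)); last by rewrite nm_dist hM // leq_maxr.
move=> z; apply: le_trans (hs _ z) _; rewrite ler_wpM2r ?nm_ge0 //.
by apply: hN; rewrite leq_maxl.
Qed.

Definition psi_map (S : X -> X) : B := xget 0 [set b | psi_rel S b].

Lemma psi_mapE S b : psi_rel S b -> psi_map S = b.
Proof.
move=> hb; apply: (psi_rel_unique _ hb).
exact: (@xgetPex _ 0 [set b' | psi_rel S b'] (ex_intro _ b hb)).
Qed.

Lemma psi_mapP S : compact_op S -> psi_rel S (psi_map S).
Proof. by move=> /psi_rel_exists [b hb]; rewrite (psi_mapE hb). Qed.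

Lemma psi_mul S z : compact_op S -> psi_map S ** t z = t (S z).
Proof.
move=> cS; apply/eqP; rewrite -subr_eq0; apply/eqP/nm_le0/ler_addgt0Pr => r r0.
rewrite add0r; pose k := nm z + 1; have k0 : 0 < k by rewrite ltr_wpDl ?nm_ge0.
have [|s hs bs] := psi_mapP cS (r := r / 2 / k); first by rewrite !divr_gt0.
have := nm_tri (t (finite_rank s z)) (psi_map S ** t z) (t (S z)).
have : nm (psi_map S ** t z - t (finite_rank s z)) <= r / 2 / k * k.
  rewrite -finite_rank_rep_mul -cmulBl; apply: le_trans (nmM _ _) _.
  by rewrite ler_pM ?nm_ge0 //; apply: le_trans (nm_rep _) _; rewrite lerDl.
have : nm (t (finite_rank s z) - t (S z)) <= r / 2 / k * k.
  rewrite nm_dist -tB; apply: le_trans (nm_rep _) _; apply: le_trans (hs z) _.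
  by rewrite ler_wpM2l ?lerDl // ltW // !divr_gt0.
rewrite divfK ?gt_eqF //; lra.
Qed.

Lemma psi_map_is_psi : is_psi t psi_map.
Proof.
split=> [x y|c S T cS cT|S T cS cT|S T cS ST].
- apply: psi_mapE => r r0; exists [:: (x, y)].
    by move=> z; rewrite /finite_rank big_seq1 subrr nm0 mulr_ge0 ?nm_ge0 ?ltW.
  by rewrite /finite_rank_rep big_seq1 subrr nm0 ltW.
- apply: psi_mapE => r r0; pose k := Normc.normc c + 1.
  have k0 : 0 < k by rewrite ltr_wpDl ?normc_ge0.
  have r1 : 0 < r / 2 / k by rewrite !divr_gt0.
  have r2 : 0 < r / 2 by rewrite divr_gt0.
  have ck (u : R) : 0 <= u -> Normc.normc c * (r / 2 / k * u) <= r / 2 * u.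
    move=> u0; have -> : r / 2 * u = k * (r / 2 / k * u) by field; rewrite gt_eqF.
    by rewrite ler_wpM2r ?lerDl // mulr_ge0 // ltW.
  have [s hs bs] := psi_mapP cS r1; have [s' hs' bs'] := psi_mapP cT r2.
  exists (scale_rank c s ++ s').
    move=> z; rewrite finite_rank_cat finite_rank_scale opprD addrACA -scalerBr.
    apply: le_trans (nmD _ _) _; rewrite nmZ [r in leRHS]splitr mulrDl; apply: lerD => //.
    apply: le_trans (ck _ (nm_ge0 z)); by rewrite ler_wpM2l ?normc_ge0.
  rewrite finite_rank_rep_cat finite_rank_rep_scale opprD addrACA -scalerBr.
  apply: le_trans (nmD _ _) _; rewrite nmZ [leRHS]splitr; apply: lerD => //.
  rewrite -[leRHS]mulr1; apply: le_trans (ck _ ler01).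
  by rewrite mulr1 ler_wpM2l ?normc_ge0.
- apply: psi_mapE => r r0; have [k k0 Sk] := compact_bounded cS.
  have [S' SS'] := cS.1.
  pose l := k + nm (psi_map S) + 1; have l0 : 0 < l.
    by rewrite ltr_wpDl ?addr_ge0 ?nm_ge0.
  have [|s hs bs] := psi_mapP cT (r := r / l); first by rewrite divr_gt0.
  exists [seq (S p.1, p.2) | p <- s].
    move=> z; have -> : finite_rank [seq (S p.1, p.2) | p <- s] z = S (finite_rank s z).
      rewrite /finite_rank big_map; elim: s {hs bs} => [|p s IH].
        by rewrite !big_nil -[X in S X](scale0r 0) (adjointZ _ _ SS') scale0r.
      by rewrite !big_cons (adjointD _ _ SS') IH /theta (adjoint_ract _ _ SS').
    rewrite -(adjointB _ _ SS'); apply: le_trans (Sk _) _.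
    apply: (@le_trans _ _ (k * (r / l * nm z))); first by rewrite ler_wpM2l.
    rewrite mulrA ler_wpM2r ?nm_ge0 // mulrA ler_pdivrMr // mulrC ler_wpM2l ?(ltW r0) //.
    by rewrite /l -addrA lerDl addr_ge0 ?nm_ge0.
  have -> : finite_rank_rep [seq (S p.1, p.2) | p <- s] = psi_map S ** finite_rank_rep s.
    rewrite /finite_rank_rep big_map cmul_sumr; apply: eq_bigr => p _ /=.
    by rewrite cmulA psi_mul.
  rewrite -cmulBr; apply: le_trans (nmM _ _) _.
  apply: (@le_trans _ _ (nm (psi_map S) * (r / l))); first by rewrite ler_wpM2l ?nm_ge0.
  rewrite mulrA ler_pdivrMr // mulrC ler_wpM2l ?(ltW r0) //.
  by rewrite /l -addrA addrCA lerDl addr_ge0.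
- apply: psi_mapE => r r0; have [s hs bs] := psi_mapP cS r0.
  exists (flip s); last by rewrite -star_finite_rank_rep -starB nm_star.
  apply: adjoint_le (hs); last exact: ltW.
  by move=> u v; rewrite innerBl innerBr ST finite_rank_adjoint.
Qed.

End HilbertModule.

(** * The Hilbert space l^2(N) *)

Section Ell2Facts.
Variable R : realType.
Implicit Types (x y z : ell2 R) (n : nat).
Local Notation nc := (@Normc.normc R).

Lemma nm_ell2 x : nm x = l2norm x.
Proof. by rewrite /nm ell2_normE. Qed.

Definition ip x y : R[i] := ell2_inner x y.


Lemma ipDr x y z : ip x (y + z) = ip x y + ip x z.
Proof. exact: (@innerDr _ _ (ell2 R)). Qed.
Lemma ipBr x y z : ip x (y - z) = ip x y - ip x z.
Proof. exact: (@innerBr _ _ (ell2 R)). Qed.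
Lemma ipZr c x y : ip x (c *: y) = c * ip x y.
Proof. exact: (@innerZr _ _ (ell2 R)). Qed.
Lemma ipDl x y z : ip (x + y) z = ip x z + ip y z.
Proof. exact: (@innerDl _ _ (ell2 R)). Qed.
Lemma ipBl x y z : ip (x - y) z = ip x z - ip y z.
Proof. exact: (@innerBl _ _ (ell2 R)). Qed.
Lemma ipZl c x y : ip (c *: x) y = conjc c * ip x y.
Proof. exact: (@innerZl _ _ (ell2 R)). Qed.
Lemma ipJ x y : conjc (ip x y) = ip y x.
Proof. exact: (@innerJ _ _ (ell2 R)). Qed.
Lemma ipxx x : ip x x = (nm x ^+ 2)%:C%C.
Proof. by rewrite /ip ell2_innerxx nm_ell2. Qed.
Lemma ip0r x : ip x 0 = 0.
Proof. exact: (@inner0r _ _ (ell2 R)). Qed.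
Lemma ip_sumr (I : Type) (s : seq I) (F : I -> ell2 R) y :
  ip y (\sum_(i <- s) F i) = \sum_(i <- s) ip y (F i).
Proof. exact: (@inner_sumr _ _ (ell2 R)). Qed.

Lemma mulc_conj (c : R[i]) : c * conjc c = (nc c ^+ 2)%:C%C.
Proof.
rewrite Defs.sqr_normc; case: c => a b; apply/eqP; rewrite eq_complex /=.
by apply/andP; split; apply/eqP; ring.
Qed.

(** Expand |v|^2 >= 0 for v = |x|^2 y - <x, y> x. *)
Lemma ip_le x y : nc (ip x y) <= nm x * nm y.
Proof.
have [x0|x0] := eqVneq (nm x) 0.
  by rewrite (nm_eq0 x0) -(scale0r 0) ipZl rmorph0 mul0r Normc.normc0 mulr_ge0 ?nm_ge0.
have xp : 0 < nm x by rewrite lt_def x0 nm_ge0.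
pose N : R := nm x ^+ 2; have Np : 0 < N by rewrite exprn_gt0.
pose c := ip x y; pose v := N%:C%C *: y - c *: x.
have : ip v v = (N ^+ 2 * nm y ^+ 2 - N * nc c ^+ 2)%:C%C.
  rewrite ipBr !ipBl !ipZr !ipZl !ipxx -/N -(ipJ x y) -/c conjc_real.
  have -> : (N ^+ 2 * nm y ^+ 2 - N * nc c ^+ 2)%:C%C = N%:C%C ^+ 2 * (nm y ^+ 2)%:C%C
      - N%:C%C * (c * conjc c).
    by rewrite mulc_conj -rmorphXn -!rmorphM -rmorphB.
  ring.
rewrite ipxx => -[h]; have : 0 <= N ^+ 2 * nm y ^+ 2 - N * nc c ^+ 2 by rewrite -h sqr_ge0.
rewrite expr2 -mulrA -mulrBr pmulr_rge0 // subr_ge0 -exprMn => h2.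
by rewrite -(@ler_pXn2r _ 2) ?nnegrE ?normc_ge0 ?mulr_ge0 ?nm_ge0.
Qed.

Lemma ell2_inner_le x y : nm (inner x y : scalars R) <= nm x * nm y.
Proof. exact: ip_le. Qed.

Lemma ell2_ract_le x (a : scalars R) : nm (ract x a : ell2 R) <= nm x * nm a.
Proof. by rewrite [ract x a]/(ell2_ract x a) nmZ mulrC. Qed.

Lemma csum1 (u : nat -> R[i]) k : (forall n, n <> k -> u n = 0) -> csum u = u k.
Proof.
move=> hu.
have H (v : nat -> R) : (forall n, n <> k -> v n = 0) -> limn (series v) = v k.
  move=> hv; apply/cvg_lim => //; apply: cvg_near_cst; exists k.+1 => // n /= kn.
  rewrite /series /= big_mkord (bigD1 (Ordinal kn)) //= big1 ?addr0 // => i ik.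
  by apply: hv => E; case/eqP: ik; apply: val_inj.
rewrite /csum (H (fun n => complex.Re (u n))) ?(H (fun n => complex.Im (u n))).
- by case: (u k).
- by move=> n /hu ->.
- by move=> n /hu ->.
Qed.

Lemma basis_summable k : square_summable (fun n => (n == k)%:R : R[i]).
Proof.
apply/square_summableP; exists (\sum_(0 <= n < k.+1) nc ((n == k)%:R)) => N.
apply: le_trans (pnorm_le_sum _ _) _; have [Nk|kN] := leqP N k.+1.
  rewrite (big_cat_nat (leq0n N) Nk) /= lerDl.
  by apply: sumr_ge0 => i _; apply: normc_ge0.
rewrite (big_cat_nat (leq0n k.+1) (ltnW kN)) /= gerDl.
rewrite big_nat_cond big1 // => i; rewrite andbT => /andP[ki _].
by rewrite gtn_eqF // Normc.normc0.
Qed.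

Definition basis_vec k : ell2 R := mk_ell2 (@basis_summable k).

Lemma basis_vecE k n : basis_vec k n = (n == k)%:R :> R[i].
Proof. by []. Qed.

Lemma ip_basis_vec k x : ip (basis_vec k) x = x k.
Proof.
rewrite /ip /ell2_inner (@csum1 _ k).
  by rewrite [basis_vec k k]basis_vecE eqxx conjc_nat mul1r.
by move=> n /eqP nk; rewrite [basis_vec k n]basis_vecE (negbTE nk) conjc_nat mul0r.
Qed.

Lemma nm_basis_vec k : nm (basis_vec k) = 1.
Proof.
have : nm (basis_vec k) ^+ 2 = 1.
  by apply: complexI; rewrite -ipxx ip_basis_vec basis_vecE eqxx.
by move=> /eqP; rewrite sqrf_eq1 => /orP[/eqP //|/eqP h]; have := nm_ge0 (basis_vec k); rewrite h; lra.
Qed.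


Definition trunc N x : ell2 R := \sum_(n < N) (x n : R[i]) *: basis_vec n.

Lemma truncE N x n : trunc N x n = if (n < N)%N then x n else 0 :> R[i].
Proof.
rewrite -ip_basis_vec ip_sumr; case: ltnP => nN.
  rewrite (bigD1 (Ordinal nN)) //= big1 ?addr0.
    by rewrite ipZr ip_basis_vec basis_vecE eqxx mulr1.
  move=> i /eqP ni; rewrite ipZr ip_basis_vec basis_vecE; case: eqP => [E|_]; rewrite ?mulr0 //.
  by case: ni; apply: val_inj.
rewrite big1 // => i _; rewrite ipZr ip_basis_vec basis_vecE; case: eqP => [E|_]; rewrite ?mulr0 //.
by move: nN; rewrite E leqNgt ltn_ord.
Qed.

Lemma trunc_tends x : tends (fun N => trunc N x) x.
Proof.
move=> r r0; have cx := @ell2_summable R x.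
have /cvgrPdist_le /(_ (r ^+ 2)) [|N _ hN] := cx; first by rewrite exprn_gt0.
exists N => n Nn; rewrite nm_dist nm_ell2; apply: l2norm_le => M.
rewrite -(@ler_pXn2r _ 2) ?nnegrE ?pnorm_ge0 ?(ltW r0) // sqr_sqrtr ?psum_ge0 //.
have [Mn|nM] := leqP M n.
  rewrite big_nat big1 ?sqr_ge0 // => i /andP[_ iM].
  by rewrite ell2_funB truncE (leq_trans iM Mn) subrr Normc.normc0 expr0n.
have -> : \sum_(0 <= i < M) nc ((x - trunc n x) i) ^+ 2 = \sum_(n <= i < M) nc (x i) ^+ 2.
  transitivity (\sum_(0 <= i < M) (if (i < n)%N then 0 else nc (x i) ^+ 2)).
    apply: eq_big_nat => i _; rewrite ell2_funB truncE.
    by case: ltnP => _; rewrite ?subr0 // subrr Normc.normc0 expr0n.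
  rewrite (big_cat_nat (leq0n n) (ltnW nM)) /= big_nat big1 ?add0r.
    by apply: eq_big_nat => i /andP[ni _]; rewrite ltnNge ni.
  by move=> i /andP[_ ->].
have := hN n Nn; rewrite /= => /ler_normlW; apply: le_trans.
rewrite lerBrDl; have := nondecreasing_cvgn_le (psum_nd x) cx M; apply: le_trans.
by rewrite /series /= (big_cat_nat (leq0n n) (ltnW nM)).
Qed.

(** Truncations converge in norm, so the linear combinations of the basis
    vectors are dense. *)
Lemma basis_ext (V : normedModType R[i]) (f g : ell2 R -> V) k :
  linear f -> linear g -> (forall x, nm (f x) <= k * nm x) ->
  (forall x, nm (g x) <= k * nm x) -> (forall n, f (basis_vec n) = g (basis_vec n)) -> f =1 g.
Proof.
move=> lf lg hf hg fg x.
have lin0 (h : ell2 R -> V) : linear h -> h 0 = 0.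
  move=> lh; apply: (addIr (h 0)); have := lh 1 0 0.
  by rewrite !scale1r addr0 add0r => <-.
have lin_sum (h : ell2 R -> V) N : linear h ->
    h (trunc N x) = \sum_(n < N) (x n : R[i]) *: h (basis_vec n).
  move=> lh; rewrite /trunc; elim/big_rec2: _ => [|i a b _ <-]; first exact: lin0.
  exact: lh.
have lin_tends (h : ell2 R -> V) : linear h -> (forall x, nm (h x) <= k * nm x) ->
    tends (fun N => h (trunc N x)) (h x).
  move=> lh hh; apply: (@tends_lip _ _ _ h k _ _ _ (trunc_tends x)) => y.
  have -> : h y - h x = h (y - x).
    have E := lh (-1) x y; rewrite scaleN1r scaleN1r in E.
    by rewrite [y - x]addrC E addrC.
  exact: hh.
apply: tends_unique (lin_tends f lf hf) _.
apply: tends_eq (lin_tends g lg hg) => N.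
by rewrite !lin_sum //; apply: eq_bigr => i _; rewrite fg.
Qed.

End Ell2Facts.

(** * Bounded operators on l^2(N) *)

Section BoundedOperators.
Variable R : realType.
Local Notation H := (ell2 R).

Definition adjoint_op (f g : H -> H) := forall x y, ip (f x) y = ip x (g y).

Definition bounded_op (f : H -> H) := exists2 M : R, 0 <= M & forall x, nm (f x) <= M * nm x.

Definition bop_pred : pred (H -> H) :=
  fun f => `[< (exists g, adjoint_op f g) /\ bounded_op f >].

Lemma adjoint_opE (f g : H -> H) : adjoint_op f g -> adjoint_pair f g.
Proof. by []. Qed.

Fact bop_submod_closed : subsemimod_closed bop_pred.
Proof.
split; first split.
- apply/asboolP; split; first by exists 0 => x y; rewrite -[LHS]/(ip 0 y) -[RHS]/(ip x 0) ip0r -ipJ ip0r rmorph0.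
  by exists 0 => // x; rewrite -[X in nm X]/(0 : H) nm0 mul0r.
- move=> f g /asboolP [[f' ff'] [M M0 hM]] /asboolP [[g' gg'] [N N0 hN]].
  apply/asboolP; split; first by exists (f' + g') => x y; rewrite ipDl ipDr ff' gg'.
  exists (M + N) => [|x]; first exact: addr_ge0.
  by rewrite mulrDl; apply: le_trans (nmD _ _) _; apply: lerD.
- move=> c f /asboolP [[f' ff'] [M M0 hM]]; apply/asboolP; split.
    exists (conjc c *: f') => x y.
    rewrite -[(c *: f) x]/(c *: f x) -[(conjc c *: f') y]/(conjc c *: f' y).
    by rewrite ipZl ipZr ff'.
  exists (Normc.normc c * M) => [|x]; first by rewrite mulr_ge0 ?normc_ge0.
  by rewrite -[(c *: f) x]/(c *: f x) nmZ -mulrA ler_wpM2l ?normc_ge0.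
Qed.

HB.instance Definition _ :=
  GRing.isSubmodClosed.Build R[i] (H -> H) bop_pred bop_submod_closed.

End BoundedOperators.

(** Asking for an adjoint makes linearity automatic and spares the Riesz
    representation theorem. *)
Record bop (R : realType) := Bop {
  bop_fun :> ell2 R -> ell2 R;
  bopP : bop_pred bop_fun
}.

HB.instance Definition _ (R : realType) := [isSub for @bop_fun R].
HB.instance Definition _ (R : realType) := [Choice of bop R by <:].
HB.instance Definition _ (R : realType) := [SubChoice_isSubLmodule of bop R by <:].

Section BopNorm.
Variable R : realType.
Local Notation H := (ell2 R).
Implicit Types (f g : bop R) (x y : H).

Lemma bopD f g x : (f + g) x = f x + g x. Proof. by []. Qed.
Lemma bopB f g x : (f - g) x = f x - g x. Proof. by []. Qed.
Lemma bopZ (c : R[i]) f x : (c *: f) x = c *: f x. Proof. by []. Qed.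

Lemma bop_bounded f : bounded_op f.
Proof. by have /asboolP [hf hb] := bopP f. Qed.

Lemma bop_ext f g : f =1 g -> f = g.
Proof. by move=> fg; apply: val_inj; apply/funext. Qed.

Definition opnorm f : R := sup [set nm (f x) | x in [set x : H | nm x <= 1]].

Lemma opnorm_has_sup f : has_sup [set nm (f x) | x in [set x : H | nm x <= 1]].
Proof.
split; first by exists (nm (f 0)), 0 => //=; rewrite nm0.
have [M M0 hM] := bop_bounded f; exists M => _ [x /= x1 <-].
by apply: le_trans (hM x) _; rewrite ler_piMr.
Qed.

Lemma opnorm_le f (M : R) : 0 <= M -> (forall x, nm (f x) <= M * nm x) -> opnorm f <= M.
Proof.
move=> M0 hM; apply: ge_sup; first by case: (opnorm_has_sup f).
by move=> _ [x /= x1 <-]; apply: le_trans (hM x) _; rewrite ler_piMr.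
Qed.

Lemma opnorm_ge0 f : 0 <= opnorm f.
Proof.
have := ub_le_sup (opnorm_has_sup f).2 => /(_ (nm (f 0))) h.
by apply: le_trans (nm_ge0 (f 0)) (h _); exists 0 => //=; rewrite nm0.
Qed.

Lemma bop_adj_ex f : exists h : H -> H, adjoint_op f h.
Proof. by have /asboolP [hf hb] := bopP f. Qed.

Lemma bop_linear f c x y : f (c *: x + y) = c *: f x + f y.
Proof.
have [g /adjoint_opE fg] := bop_adj_ex f.
rewrite [LHS](adjointD _ _ fg); congr (_ + _); exact: (adjointZ _ _ fg).
Qed.

Lemma bop_addr f x y : f (x + y) = f x + f y.
Proof. by have := bop_linear f 1 x y; rewrite !scale1r. Qed.
Lemma bop_0 f : f 0 = 0.
Proof. by apply: (addIr (f 0)); rewrite -bop_addr addr0 add0r. Qed.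
Lemma bop_scale f c x : f (c *: x) = c *: f x.
Proof. by have := bop_linear f c x 0; rewrite !addr0 bop_0 addr0. Qed.
Lemma bop_subr f x y : f (x - y) = f x - f y.
Proof. by rewrite bop_addr -scaleN1r bop_scale scaleN1r. Qed.

Lemma le_opnorm f x : nm (f x) <= opnorm f * nm x.
Proof.
have [x0|x0] := eqVneq (nm x) 0.
  by rewrite (nm_eq0 x0) bop_0 nm0 mulr0.
have xp : 0 < nm x by rewrite lt_def x0 nm_ge0.
rewrite -ler_pdivrMr // mulrC -nmZr ?invr_ge0 ?nm_ge0 // -bop_scale.
apply: ub_le_sup; first exact: (opnorm_has_sup f).2.
by exists ((nm x)^-1%:C%C *: x) => //=; rewrite nmZr ?invr_ge0 ?nm_ge0 // mulVf.
Qed.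

Definition bop_norm f : R[i] := (opnorm f)%:C%C.

Fact bop_ler_normD f g : bop_norm (f + g) <= bop_norm f + bop_norm g.
Proof.
rewrite -rmorphD lecR; apply: opnorm_le; first by rewrite addr_ge0 ?opnorm_ge0.
move=> x; rewrite bopD mulrDl; apply: le_trans (nmD _ _) _.
by apply: lerD; apply: le_opnorm.
Qed.

Lemma opnormZ_le (c : R[i]) f : opnorm (c *: f) <= Normc.normc c * opnorm f.
Proof.
apply: opnorm_le; first by rewrite mulr_ge0 ?normc_ge0 ?opnorm_ge0.
by move=> x; rewrite bopZ nmZ -mulrA ler_wpM2l ?normc_ge0 ?le_opnorm.
Qed.

Fact bop_normrZ (c : R[i]) f : bop_norm (c *: f) = `|c| * bop_norm f.
Proof.
rewrite normr_normc -rmorphM; congr (_%:C)%C => /=.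
apply/le_anti; rewrite opnormZ_le /=.
have [->|c0] := eqVneq c 0; first by rewrite Normc.normc0 mul0r opnorm_ge0.
have nc0 : 0 < Normc.normc c by rewrite -ltcR -normr_normc normr_gt0.
rewrite -ler_pdivlMl // -Normc.normcV.
by have := opnormZ_le c^-1 (c *: f); rewrite scalerA mulVf // scale1r.
Qed.

Fact bop_normr0_eq0 f : bop_norm f = 0 -> f = 0.
Proof.
move=> [f0]; apply: bop_ext => x; apply: nm_le0.
by have := le_opnorm f x; rewrite f0 mul0r.
Qed.

HB.instance Definition _ := Lmodule_isNormed.Build R[i] (bop R)
  bop_ler_normD bop_normrZ bop_normr0_eq0.

Lemma nm_bop f : nm f = opnorm f. Proof. by []. Qed.

Definition bop_adj f : H -> H := projT1 (cid (bop_adj_ex f)).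

Lemma bop_adjP f : adjoint_op f (bop_adj f).
Proof. exact: projT2 (cid (bop_adj_ex f)). Qed.

Lemma bop_adj_le f x : nm (bop_adj f x) <= opnorm f * nm x.
Proof.
apply: (adjoint_le (@ell2_inner_le R) (bop_adjP f) (opnorm_ge0 f)).
exact: le_opnorm.
Qed.

Fact bop_starP f : bop_pred (bop_adj f).
Proof.
apply/asboolP; split; first by exists f; exact: adjoint_sym (bop_adjP f).
by exists (opnorm f); [exact: opnorm_ge0|exact: bop_adj_le].
Qed.

Definition bop_star f : bop R := Bop (bop_starP f).

Fact bop_mulP f g : bop_pred (f \o g).
Proof.
apply/asboolP; split.
  by exists (bop_adj g \o bop_adj f) => x y /=; rewrite bop_adjP bop_adjP.
exists (opnorm f * opnorm g) => [|x]; first by rewrite mulr_ge0 ?opnorm_ge0.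
apply: le_trans (le_opnorm _ _) _; rewrite -mulrA ler_wpM2l ?opnorm_ge0 //.
exact: le_opnorm.
Qed.

Definition bop_mul f g : bop R := Bop (bop_mulP f g).

Lemma ip_ext x y : (forall z, ip z x = ip z y) -> x = y.
Proof. exact: (@innerI _ _ H). Qed.

(** The pointwise limits of the operators and of their adjoints exist and are
    adjoint to each other. *)
Lemma bop_complete (F : set_system (bop R)) : ProperFilter F -> cauchy F -> cvg F.
Proof.
move=> FF Fc.
have Fb (r : R) : 0 < r -> exists f0 : bop R, F [set f | nm (f - f0) <= r].
  move=> r0; have /cauchyP/(_ r%:C%C) [|f0 Ff0] := Fc; first by rewrite ltcR.
  exists f0; apply: filterS Ff0 => f; rewrite -ball_normE /= nmE ltcR nm_dist.
  exact: ltW.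
have /choice [u hu] : forall n : nat, exists f0 : bop R, F [set f | nm (f - f0) <= n.+1%:R^-1].
  by move=> n; apply: Fb; rewrite invr_gt0.
have udist n m : nm (u n - u m) <= n.+1%:R^-1 + m.+1%:R^-1.
  have [f [/= h1 h2]] := filter_ex (filterI (hu n) (hu m)).
  have := nm_tri f (u n) (u m); rewrite (nm_dist (u n) f) => h.
  by apply: le_trans h _; apply: lerD.
have small (r : R) : 0 < r -> exists N, forall n, (N <= n)%N -> n.+1%:R^-1 <= r.
  move=> r0; exists (Num.truncn r^-1) => n Nn.
  rewrite -[leRHS]invrK lef_pV2 ?posrE ?invr_gt0 //.
  apply: le_trans (ltW (truncnS_gt _)) _; by rewrite ler_nat.
have uc (r : R) : 0 < r -> exists N, forall n m, (N <= n)%N -> (N <= m)%N -> nm (u n - u m) <= r.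
  move=> r0; have [|N hN] := small (r / 2); first by rewrite divr_gt0.
  exists N => n m /hN hn /hN hm; apply: le_trans (udist n m) _.
  by rewrite [leRHS]splitr lerD.
have point (v : nat -> H -> H) : (forall n m x, nm (v n x - v m x) <= nm (u n - u m) * nm x) ->
    forall x, exists y, tends (fun n => v n x) y.
  move=> hv x; apply: cauchy_tends => r r0.
  have k0 : 0 < nm x + 1 by rewrite ltr_wpDl ?nm_ge0.
  have [|N hN] := uc (r / (nm x + 1)); first by rewrite divr_gt0.
  exists N => n m hn hm; apply: le_trans (hv n m x) _.
  apply: (@le_trans _ _ (r / (nm x + 1) * (nm x + 1))); last by rewrite divfK ?gt_eqF.
  by rewrite ler_pM ?nm_ge0 ?hN // lerDl.
have /choice [f hf] := point (fun n => u n) (fun n m x => le_opnorm (u n - u m) x).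
have adjB n m x : bop_adj (u n) x - bop_adj (u m) x = bop_adj (u n - u m) x.
  by apply: ip_ext => z; rewrite ipBr -!bop_adjP bopB ipBl.
have /choice [g hg] := point (fun n => bop_adj (u n))
  (fun n m x => eq_ind_r (fun y => nm y <= _) (bop_adj_le (u n - u m) x) (adjB n m x)).
have fle n (r : R) : (forall m, (n <= m)%N -> nm (u m - u n) <= r) ->
    forall x, nm (f x - u n x) <= r * nm x.
  move=> hr x; apply/ler_addgt0Pr => d d0; have [N hN] := hf x d d0.
  apply: le_trans (nm_tri (u (maxn N n) x) _ _) _; rewrite addrC; apply: lerD.
    rewrite -bopB; apply: le_trans (le_opnorm _ _) _.
    by rewrite ler_wpM2r ?nm_ge0 // hr // leq_maxr.
  by rewrite nm_dist; apply: hN; rewrite leq_maxl.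
have ipl x y : tends (fun n => ip (u n x) y : scalars R) (ip (f x) y : scalars R).
  apply: (@tends_lip _ H (scalars R) (fun z => ip z y : scalars R) (nm y) _ _ _ (hf x)) => z.
  by rewrite -[_ - _](ipBl z (f x) y) mulrC; exact: ip_le.
have ipr x y : tends (fun n => ip x (bop_adj (u n) y) : scalars R) (ip x (g y) : scalars R).
  apply: (@tends_lip _ H (scalars R) (fun z => ip x z : scalars R) (nm x) _ _ _ (hg y)) => z.
  by rewrite -[_ - _](ipBr x z (g y)); exact: ip_le.
have adjf : adjoint_op f g.
  move=> x y; apply: (tends_unique (ipl x y)).
  by apply: tends_eq (ipr x y) => n; exact: (esym (bop_adjP (u n) x y)).
have bf : bop_pred f.
  apply/asboolP; split; first by exists g.
  have [N hN] := uc 1 ltr01.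
  exists (1 + opnorm (u N)); first by rewrite addr_ge0 ?opnorm_ge0.
  move=> x; have := fle N 1 (fun m hm => hN m N hm (leqnn N)) x.
  have := nm_tri (u N x) (f x) 0; rewrite !subr0; have := le_opnorm (u N) x; lra.
apply/cvg_ex; exists (Bop bf); apply/cvgrPdist_le => r r0.
have [rI rR] : complex.Im r = 0 /\ 0 < complex.Re r.
  by move: r0; rewrite ltcE /= => /andP[/eqP -> ->].
have r2 : 0 < complex.Re r / 2 by rewrite divr_gt0.
have [N hN] := uc _ r2; have [M hM] := small _ r2.
pose n := maxn N M.
apply: filterS (hu n) => h /= hh.
rewrite nmE [r]complexE rI mulr0 addr0 lecR [leRHS]splitr.
apply: le_trans (nm_tri (u n) _ _) _; apply: lerD; last first.
  by rewrite nm_dist; apply: le_trans hh _; apply: hM; rewrite leq_maxr.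
rewrite nm_bop; apply: opnorm_le; first exact: ltW.
apply: fle => m nm'; apply: hN; last by rewrite leq_maxl.
by apply: leq_trans nm'; rewrite leq_maxl.
Qed.

HB.instance Definition _ := Uniform_isComplete.Build (bop R) bop_complete.

Fact bop_mulA : associative bop_mul.
Proof. by move=> f g h; apply: bop_ext. Qed.
Fact bop_mulDl : left_distributive bop_mul +%R.
Proof. by move=> f g h; apply: bop_ext => x; exact: (bopD f g (h x)). Qed.
Fact bop_mulDr : right_distributive bop_mul +%R.
Proof. by move=> f g h; apply: bop_ext => x; exact: (bop_addr f (g x) (h x)). Qed.
Fact bop_mulZl (c : R[i]) f g : bop_mul (c *: f) g = c *: bop_mul f g.
Proof. by apply: bop_ext => x; exact: (bopZ c f (g x)). Qed.
Fact bop_mulZr (c : R[i]) f g : bop_mul f (c *: g) = c *: bop_mul f g.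
Proof. by apply: bop_ext => x; exact: (bop_scale f c (g x)). Qed.

Lemma ip_star f x y : ip x (bop_star f y) = ip (f x) y.
Proof. by rewrite bop_adjP. Qed.

Fact bop_starK : involutive bop_star.
Proof.
move=> f; apply: bop_ext => y; apply: ip_ext => x.
by rewrite ip_star -ipJ ip_star ipJ.
Qed.
Fact bop_starD : {morph bop_star : f g / f + g}.
Proof.
move=> f g; apply: bop_ext => y; apply: ip_ext => x.
by rewrite bopD ipDr !ip_star -ipDl.
Qed.
Fact bop_starZ (c : R[i]) f : bop_star (c *: f) = conjc c *: bop_star f.
Proof.
apply: bop_ext => y; apply: ip_ext => x.
by rewrite bopZ ipZr !ip_star -ipZl.
Qed.
Fact bop_starM f g : bop_star (bop_mul f g) = bop_mul (bop_star g) (bop_star f).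
Proof.
apply: bop_ext => y; apply: ip_ext => x.
by rewrite !ip_star.
Qed.
Fact bop_norm_mul f g : `|bop_mul f g| <= `|f| * `|g|.
Proof.
rewrite !nmE -rmorphM lecR !nm_bop; apply: opnorm_le.
  by rewrite mulr_ge0 ?opnorm_ge0.
move=> x; apply: le_trans (le_opnorm f (g x)) _.
by rewrite -mulrA ler_wpM2l ?opnorm_ge0 ?le_opnorm.
Qed.
Fact bop_cstar f : `|bop_mul (bop_star f) f| = `|f| ^+ 2.
Proof.
rewrite !nmE -rmorphXn; congr (_%:C)%C; rewrite !nm_bop; apply/le_anti/andP; split.
  apply: opnorm_le; first exact: sqr_ge0.
  move=> x; rewrite expr2 -mulrA; apply: le_trans (bop_adj_le _ _) _.
  by rewrite ler_wpM2l ?opnorm_ge0 ?le_opnorm.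
set M := opnorm (bop_mul _ _); have M0 : 0 <= M by exact: opnorm_ge0.
rewrite -[leRHS]sqr_sqrtr // lerXn2r ?nnegrE ?opnorm_ge0 ?sqrtr_ge0 //.
apply: opnorm_le => [|x]; first exact: sqrtr_ge0.
rewrite -(@ler_pXn2r _ 2) ?nnegrE ?nm_ge0 ?mulr_ge0 ?sqrtr_ge0 ?nm_ge0 // exprMn (sqr_sqrtr M0).
have -> : nm (f x) ^+ 2 = nm (ip x (bop_mul (bop_star f) f x) : scalars R).
  rewrite [bop_mul _ _ x]/(bop_star f (f x)) ip_star ipxx.
  by rewrite -[LHS]ger0_norm ?sqr_ge0 // -normcr.
apply: le_trans (ip_le _ _) _; rewrite mulrC expr2 mulrA ler_wpM2r ?nm_ge0 //.
exact: le_opnorm.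
Qed.

HB.instance Definition _ := isCStarAlgebra.Build R (bop R)
  bop_mulA bop_mulDl bop_mulDr bop_mulZl bop_mulZr
  bop_starK bop_starD bop_starZ bop_starM bop_norm_mul bop_cstar.

Lemma bopM f g x : (f ** g) x = f (g x). Proof. by []. Qed.


End BopNorm.

(** * Partial injections and multiplication operators *)

Section PartialInjections.
Variable R : realType.
Local Notation H := (ell2 R).
Local Notation nc := (@Normc.normc R).

Lemma bop_basis_ext (f g : bop R) : (forall n, f (basis_vec R n) = g (basis_vec R n)) -> f = g.
Proof.
move=> fg; apply: bop_ext; apply: (@basis_ext _ _ _ _ (opnorm f + opnorm g)) => //.
- by move=> c x y; exact: bop_linear.
- by move=> c x y; exact: bop_linear.
- move=> x; apply: le_trans (le_opnorm f x) _.
  by rewrite ler_wpM2r ?nm_ge0 // lerDl opnorm_ge0.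
- move=> x; apply: le_trans (le_opnorm g x) _.
  by rewrite ler_wpM2r ?nm_ge0 // lerDr opnorm_ge0.
Qed.

(** Partial injections of N: they encode in one stroke permutations, creation
    operators and coordinate projections. *)
Record pinj := PInj {
  pfwd : nat -> option nat;
  pbwd : nat -> option nat;
  pinjP : forall m j, pfwd m = Some j <-> pbwd j = Some m
}.

Definition pinj_inv p := PInj (fun m j => iff_sym (pinjP p j m)).

Definition pinj_fun (p : pinj) (f : nat -> R[i]) : nat -> R[i] :=
  fun j => oapp f 0 (pbwd p j).

Lemma pinj_pnorm p (x : H) N : pnorm (pinj_fun p x) N <= nm x.
Proof.
pose s := pmap (pbwd p) (iota 0 N).
have us : uniq s.
  apply: (@pmap_uniq _ _ _ (fun m => odflt 0%N (pfwd p m))); last exact: iota_uniq.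
  by move=> j /=; case E: (pbwd p j) => [m|] //=; rewrite ((pinjP p m j).2 E).
pose K := (\max_(i <- s) i).+1.
have sK m : m \in s -> (m < K)%N by move=> ms; rewrite ltnS; exact: leq_bigmax_seq.
rewrite nm_ell2.
apply: le_trans (pnorm_le_l2norm K (@ell2_summable R x)).
rewrite ler_wsqrtr //.
have -> : \sum_(0 <= n < N) nc (pinj_fun p x n) ^+ 2 = \sum_(m <- s) nc (x m) ^+ 2.
  rewrite /s /index_iota subn0; elim: (iota 0 N) => [|j l IH]; first by rewrite !big_nil.
  rewrite big_cons IH; case E: (pbwd p j) => [m|].
    by rewrite /pinj_fun E [pmap _ (j :: l)]/= E big_cons.
  rewrite [pmap _ (j :: l)]/= E /pinj_fun E -[oapp _ _ None]/(0 : R[i]).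
  by rewrite Normc.normc0 expr0n add0r.
have -> : \sum_(m <- s) nc (x m) ^+ 2 = \sum_(m <- index_iota 0 K | m \in s) nc (x m) ^+ 2.
  rewrite -[RHS]big_filter; apply: perm_big; apply: uniq_perm => //.
    by rewrite filter_uniq // iota_uniq.
  move=> m; rewrite mem_filter mem_index_iota /=.
  by case ms: (m \in s) => //=; rewrite sK.
rewrite big_mkcond; apply: ler_sum => m _.
by case: ifP => // _; exact: sqr_ge0.
Qed.

Fact pinj_summable p (x : H) : square_summable (pinj_fun p x).
Proof. by apply/square_summableP; exists (nm x) => N; exact: pinj_pnorm. Qed.

Definition pinj_map p (x : H) : H := mk_ell2 (@pinj_summable p x).

Lemma pinj_mapE p x j : pinj_map p x j = oapp (x : nat -> R[i]) 0 (pbwd p j) :> R[i].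
Proof. by []. Qed.

Lemma pinj_map_le p x : nm (pinj_map p x) <= nm x.
Proof. by rewrite nm_ell2; apply: l2norm_le => N; exact: pinj_pnorm. Qed.

Lemma pinj_map_linear p : linear (pinj_map p).
Proof.
move=> c x y; apply: ell2_ext => j; rewrite -[RHS]/(c * (pinj_map p x j : R[i]) + pinj_map p y j).
rewrite !pinj_mapE; case: (pbwd p j) => [m|] //=.
by rewrite mulr0 addr0.
Qed.

Lemma pinj_map_basis p m : pinj_map p (basis_vec R m) = oapp (basis_vec R) 0 (pfwd p m).
Proof.
apply: ell2_ext => j; rewrite pinj_mapE.
case E: (pfwd p m) => [j'|]; case E': (pbwd p j) => [m'|].
- rewrite -[LHS]/((m' == m)%:R : R[i]) -[RHS]/((j == j')%:R : R[i]); congr (_%:R).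
  have := (pinjP p m' j).2 E'.
  have [->|mm] := eqVneq m' m; first by rewrite E => -[->]; rewrite eqxx.
  case: eqVneq => // -> /= E2; have := (pinjP p m j').1 E.
  by rewrite ((pinjP p m' j').1 E2) => -[F]; rewrite F eqxx in mm.
- rewrite -[LHS]/(0 : R[i]) -[RHS]/((j == j')%:R : R[i]).
  by case: eqVneq => // jj; move: E'; rewrite jj ((pinjP p m j').1 E).
- rewrite -[LHS]/((m' == m)%:R : R[i]) -[RHS]/(0 : R[i]).
  case: eqVneq => // mm; have := (pinjP p m' j).2 E'.
  by rewrite mm E.
- by [].
Qed.

(** Both sides are bounded and linear in the second vector, and they agree on
    basis vectors. *)
Lemma pinj_adjoint p : adjoint_op (pinj_map p) (pinj_map (pinj_inv p)).
Proof.
move=> x; apply: (@basis_ext R (scalars R) (fun y => ip (pinj_map p x) y : scalars R)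
  (fun y => ip x (pinj_map (pinj_inv p) y) : scalars R) (nm x)).
- by move=> c y z; rewrite -[LHS]/(ip _ _) ipDr ipZr.
- by move=> c y z; rewrite -[LHS]/(ip _ _) pinj_map_linear ipDr ipZr.
- move=> y; apply: le_trans (ip_le _ _) _; rewrite ler_wpM2r ?nm_ge0 //.
  exact: pinj_map_le.
- move=> y; apply: le_trans (ip_le _ _) _; rewrite ler_wpM2l ?nm_ge0 //.
  exact: pinj_map_le.
move=> k; rewrite -[LHS]/(ip (pinj_map p x) (basis_vec R k)) -ipJ ip_basis_vec pinj_mapE.
rewrite pinj_map_basis [pfwd _ k]/=; case: (pbwd p k) => [m|].
  by rewrite -[RHS]/(ip x (basis_vec R m)) -[RHS]ipJ ip_basis_vec.
by rewrite -[RHS]/(ip x 0) ip0r -[oapp _ _ None]/(0 : R[i]) rmorph0.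
Qed.

Fact pinj_bopP p : bop_pred (pinj_map p).
Proof.
apply/asboolP; split; first by exists (pinj_map (pinj_inv p)); exact: pinj_adjoint.
by exists 1 => // x; rewrite mul1r pinj_map_le.
Qed.

Definition pinj_op p : bop R := Bop (pinj_bopP p).

Lemma pinj_op_basis p m : pinj_op p (basis_vec R m) = oapp (basis_vec R) 0 (pfwd p m).
Proof. exact: pinj_map_basis. Qed.

Lemma pinj_opE p x j : pinj_op p x j = oapp (x : nat -> R[i]) 0 (pbwd p j) :> R[i].
Proof. by []. Qed.

Lemma star_pinj_op p : star (pinj_op p) = pinj_op (pinj_inv p).
Proof.
apply: bop_ext => y; apply: ip_ext => x.
by rewrite [star _]/(bop_star _) ip_star; exact: pinj_adjoint.
Qed.

Lemma pinj_op_le p x : nm (pinj_op p x) <= nm x.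
Proof. exact: pinj_map_le. Qed.

Definition bop1_pinj := PInj (fun m j : nat => (conj (fun h : Some m = Some j => esym h) (fun h => esym h))).

Definition bop1 := pinj_op bop1_pinj.

Lemma bop1E x : bop1 x = x.
Proof. by apply: ell2_ext. Qed.

Lemma bop1_unit : is_unit bop1.
Proof. by split=> f; apply: bop_ext => x; rewrite bopM bop1E. Qed.

Lemma partial_idP (a : pred nat) m j :
  (if a m then Some m else None) = Some j <-> (if a j then Some j else None) = Some m.
Proof.
by split; [case am: (a m) => // -[<-]; rewrite am|case aj: (a j) => // -[<-]; rewrite aj].
Qed.

Definition pproj (a : pred nat) : bop R := pinj_op (PInj (partial_idP a)).

Lemma pproj_basis a m : pproj a (basis_vec R m) = if a m then basis_vec R m else 0.
Proof. by rewrite pinj_op_basis /=; case: (a m). Qed.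

Lemma pprojE a x j : pproj a x j = if a j then x j else 0 :> R[i].
Proof. by rewrite pinj_opE /=; case: (a j). Qed.

Lemma star_pproj a : star (pproj a) = pproj a.
Proof.
rewrite /pproj star_pinj_op; apply: bop_ext => x; apply: ell2_ext => j.
by rewrite !pinj_opE.
Qed.

Lemma pproj_idem a : pproj a ** pproj a = pproj a.
Proof.
apply: bop_ext => x; apply: ell2_ext => j; rewrite bopM !pprojE.
by case: (a j).
Qed.

Section Diagonal.
Variables (f : nat -> R) (M : R).
Hypothesis fM : forall n, `|f n| <= M.

Let M0 : 0 <= M. Proof. exact: le_trans (normr_ge0 _) (fM 0%N). Qed.

Lemma diag_pnorm (x : H) N : pnorm (fun n => (f n)%:C%C * (x n : R[i])) N <= M * nm x.
Proof.
apply: le_trans (_ : M * pnorm x N <= _); last first.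
  by rewrite ler_wpM2l // nm_ell2; apply: pnorm_le_l2norm; exact: ell2_summable.
rewrite -[X in _ <= X * _](ger0_norm M0) -normcr -pnormZ.
rewrite ler_wsqrtr //; apply: ler_sum => i _.
rewrite lerXn2r ?nnegrE ?normc_ge0 // !Normc.normcM !normcr ler_wpM2r ?normc_ge0 //.
by rewrite (ger0_norm M0).
Qed.

Fact diag_summable (x : H) : square_summable (fun n => (f n)%:C%C * (x n : R[i])).
Proof. by apply/square_summableP; exists (M * nm x) => N; exact: diag_pnorm. Qed.

Definition diag_map (x : H) : H := mk_ell2 (@diag_summable x).

Lemma diag_adjoint : adjoint_op diag_map diag_map.
Proof.
move=> x y; congr csum; apply/funext => n.
rewrite -[diag_map x n]/((f n)%:C%C * (x n : R[i])) -[diag_map y n]/((f n)%:C%C * (y n : R[i])).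
have -> : conjc ((f n)%:C%C * (x n : R[i])) = (f n)%:C%C * conjc (x n : R[i]).
  by rewrite rmorphM; congr (_ * _); exact: conjc_real.
by rewrite mulrCA mulrA.
Qed.

Fact diag_bopP : bop_pred diag_map.
Proof.
apply/asboolP; split; first by exists diag_map; exact: diag_adjoint.
exists M => // x; rewrite nm_ell2; apply: l2norm_le => N; exact: diag_pnorm.
Qed.

Definition diag : bop R := Bop diag_bopP.

Lemma diagE x n : diag x n = (f n)%:C%C * (x n : R[i]) :> R[i].
Proof. by []. Qed.

Lemma diag_le x : nm (diag x) <= M * nm x.
Proof. rewrite nm_ell2; apply: l2norm_le => N; exact: diag_pnorm. Qed.

Let diag_term (x : H) : (fun n => complex.Re (conjc (x n : R[i]) * (diag x n : R[i]))) =
  (fun n => f n * nc (x n) ^+ 2).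
Proof.
by apply/funext => n; rewrite diagE mulrCA [conjc _ * _]mulrC mulc_conj -rmorphM.
Qed.

(** A formula which makes sense for unbounded multipliers too. *)
Lemma diag_ip (x : H) :
  complex.Re (ip x (diag x)) = limn (series (fun n => f n * nc (x n) ^+ 2)).
Proof. by rewrite -diag_term. Qed.

Lemma diag_ge0 x : (forall n, 0 <= f n) -> 0 <= complex.Re (ip x (diag x)).
Proof.
move=> f0; have cs : cvgn (series (fun n => f n * nc (x n) ^+ 2)).
  rewrite -diag_term.
  exact: (@abs_summable_Re _ _ (@ell2_abs_summable R x (diag x))).
rewrite diag_ip; apply: limr_ge => //; near=> N; apply: sumr_ge0 => n _.
by rewrite mulr_ge0 ?sqr_ge0.
Unshelve. all: by end_near. Qed.

End Diagonal.

End PartialInjections.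

(** * Representations of l^2(N) *)

Section CuntzIsometries.
Variables (R : realType) (B : cstarAlgType R) (e : B).
Hypothesis he : is_unit e.
Local Notation X := (ell2 R).

Let emul x : e ** x = x. Proof. by case: he. Qed.
Let mule x : x ** e = x. Proof. by case: he. Qed.

Definition scalar_map (a : scalars R) : B := (a : R[i]) *: e.

Lemma scalar_map_hom : star_hom scalar_map.
Proof.
split=> [c a b|a b|a]; rewrite /scalar_map.
- by rewrite scalerDl [in LHS]/*:%R /= scalerA.
- by rewrite cmulZl cmulZr mule scalerA.
- by rewrite starZ (selfadj_unit he).
Qed.

Lemma nm_scalar_map a : nm (scalar_map a) <= nm a.
Proof. by rewrite /scalar_map nmZ ler_piMr ?normc_ge0 ?nm_unit. Qed.

Section Representation.
Variable t : X -> B.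
Hypothesis tlin : linear t.
Hypothesis tinner : forall x y, star (t x) ** t y = ip x y *: e.

Lemma ell2_rigged : rigged scalar_map t.
Proof.
split.
- split; first exact: scalar_map_hom.
  apply/seteqP; split=> // b _; apply: subset_closure.
  exists 1%N, (fun=> 1), (fun=> b); split; last by rewrite big_ord1 scale1r.
  by move=> _; exists (1 : R[i]), b; rewrite /scalar_map scale1r emul.
- by split=> //; exact: (cc_of_inner he tinner).
- move=> a1 a2 x; rewrite /scalar_map cmulZl cmulZl cmulZr emul mule.
  have tZ c y : t (c *: y) = c *: t y.
    have t0 : t 0 = 0.
      by apply: (addIr (t 0)); have := tlin 1 0 0; rewrite !scale1r addr0 add0r => <-.
    by have := tlin c y 0; rewrite !addr0 t0 addr0.
  by rewrite -[lact _ _]/((a1 : R[i]) *: ((a2 : R[i]) *: x)) !tZ.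
- exact: tinner.
Qed.

(** A finite rank operator is small on the basis vectors of large index, on
    which the scalar a has norm |a|. *)
Lemma katsura_ell2 (a : scalars R) : katsura_ideal X a -> a = 0.
Proof.
move=> [ca _]; apply: nm_le0; apply/ler_addgt0Pr => r r0; rewrite add0r.
have [s hs] := compact_approx ca (r := r / 2) (divr_gt0 r0 (ltr0n R 2)).
have [k hk] : exists k, nm (finite_rank s (basis_vec R k)) <= r / 2.
  have : forall d, 0 < d -> exists N, forall k, (N <= k)%N -> nm (finite_rank s (basis_vec R k)) <= d.
    rewrite /finite_rank; elim: s {hs} => [|p s IH] d d0.
      by exists 0%N => k _; rewrite big_nil nm0 ltW.
    have [N hN] := IH _ (divr_gt0 d0 (ltr0n R 2)).
    have k0 : 0 < nm p.1 + 1 by rewrite ltr_wpDl ?nm_ge0.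
    have [M hM] := trunc_tends p.2 (divr_gt0 (divr_gt0 d0 (ltr0n R 2)) k0).
    exists (maxn N M) => k; rewrite geq_max => /andP[Nk Mk].
    rewrite big_cons [leRHS]splitr; apply: le_trans (nmD _ _) _; apply: lerD; last exact: hN.
    rewrite /theta -[ract _ _]/((ip p.2 (basis_vec R k)) *: p.1) nmZ.
    have h : Normc.normc (ip p.2 (basis_vec R k)) <= d / 2 / (nm p.1 + 1).
      have -> : ip p.2 (basis_vec R k) = ip (p.2 - trunc k p.2) (basis_vec R k).
        rewrite ipBl -[ip (trunc _ _) _]ipJ ip_basis_vec truncE ltnn.
        by rewrite rmorph0 subr0.
      apply: le_trans (ip_le _ _) _; rewrite nm_basis_vec mulr1 nm_dist.
      exact: hM.
    apply: (@le_trans _ _ (d / 2 / (nm p.1 + 1) * (nm p.1 + 1))).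
      by rewrite ler_pM ?normc_ge0 ?nm_ge0 // lerDl.
    by rewrite divfK ?gt_eqF.
  by move=> /(_ _ (divr_gt0 r0 (ltr0n R 2))) [N hN]; exists N; exact: hN.
have := hs (basis_vec R k); rewrite nm_basis_vec mulr1 => h2.
have <- : nm (lact a (basis_vec R k) : X) = nm a.
  by rewrite -[lact _ _]/((a : R[i]) *: basis_vec R k) nmZ nm_basis_vec mulr1.
have := nm_tri (finite_rank s (basis_vec R k)) (lact a (basis_vec R k)) 0; rewrite !subr0 => h3.
by apply: le_trans h3 _; rewrite [leRHS]splitr lerD.
Qed.

(** As the Katsura ideal is zero, only the existence of psi is at stake. *)
Lemma ell2_covariant : covariant scalar_map t.
Proof.
have t0 : t 0 = 0.
  by apply: (addIr (t 0)); have := tlin 1 0 0; rewrite !scale1r addr0 add0r => <-.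
have hpsi : is_psi t (psi_map t).
  apply: (psi_map_is_psi (@ell2_inner_le R) (@ell2_ract_le R) nm_scalar_map tlin) => //.
  move=> x a; have [_ _ h _] := ell2_rigged.
  have := h (1 : R[i]) a x; rewrite {1}/scalar_map scale1r emul => ->.
  by rewrite -[lact _ _]/((1 : R[i]) *: ract x a) scale1r.
exists (psi_map t); split=> // a /katsura_ell2 ->; rewrite /scalar_map scale0r.
have -> : lact (0 : scalars R) = theta 0 0 :> (X -> X).
  apply/funext => z; rewrite -[LHS]/((0 : R[i]) *: z) scale0r.
  by rewrite -[RHS]/(ip 0 z *: (0 : X)) scaler0.
by case: hpsi => -> _ _ _; rewrite t0 cmul0l.
Qed.

End Representation.

(** The map x |-> sum_n x_n S_n is isometric on finitely supported vectors, so
    it extends to l^2(N) by completeness. *)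
Lemma cuntz_representation (S : nat -> B) :
  (forall i j, star (S i) ** S j = if i == j then e else 0) ->
  exists t : X -> B, [/\ linear t,
    forall x y, star (t x) ** t y = ip x y *: e & forall n, t (basis_vec R n) = S n].
Proof.
move=> hS; pose tN N (x : X) := \sum_(n < N) (x n : R[i]) *: S n.
have inner N M x y : star (tN N x) ** tN M y = ip (trunc N x) (trunc M y) *: e.
  rewrite star_sum cmul_suml /trunc.
  have -> : ip (\sum_(n < N) (x n : R[i]) *: basis_vec R n) (\sum_(n < M) (y n : R[i]) *: basis_vec R n) =
      \sum_(i < N) ip ((x i : R[i]) *: basis_vec R i) (\sum_(n < M) (y n : R[i]) *: basis_vec R n).
    exact: (@inner_suml _ _ X).
  rewrite scaler_suml; apply: eq_bigr => i _; rewrite cmul_sumr ip_sumr scaler_suml.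
  apply: eq_bigr => j _; rewrite starZ cmulZl cmulZr hS ipZl ipZr ip_basis_vec basis_vecE !scalerA.
  by case: eqP => _; rewrite ?mulr1 // mulr0 mulr0 !scaler0 scale0r.
have tN_lin N c x y : tN N (c *: x + y) = c *: tN N x + tN N y.
  rewrite /tN scaler_sumr -big_split; apply: eq_bigr => i _ /=.
  by rewrite scalerA -scalerDl.
have dist N M x : nm (tN N x - tN M x) <= nm (trunc N x - trunc M x).
  rewrite -(@ler_pXn2r _ 2) ?nnegrE ?nm_ge0 // -nm_cstar.
  have -> : star (tN N x - tN M x) ** (tN N x - tN M x) =
      ip (trunc N x - trunc M x) (trunc N x - trunc M x) *: e.
    by rewrite starB cmulBl !cmulBr !inner ipBl !ipBr !scalerBl.
  by rewrite ipxx nmZr ?sqr_ge0 // ler_piMr ?sqr_ge0 // nm_unit.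
have /choice [t ht] : forall x, exists b, tends (fun N => tN N x) b.
  move=> x; apply: cauchy_tends => r r0.
  have [N hN] := trunc_tends x (divr_gt0 r0 (ltr0n R 2)).
  exists N => n m /hN hn /hN hm; apply: le_trans (dist _ _ _) _.
  apply: le_trans (nm_tri x _ _) _; rewrite [leRHS]splitr.
  by apply: lerD; [exact: hn|rewrite nm_dist; exact: hm].
exists t; split.
- move=> c x y; apply: tends_unique (ht _) _.
  apply: tends_eq (_ : tends (fun N => c *: tN N x + tN N y) _); first by move=> N.
  apply: tendsD (ht y); apply: (@tends_lip _ B B _ (Normc.normc c) _ _ _ (ht x)) => z.
  by rewrite -scalerBr nmZ.
- move=> x y; apply: tends_unique (tendsM (tends_star (ht x)) (ht y)) _.
  apply: tends_eq (fun N => esym (inner N N x y)) _.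
  have -> : (fun N => ip (trunc N x) (trunc N y) *: e) = (fun N => ip (trunc N x) y *: e).
    apply/funext => N; congr (_ *: _); rewrite {1 3}/trunc.
    transitivity (\sum_(i < N) ip ((x i : R[i]) *: basis_vec R i) (trunc N y)).
      exact: (@inner_suml _ _ X).
    transitivity (\sum_(i < N) ip ((x i : R[i]) *: basis_vec R i) y); last first.
      by apply/esym; exact: (@inner_suml _ _ X).
    by apply: eq_bigr => i _; rewrite !ipZl !ip_basis_vec truncE ltn_ord.
  apply: (@tends_lip _ X B (fun z => ip z y *: e) (nm y) _ _ _ (trunc_tends x)) => z.
  rewrite -scalerBl -ipBl nmZ mulrC.
  apply: (@le_trans _ _ (1 * Normc.normc (ip (z - x) y))).
    by rewrite ler_wpM2r ?normc_ge0 // nm_unit.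
  by rewrite mul1r mulrC; exact: ip_le.
- move=> n; apply: tends_unique (ht _) _ => r r0; exists n.+1 => N nN.
  rewrite /tN (bigD1 (Ordinal nN)) //= big1 => [|i /eqP ni].
    by rewrite eqxx scale1r addr0 subrr nm0 ltW.
  case: eqP => [E|_]; last by rewrite scale0r.
  by case: ni; apply: val_inj.
Qed.

End CuntzIsometries.

(** * Crossed products and covariant pairs *)

Section FiniteSupport.
Variables (G : groupType) (V : zmodType).
Implicit Types (f h : G -> V).

Definition single (g : G) (v : V) : G -> V := fun k => if k == g then v else 0.

Definition supported (r : seq G) f := forall g, g \notin r -> f g = 0.

Lemma fin_suppP f : fin_supp f <-> exists2 r, uniq r & supported r f.
Proof.
split=> [/finite_seqP [r hr]|[r _ hr]].
  exists (undup r); first exact: undup_uniq.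
  move=> g; rewrite mem_undup => /negP gr; apply/eqP/negPn/negP => /eqP fg.
  by apply: gr; have : [set` r] g by rewrite -hr.
apply: (@sub_finite_set _ _ [set` r]); last by apply/finite_seqP; exists r.
move=> g /= fg; apply/negPn/negP => gr; exact/fg/hr.
Qed.

Lemma common_support W (f : G -> V) (h : G -> (W : zmodType)) : fin_supp f -> fin_supp h ->
  exists r, [/\ uniq r, supported r f & forall g, g \notin r -> h g = 0].
Proof.
move=> /fin_suppP [r _ hr] h0.
have [s _ hs] : exists2 s, uniq s & forall g, g \notin s -> h g = 0.
  have /finite_seqP [s hs] := h0; exists (undup s); first exact: undup_uniq.
  move=> g; rewrite mem_undup => /negP gr; apply/eqP/negPn/negP => /eqP fg.
  by apply: gr; have : [set` s] g by rewrite -hs.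
exists (undup (r ++ s)); split; first exact: undup_uniq.
  by move=> g; rewrite mem_undup mem_cat negb_or => /andP[/hr].
by move=> g; rewrite mem_undup mem_cat negb_or => /andP[_ /hs].
Qed.

Lemma fin_supp0 : fin_supp (fun _ : G => 0 : V).
Proof. by apply/fin_suppP; exists [::]. Qed.

Lemma fin_supp_single g v : fin_supp (single g v).
Proof.
apply/fin_suppP; exists [:: g] => // k; rewrite inE /single => kg.
by rewrite (negbTE kg).
Qed.

Lemma fin_suppD f h : fin_supp f -> fin_supp h -> fin_supp (fun g => f g + h g).
Proof.
move=> sf sh; have [r [ur rf rh]] := common_support sf sh.
by apply/fin_suppP; exists r => // g gr; rewrite rf // rh // addr0.
Qed.

(** Multiplicativity and the like follow from the case of functions supported
    at one point, by additivity. *)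
Lemma fin_supp_ind (P : (G -> V) -> Prop) : P (fun=> 0) ->
  (forall g v f, fin_supp f -> P f -> P (fun k => single g v k + f k)) ->
  forall f, fin_supp f -> P f.
Proof.
move=> P0 PS f /fin_suppP [r _]; elim: r f => [|g r IH] f hr.
  by have -> : f = (fun=> 0) by apply/funext => g; apply: hr.
pose f' k := if k == g then 0 else f k.
have -> : f = (fun k => single g (f g) k + f' k).
  by apply/funext => k; rewrite /single /f'; case: eqP => [->|_]; rewrite ?addr0 ?add0r.
have hf' : supported r f'.
  move=> k kr; rewrite /f'; case: eqVneq => // kg; apply: hr.
  by rewrite inE negb_or kg.
apply: PS; last exact: IH.
apply/fin_suppP; exists (undup r); first exact: undup_uniq.
by move=> k; rewrite mem_undup; apply: hf'.
Qed.

Lemma fsum_supported (W : zmodType) (F : G -> W) r : uniq r ->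
  (forall g, g \notin r -> F g = 0) ->
  \sum_(g \in [set: G]) F g = \sum_(g <- r) F g.
Proof.
move=> ur hr; rewrite (fsbigE r) //= => [|g _]; last exact: hr.
by apply: eq_bigl => g; rewrite in_setT.
Qed.

End FiniteSupport.

Section Convolution.
Variables (R : realType) (G : groupType) (B : cstarAlgType R) (e : B).
Variable alpha : G -> B -> B.
Hypothesis he : is_unit e.
Hypothesis halpha : is_action alpha.
Implicit Types (f h : G -> B).

Let emul x : e ** x = x. Proof. by case: he. Qed.
Let mule x : x ** e = x. Proof. by case: he. Qed.
Let hsh g : star_hom (alpha g). Proof. by case: halpha. Qed.
Let act1 b : alpha 1%g b = b. Proof. by case: halpha. Qed.
Let actM g (k : G) b : alpha (g * k)%g b = alpha g (alpha k b). Proof. by case: halpha. Qed.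

Lemma act_unit g : alpha g e = e.
Proof.
have actV x : alpha g (alpha g^-1%g x) = x by rewrite -actM mulgV act1.
rewrite -[LHS]mule -{2}[e]actV -star_homM // emul actV //.
Qed.

Lemma convolutionE f h g r : uniq r -> supported r f ->
  convolution alpha f h g = \sum_(k <- r) f k ** alpha k (h (k^-1 * g)%g).
Proof.
move=> ur rf; rewrite /convolution; apply: fsum_supported => // k kr.
by rewrite rf // cmul0l.
Qed.

Lemma convolution_single g a h k :
  convolution alpha (single g a) h k = a ** alpha g (h (g^-1 * k)%g).
Proof.
rewrite (@convolutionE _ _ _ [:: g]) ?big_seq1 /single ?eqxx // => l.
by rewrite inE => /negbTE ->.
Qed.

Lemma convolution_singles g a k b :
  convolution alpha (single g a) (single k b) = single (g * k)%g (a ** alpha g b).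
Proof.
apply/funext => l; rewrite convolution_single /single.
have -> : ((g^-1 * l)%g == k) = (l == (g * k)%g).
  by apply/eqP/eqP => [<-|->]; rewrite mulgA ?mulgV ?mulVg mul1g.
by case: ifP => // _; rewrite star_hom0 // cmul0r.
Qed.

Lemma convolutionDl f f' h : fin_supp f -> fin_supp f' ->
  convolution alpha (fun g => f g + f' g) h =
  (fun g => convolution alpha f h g + convolution alpha f' h g).
Proof.
move=> sf sf'; have [r [ur rf rf']] := common_support sf sf'.
apply/funext => g; rewrite !(@convolutionE _ _ _ r) // => [|k kr]; last first.
  by rewrite rf // rf' // addr0.
by rewrite -big_split; apply: eq_bigr => k _; rewrite cmulDl.
Qed.

Lemma convolutionDr f h h' : fin_supp f ->
  convolution alpha f (fun g => h g + h' g) =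
  (fun g => convolution alpha f h g + convolution alpha f h' g).
Proof.
move=> /fin_suppP [r ur rf]; apply/funext => g; rewrite !(@convolutionE _ _ _ r) //.
by rewrite -big_split; apply: eq_bigr => k _; rewrite star_homD // cmulDr.
Qed.

Lemma convolution0l h : convolution alpha (fun=> 0) h = (fun=> 0).
Proof. by apply/funext => g; rewrite (@convolutionE _ _ _ [::]) ?big_nil. Qed.

Lemma convolution0r f : fin_supp f -> convolution alpha f (fun=> 0) = (fun=> 0).
Proof.
move=> /fin_suppP [r ur rf]; apply/funext => g; rewrite (@convolutionE _ _ _ r) //.
by rewrite big1 // => k _; rewrite star_hom0 // cmul0r.
Qed.

Lemma fin_supp_convolution f h : fin_supp f -> fin_supp h ->
  fin_supp (convolution alpha f h).
Proof.
move=> sf sh; elim/fin_supp_ind: f / sf => [|g a f sf IH].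
  by rewrite convolution0l; exact: fin_supp0.
rewrite convolutionDl //; last exact: fin_supp_single.
apply: fin_suppD IH; elim/fin_supp_ind: h / sh => [|k b h sh IH].
  by rewrite convolution0r; [exact: fin_supp0|exact: fin_supp_single].
rewrite convolutionDr; last exact: fin_supp_single.
by apply: fin_suppD IH; rewrite convolution_singles; exact: fin_supp_single.
Qed.

Lemma involution_single g a : involution alpha (single g a) = single g^-1%g (alpha g^-1%g (star a)).
Proof.
apply/funext => k; rewrite /involution /single.
have -> : (k^-1%g == g) = (k == g^-1%g) by apply/eqP/eqP => [<-|->]; rewrite invgK.
by case: eqP => [->//|_]; rewrite star0 star_hom0.
Qed.

Lemma involutionD f h : involution alpha (fun g => f g + h g) =
  (fun g => involution alpha f g + involution alpha h g).
Proof. by apply/funext => g; rewrite /involution starD star_homD. Qed.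

Section CovariantPair.
Variables (D : cstarAlgType R) (pi : B -> D) (V : G -> D).
Hypothesis hpi : star_hom pi.
Hypothesis VM : forall g (h : G), V (g * h)%g = V g ** V h.
Hypothesis VS : forall g, star (V g) = V g^-1%g.
Hypothesis Vpi : forall g b, V g ** pi b = pi (alpha g b) ** V g.

Definition integrated_form f : D := \sum_(g \in [set: G]) pi (f g) ** V g.

Lemma integrated_formE f r : uniq r -> supported r f ->
  integrated_form f = \sum_(g <- r) pi (f g) ** V g.
Proof.
move=> ur rf; apply: fsum_supported => // g gr.
by rewrite rf // star_hom0 // cmul0l.
Qed.

Lemma integrated_form_single g b : integrated_form (single g b) = pi b ** V g.
Proof.
rewrite (@integrated_formE _ [:: g]) ?big_seq1 /single ?eqxx // => k.
by rewrite inE => /negbTE ->.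
Qed.

Lemma integrated_formP (c : R[i]) f h : fin_supp f -> fin_supp h ->
  integrated_form (fun g => c *: f g + h g) = c *: integrated_form f + integrated_form h.
Proof.
move=> sf sh; have [r [ur rf rh]] := common_support sf sh.
rewrite !(@integrated_formE _ r) // => [|k kr]; last first.
  by rewrite rf // rh // addr0 scaler0.
rewrite scaler_sumr -big_split; apply: eq_bigr => g _ /=.
by rewrite star_homD // star_homZ // cmulDl cmulZl.
Qed.

Lemma integrated_formD f h : fin_supp f -> fin_supp h ->
  integrated_form (fun g => f g + h g) = integrated_form f + integrated_form h.
Proof.
move=> sf sh; have := integrated_formP 1 sf sh; rewrite scale1r => <-.
by congr integrated_form; apply/funext => g; rewrite scale1r.
Qed.

Lemma integrated_form0 : integrated_form (fun=> 0) = 0.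
Proof. by rewrite (@integrated_formE _ [::]) ?big_nil. Qed.

Lemma integrated_form_hom : Cc_star_hom alpha integrated_form.
Proof.
split=> [c f h sf sh|f h sf sh|f sf]; first exact: integrated_formP.
- elim/fin_supp_ind: f / sf => [|g a f sf IH].
    by rewrite convolution0l integrated_form0 cmul0l.
  have ss := @fin_supp_single G B g a.
  rewrite convolutionDl // !integrated_formD //; try exact: fin_supp_convolution.
  rewrite IH cmulDl; congr (_ + _).
  elim/fin_supp_ind: h / sh {IH} => [|k b h sh IH].
    by rewrite convolution0r // integrated_form0 cmul0r.
  have sk := @fin_supp_single G B k b.
  rewrite convolutionDr // !integrated_formD //; try exact: fin_supp_convolution.
  rewrite IH cmulDr; congr (_ + _); rewrite convolution_singles !integrated_form_single.
  by rewrite star_homM // VM -!cmulA [V g ** (_ ** _)]cmulA Vpi !cmulA.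
- elim/fin_supp_ind: f / sf => [|g a f sf IH].
    rewrite integrated_form0 star0 -integrated_form0; congr integrated_form.
    by apply/funext => g; rewrite /involution star0 star_hom0.
  have ss := @fin_supp_single G B g a.
  have sinv f0 : fin_supp f0 -> fin_supp (involution alpha f0).
    elim/fin_supp_ind => [|k b f1 s1 I1].
      rewrite (_ : involution _ _ = fun=> 0); first exact: fin_supp0.
      by apply/funext => k; rewrite /involution star0 star_hom0.
    rewrite involutionD; apply: fin_suppD I1; rewrite involution_single.
    exact: fin_supp_single.
  rewrite involutionD !integrated_formD //; try exact: sinv.
  rewrite IH starD; congr (_ + _); rewrite involution_single !integrated_form_single.
  by rewrite starM VS -star_homS // -Vpi.
Qed.

End CovariantPair.

Section CrossedProductAlgebra.
Variables (C : cstarAlgType R) (j : (G -> B) -> C).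
Hypothesis hC : is_full_crossed_product alpha j.

Let jP (c : R[i]) f h : fin_supp f -> fin_supp h ->
  j (fun g => c *: f g + h g) = c *: j f + j h.
Proof. by case: hC => -[h0 _ _] _ _; apply: h0. Qed.
Let jM f h : fin_supp f -> fin_supp h -> j (convolution alpha f h) = j f ** j h.
Proof. by case: hC => -[_ h0 _] _ _; apply: h0. Qed.
Let jS f : fin_supp f -> j (involution alpha f) = star (j f).
Proof. by case: hC => -[_ _ h0] _ _; apply: h0. Qed.

Let jD f h : fin_supp f -> fin_supp h -> j (fun g => f g + h g) = j f + j h.
Proof.
move=> sf sh; have := jP 1 sf sh; rewrite scale1r => <-.
by congr j; apply/funext => g; rewrite scale1r.
Qed.

Let j0 : j (fun=> 0) = 0.
Proof.
apply: (addIr (j (fun=> 0))); rewrite add0r -jD; try exact: fin_supp0.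
by congr j; apply/funext => g; rewrite addr0.
Qed.

Definition cp_unitary g : C := j (single g e).
Definition cp_emb b : C := j (single 1%g b).

Lemma cp_single g b : j (single g b) = cp_emb b ** cp_unitary g.
Proof.
rewrite -jM; try exact: fin_supp_single.
by rewrite convolution_singles mul1g act1 mule.
Qed.

Lemma cp_emb_hom : star_hom cp_emb.
Proof.
split=> [c a b|a b|a].
- rewrite /cp_emb -jP; try exact: fin_supp_single.
  congr j; apply/funext => g; rewrite /single; case: eqP => // _.
  by rewrite scaler0 addr0.
- rewrite /cp_emb -jM; try exact: fin_supp_single.
  by rewrite convolution_singles mul1g act1.
- rewrite /cp_emb -jS; last exact: fin_supp_single.
  by rewrite involution_single invg1 act1.
Qed.

Lemma cp_unitaryM g (h : G) : cp_unitary (g * h)%g = cp_unitary g ** cp_unitary h.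
Proof.
rewrite /cp_unitary -jM; try exact: fin_supp_single.
by rewrite convolution_singles act_unit mule.
Qed.

Lemma cp_unitaryS g : star (cp_unitary g) = cp_unitary g^-1%g.
Proof.
rewrite /cp_unitary -jS; last exact: fin_supp_single.
by rewrite involution_single (selfadj_unit he) act_unit.
Qed.

Lemma cp_covariant g b : cp_unitary g ** cp_emb b = cp_emb (alpha g b) ** cp_unitary g.
Proof.
rewrite -cp_single /cp_unitary /cp_emb -jM; try exact: fin_supp_single.
by rewrite convolution_singles mulg1 emul.
Qed.

Lemma cp_sum f r : uniq r -> supported r f -> j f = \sum_(g <- r) cp_emb (f g) ** cp_unitary g.
Proof.
elim: r f => [|g r IH] f /= ur rf.
  by rewrite big_nil -j0; congr j; apply/funext => g; apply: rf.
move: ur => /andP[gr ur]; pose f' k := if k == g then 0 else f k.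
have hf' : supported r f'.
  move=> k kr; rewrite /f'; case: eqVneq => // kg; apply: rf.
  by rewrite inE negb_or kg.
have E : f = (fun k => single g (f g) k + f' k).
  by apply/funext => k; rewrite /single /f'; case: eqP => [->|_]; rewrite ?addr0 ?add0r.
rewrite [in LHS]E jD; [|exact: fin_supp_single|by apply/fin_suppP; exists r].
rewrite cp_single IH // big_cons; congr (_ + _).
rewrite big_seq [RHS]big_seq; apply: eq_bigr => k kr; congr (cp_emb _ ** _).
by rewrite /f'; case: eqP => // kg; move: gr; rewrite -kg kr.
Qed.

Lemma cp_ind (P : C -> Prop) : closed [set x | P x] -> P 0 ->
  (forall x y, P x -> P y -> P (x + y)) ->
  (forall b g, P (cp_emb b ** cp_unitary g)) -> forall x, P x.
Proof.
move=> cP P0 PD Pg x.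
have [_ dense _] := hC.
have : closure (j @` @fin_supp G B) x by rewrite dense.
suff sub : j @` @fin_supp G B `<=` [set x | P x].
  by move=> /(closure_subset sub); move/closure_id: cP => <-.
move=> _ [f /fin_suppP [r ur rf] <-] /=; rewrite (cp_sum ur rf).
by elim/big_ind: _.
Qed.

Lemma cp_unit : is_unit (cp_unitary 1%g).
Proof.
have L x : cp_unitary 1%g ** x = x.
  elim/cp_ind: x => [||x y hx hy|b g].
  - apply/closedP => x h /=; apply/eqP; rewrite -subr_eq0; apply/eqP/nm_le0.
    have k0 : 0 < nm (cp_unitary 1%g) + 1 by rewrite ltr_wpDl ?nm_ge0.
    apply/ler_addgt0Pr => r r0; rewrite add0r.
    have [y /= Py yx] := h _ (divr_gt0 r0 k0).
    have -> : cp_unitary 1%g ** x - x = (y - x) - cp_unitary 1%g ** (y - x).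
      by rewrite cmulBr Py opprB [RHS]addrC addrA subrK.
    apply: le_trans (nmB _ _) _.
    apply: (@le_trans _ _ (nm (y - x) * (nm (cp_unitary 1%g) + 1))).
      by rewrite mulrDr mulr1 addrC lerD2r mulrC nmM.
    by rewrite -ler_pdivlMr.
  - by rewrite cmul0r.
  - by rewrite cmulDr hx hy.
  - by rewrite cmulA cp_covariant act1 -cmulA -cp_unitaryM mul1g.
split=> // x; rewrite -[x]starK -{1}(starK (cp_unitary 1%g)) -starM cp_unitaryS invg1.
by rewrite L.
Qed.


(** The universal property is stated for homomorphisms of the convolution
    algebra; in use they come from covariant pairs (pi, V). *)
Lemma cp_universal (D : cstarAlgType R) (pi : B -> D) (V : G -> D) :
  star_hom pi -> (forall g (h : G), V (g * h)%g = V g ** V h) ->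
  (forall g, star (V g) = V g^-1%g) ->
  (forall g b, V g ** pi b = pi (alpha g b) ** V g) ->
  exists P : C -> D, star_hom P /\ forall b g, P (cp_emb b ** cp_unitary g) = pi b ** V g.
Proof.
move=> hpi VM VS Vpi; have [_ _ univ] := hC.
have [P [hP PE]] := univ D _ (integrated_form_hom hpi VM VS Vpi).
exists P; split=> // b g; rewrite -cp_single PE; last exact: fin_supp_single.
exact: integrated_form_single.
Qed.

End CrossedProductAlgebra.

End Convolution.

(** * The index action and Fock space *)

(** An equivariant map gpr onto G, where G acts by left translation, expresses
    freeness of the action away from 0. *)
Record index_action (G : groupType) := IndexAction {
  iact :> G -> nat -> nat;
  gpr : nat -> G;
  iact1 : forall n, iact 1%g n = n;
  iactM : forall g h n, iact (g * h)%g n = iact g (iact h n);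
  iact0 : forall g, iact g 0%N = 0%N;
  iact_neq0 : forall g n, n != 0%N -> iact g n != 0%N;
  gpr_iact : forall g n, n != 0%N -> gpr (iact g n) = (g * gpr n)%g;
  gpr_onto : forall g, exists2 n, n != 0%N & gpr n = g
}.

(** N is in bijection with a point and G x N.  The factor N makes the free part
    infinite even if G is finite. *)
Lemma index_action_exists (G : groupType) : countable [set: G] -> inhabited (index_action G).
Proof.
move=> cG.
have cGN : countable [set: G * nat].
  by rewrite -setXTT; apply: countableX => //; exact: countableP.
have bij : ([set: G * nat] #= [set: nat])%card.
  rewrite card_eq_le; apply/andP; split; first exact: cGN.
  have : (range (fun n : nat => (1%g : G, n)) #= [set: nat])%card.
    by apply: inj_card_eq => n m _ _ /= [].
  rewrite card_eq_le => /andP[_ h]; apply: card_le_trans h _.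
  exact: subset_card_le.
have /card_set_bijP [f [_ finj fsurj]] := bij.
have /choice [d hd] : forall n, exists x, f x = n.
  by move=> n; have [x _ <-] := fsurj n I; exists x.
have fK x : d (f x) = x by apply: finj; rewrite ?in_setT ?hd.
pose act g n := if n is n'.+1 then (f ((g * (d n').1)%g, (d n').2)).+1 else 0%N.
constructor; apply: (@IndexAction G act (fun n => (d n.-1).1)).
- by case=> //= n; rewrite mul1g -surjective_pairing hd.
- by move=> g h [//|n] /=; rewrite fK mulgA.
- by [].
- by move=> g [].
- by move=> g [//|n] _ /=; rewrite fK.
- by move=> g; exists (f (g, 0%N)).+1 => //=; rewrite fK.
Qed.

Section Fock.
Variables (R : realType) (G : groupType) (sg : index_action G).
Implicit Types (g h : G) (w : seq nat).

Local Notation code := CodeSeq.code.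
Local Notation decode := CodeSeq.decode.

Lemma iactK g : cancel (sg g) (sg g^-1%g).
Proof. by move=> n; rewrite -iactM mulVg iact1. Qed.

Lemma iactVK g : cancel (sg g^-1%g) (sg g).
Proof. by move=> n; rewrite -iactM mulgV iact1. Qed.

Lemma iact_eq0 g n : (sg g n == 0%N) = (n == 0%N).
Proof.
have [->|n0] := eqVneq n 0%N; first by rewrite iact0.
by apply/negbTE; exact: iact_neq0.
Qed.

Lemma iact_pinjP g n m : Some (sg g n) = Some m <-> Some (sg g^-1%g m) = Some n.
Proof. by split=> -[<-]; rewrite ?iactK ?iactVK. Qed.

Definition index_unitary g : bop R := pinj_op R (PInj (iact_pinjP g)).

Lemma index_unitary_basis g n : index_unitary g (basis_vec R n) = basis_vec R (sg g n).
Proof. exact: pinj_op_basis. Qed.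

Lemma index_unitary1 x : index_unitary 1%g x = x.
Proof.
suff -> : index_unitary 1%g = bop1 R by rewrite bop1E.
by apply: bop_basis_ext => n; rewrite index_unitary_basis bop1E iact1.
Qed.

Lemma index_unitaryM g h : index_unitary (g * h)%g = index_unitary g ** index_unitary h.
Proof. by apply: bop_basis_ext => n; rewrite bopM !index_unitary_basis iactM. Qed.

Lemma star_index_unitary g : star (index_unitary g) = index_unitary g^-1%g.
Proof.
rewrite /index_unitary star_pinj_op; apply: bop_basis_ext => n.
by rewrite !pinj_op_basis.
Qed.

Lemma index_unitary_ip g x y : ip (index_unitary g x) (index_unitary g y) = ip x y.
Proof.
rewrite -[LHS]ip_star -[bop_star _ _]/((star (index_unitary g) ** index_unitary g) y) star_index_unitary -index_unitaryM mulVg.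
by rewrite index_unitary1.
Qed.

(** The full Fock space of l^2(N) has the words on N as basis; coding words by
    natural numbers identifies it with l^2(N) itself. *)
Definition word_vec w : ell2 R := basis_vec R (code w).

Lemma word_basis_ext (f f' : bop R) : (forall w, f (word_vec w) = f' (word_vec w)) -> f = f'.
Proof.
by move=> h; apply: bop_basis_ext => n; have := h (decode n); rewrite /word_vec CodeSeq.decodeK.
Qed.

Lemma fock_unitary_pinjP g n m :
  Some (code (map (sg g) (decode n))) = Some m <-> Some (code (map (sg g^-1%g) (decode m))) = Some n.
Proof.
by split=> -[<-]; rewrite CodeSeq.codeK -map_comp map_id_in ?CodeSeq.decodeK // => k _ /=;
  rewrite ?iactK ?iactVK.
Qed.

(** The second quantization of index_unitary. *)
Definition fock_unitary g : bop R := pinj_op R (PInj (fock_unitary_pinjP g)).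

Lemma fock_unitary_word_vec g w : fock_unitary g (word_vec w) = word_vec (map (sg g) w).
Proof. by rewrite pinj_op_basis /= CodeSeq.codeK. Qed.

Lemma fock_unitaryM g h : fock_unitary (g * h)%g = fock_unitary g ** fock_unitary h.
Proof.
apply: word_basis_ext => w; rewrite bopM !fock_unitary_word_vec -map_comp; congr word_vec.
by apply: eq_map => n; rewrite iactM.
Qed.

Lemma fock_unitary1 : fock_unitary 1%g = bop1 R.
Proof.
apply: word_basis_ext => w; rewrite fock_unitary_word_vec bop1E map_id_in // => n _.
by rewrite iact1.
Qed.

Lemma star_fock_unitary g : star (fock_unitary g) = fock_unitary g^-1%g.
Proof.
rewrite /fock_unitary star_pinj_op; apply: word_basis_ext => w.
by rewrite !pinj_op_basis.
Qed.

Lemma fock_unitary_ip g x y : ip (fock_unitary g x) (fock_unitary g y) = ip x y.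
Proof.
rewrite -[LHS]ip_star -[bop_star _ _]/((star (fock_unitary g) ** fock_unitary g) y) star_fock_unitary -fock_unitaryM mulVg.
by rewrite fock_unitary1 bop1E.
Qed.

Lemma nm_fock_unitary g x : nm (fock_unitary g x) = nm x.
Proof.
apply/eqP; rewrite -(@eqrXn2 _ 2) ?nm_ge0 //; apply/eqP.
by apply: complexI; rewrite -!ipxx fock_unitary_ip.
Qed.

Lemma creation_pinjP k n m : Some (code (k :: decode n)) = Some m <->
  (if decode m is l :: w then if l == k then Some (code w) else None else None) = Some n.
Proof.
split=> [/Some_inj <-|]; first by rewrite CodeSeq.codeK eqxx CodeSeq.decodeK.
case E: (decode m) => [//|l w]; case: eqP E => // -> E /Some_inj <-.
by rewrite CodeSeq.codeK -[m in RHS]CodeSeq.decodeK E.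
Qed.

Definition creation k : bop R := pinj_op R (PInj (creation_pinjP k)).

Lemma creation_word_vec k w : creation k (word_vec w) = word_vec (k :: w).
Proof. by rewrite pinj_op_basis /= CodeSeq.codeK. Qed.

Lemma star_creation_word_vec k w : star (creation k) (word_vec w) =
  if w is l :: w' then if l == k then word_vec w' else 0 else 0.
Proof.
rewrite star_pinj_op pinj_op_basis /= CodeSeq.codeK; case: w => [//|l w].
by case: eqP.
Qed.

Lemma creation_cuntz i j : star (creation i) ** creation j = if i == j then bop1 R else 0.
Proof.
apply: word_basis_ext => w; rewrite bopM creation_word_vec star_creation_word_vec eq_sym.
by case: eqP; rewrite ?bop1E.
Qed.

Lemma fock_unitary_creation g k : fock_unitary g ** creation k = creation (sg g k) ** fock_unitary g.
Proof. by apply: word_basis_ext => w; rewrite !bopM creation_word_vec !fock_unitary_word_vec creation_word_vec. Qed.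

Definition is_free_letter n := if decode n is [:: k] then k != 0%N else false.

(** The space of one-letter words is l^2(N); the letter 0, on which G acts
    trivially, is left out, so that G acts on the range of this projection by
    copies of its regular representation. *)
Definition letters : bop R := pproj R is_free_letter.
Definition vacuum : bop R := pproj R (fun n => n == code [::]).

Lemma letters_word_vec w : letters (word_vec w) = if w is [:: k] then (if k != 0%N then word_vec w else 0) else 0.
Proof.
rewrite pproj_basis /is_free_letter CodeSeq.codeK.
by case: w => [//|k [|l w]].
Qed.

Lemma vacuum_word_vec w : vacuum (word_vec w) = if w is [::] then word_vec [::] else 0.
Proof.
rewrite pproj_basis (can_eq CodeSeq.codeK).
by case: w.
Qed.

Lemma fock_unitary_letters g : fock_unitary g ** letters = letters ** fock_unitary g.
Proof.
apply: word_basis_ext => w; rewrite !bopM fock_unitary_word_vec !letters_word_vec.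
case: w => [|k [|l w]]; [exact: bop_0| |exact: bop_0].
rewrite -[RHS]/(if sg g k != 0%N then word_vec [:: sg g k] else 0) iact_eq0.
by case: eqP => _; [exact: bop_0|exact: fock_unitary_word_vec].
Qed.

Lemma fock_unitary_vacuum g : fock_unitary g ** vacuum = vacuum ** fock_unitary g.
Proof.
apply: word_basis_ext => w; rewrite !bopM fock_unitary_word_vec !vacuum_word_vec.
by case: w => [|k w]; [exact: fock_unitary_word_vec|exact: bop_0].
Qed.

Definition lift_fun (f : G -> R) n : R :=
  if decode n is [:: k] then if k != 0%N then f (gpr sg k) else 0 else 0.

End Fock.

(** * Invariant means from almost invariant vectors *)

Section UltraLimit.
Variables (R : realType) (U : set_system nat).
Hypotheses (ultraU : UltraFilter U) (Uoo : \oo `<=` U).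

(** A cluster point in the compact interval is a limit, since an ultrafilter
    cannot contain the complement of the preimage of a neighbourhood. *)
Lemma ultra_cvg (a : nat -> R) (M : R) : (forall n, `|a n| <= M) -> cvg (a @ U).
Proof.
move=> aM.
have FU : ProperFilter U by exact: ultra_proper.
have [|l [_ cl]] := @segment_compact R (- M) M (a @ U) _.
  apply: (@filterS _ U _ setT); last exact: filterT.
  by move=> n _ /=; rewrite in_itv /= -ler_norml.
apply/cvg_ex; exists l => N Nl.
have [//|UN] := in_ultra_setVsetC (a @^-1` N) ultraU.
by have [y []] := cl (~` N) N UN Nl.
Qed.

Lemma ultra_tends (a : nat -> R) (l : R) : a @ \oo --> l -> lim (a @ U) = l.
Proof.
move=> al; have FU : ProperFilter U by exact: ultra_proper.
apply/cvg_lim => // N Nl; apply: Uoo; exact: al.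
Qed.

End UltraLimit.

Section Mean.
Variables (R : realType) (G : groupType) (sg : index_action G).
Local Notation lf := (lift_fun sg).
Local Notation code := CodeSeq.code.
Local Notation decode := CodeSeq.decode.
Local Notation H := (ell2 R).

(** The vector functional <x, f x>, where f acts by multiplication on one-letter
    words; written as a series, it makes sense for every f. *)
Definition letter_state (x : H) (f : G -> R) : R :=
  limn (series (fun n => lf f n * Normc.normc (x n) ^+ 2)).

Lemma lift_fun_le (f : G -> R) M : 0 <= M -> (forall g, `|f g| <= M) -> forall n, `|lf f n| <= M.
Proof.
move=> M0 fM n; rewrite /lift_fun.
by case: (decode n) => [|k [|l w]]; rewrite ?normr0 //; case: ifP; rewrite ?normr0.
Qed.

Section Bounded.
Variables (f : G -> R) (M : R).
Hypotheses (M0 : 0 <= M) (fM : forall g, `|f g| <= M).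
Let D := diag (lift_fun_le M0 fM).

Lemma letter_stateE x : letter_state x f = complex.Re (ip x (D x)).
Proof. by rewrite diag_ip. Qed.

Lemma letter_state_le x : `|letter_state x f| <= M * nm x ^+ 2.
Proof.
rewrite letter_stateE; apply: le_trans (Re_le_normc _) _; apply: le_trans (ip_le _ _) _.
rewrite expr2 mulrCA ler_wpM2l ?nm_ge0 //; exact: diag_le.
Qed.

Lemma letter_state_ge0 x : (forall g, 0 <= f g) -> 0 <= letter_state x f.
Proof.
move=> f0; rewrite letter_stateE; apply: diag_ge0 => n; rewrite /lift_fun.
by case: (decode n) => [|k [|l w]] //; case: ifP.
Qed.

Lemma letter_state_dist x y : `|letter_state y f - letter_state x f| <= M * (nm y + nm x) * nm (y - x).
Proof.
rewrite !letter_stateE -raddfB.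
have -> : ip y (D y) - ip x (D x) = ip y (D (y - x)) + ip (y - x) (D x).
  by rewrite bop_subr ipBr ipBl addrA subrK.
apply: le_trans (Re_le_normc _) _; apply: le_trans (Defs.normcD _ _) _.
have -> : M * (nm y + nm x) * nm (y - x) = nm y * (M * nm (y - x)) + nm (y - x) * (M * nm x).
  by ring.
apply: lerD; apply: le_trans (ip_le _ _) _; rewrite ler_wpM2l ?nm_ge0 //; exact: diag_le.
Qed.

End Bounded.

Lemma letter_state_linear (c : R) (f h : G -> R) (M N : R) x : 0 <= M -> 0 <= N ->
  (forall g, `|f g| <= M) -> (forall g, `|h g| <= N) ->
  letter_state x (fun g => c * f g + h g) = c * letter_state x f + letter_state x h.
Proof.
move=> M0 N0 fM hN.
have cM g : `|c * f g + h g| <= `|c| * M + N.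
  by apply: le_trans (ler_normD _ _) _; rewrite normrM lerD // ler_wpM2l.
have K0 : 0 <= `|c| * M + N by rewrite addr_ge0 ?mulr_ge0.
rewrite (letter_stateE K0 cM) (letter_stateE M0 fM) (letter_stateE N0 hN).
have -> : diag (lift_fun_le K0 cM) x =
    c%:C%C *: diag (lift_fun_le M0 fM) x + diag (lift_fun_le N0 hN) x.
  apply: ell2_ext => n.
  rewrite -[RHS]/(c%:C%C * ((lf f n)%:C%C * (x n : R[i])) + (lf h n)%:C%C * (x n : R[i])).
  rewrite diagE mulrA -mulrDl -rmorphM -rmorphD; congr (_%:C%C * _).
  rewrite /lift_fun; case: (decode n) => [|k [|l w]]; rewrite ?mulr0 ?addr0 //.
  by case: ifP; rewrite ?mulr0 ?addr0.
rewrite ipDr ipZr raddfD; congr (_ + _).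
by case: (ip _ _) => u v /=; rewrite mul0r subr0.
Qed.

(** Translating f amounts to conjugating the multiplication operator by the
    unitary of k. *)
Lemma letter_state_translate (f : G -> R) (M : R) k x : 0 <= M -> (forall g, `|f g| <= M) ->
  letter_state x (fun g => f (k * g)%g) = letter_state (fock_unitary R sg k x) f.
Proof.
move=> M0 fM; have fkM g : `|f (k * g)%g| <= M by exact: fM.
rewrite (letter_stateE M0 fkM) (letter_stateE M0 fM); congr complex.Re.
rewrite -(fock_unitary_ip sg k); congr (ip _ _); apply: ell2_ext => n.
rewrite [RHS]diagE [LHS]pinj_opE [in RHS]pinj_opE.
set m := code (map (sg k^-1%g) (decode n)).
rewrite -[LHS]/((lf (fun g => f (k * g)%g) m)%:C%C * (x m : R[i])) -[RHS]/((lf f n)%:C%C * (x m : R[i])).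
congr (_%:C%C * _); rewrite /lift_fun /m CodeSeq.codeK.
case: (decode n) => [|l [|l' w]] //=; rewrite iact_eq0; case: ifP => // l0.
by rewrite gpr_iact // mulgA mulgV mul1g.
Qed.

Lemma letter_state_one x : letters R x = x -> letter_state x (fun=> 1) = nm x ^+ 2.
Proof.
move=> lx; have h1 (g : G) : `|(1 : R)| <= 1 by rewrite normr1.
rewrite (letter_stateE ler01 h1) -[RHS]/(complex.Re ((nm x ^+ 2)%:C%C)) -ipxx; congr (complex.Re (ip _ _)).
rewrite -[RHS]lx; apply: ell2_ext => n; rewrite diagE pprojE /lift_fun /is_free_letter.
case: (decode n) => [|l [|l' w]]; rewrite ?mul0r //.
by case: ifP; rewrite ?mul0r // mul1r.
Qed.

(** The mean is a limit of vector states along an ultrafilter. *)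
Lemma amenable_of_almost_invariant (xi : nat -> H) :
  (forall n, letters R (xi n) = xi n) -> (forall n, nm (xi n) <= 1) ->
  (fun n => nm (xi n) ^+ 2) @ \oo --> (1 : R) ->
  (forall k, (fun n => nm (fock_unitary R sg k (xi n) - xi n)) @ \oo --> (0 : R)) ->
  amenable R G.
Proof.
move=> lxi xi1 xilim inv.
have [U [ultraU Uoo]] := @ultraFilterLemma nat \oo _.
have FU : ProperFilter U by exact: ultra_proper.
pose bounded (f : G -> R) := exists M : R, forall g, `|f g| <= M.
have bnd f : bounded f -> exists2 M, 0 <= M & forall g, `|f g| <= M.
  by move=> [M hM]; exists M => //; exact: le_trans (normr_ge0 _) (hM 1%g).
have phi_bnd f : bounded f -> cvg ((fun n => letter_state (xi n) f) @ U).
  move=> /bnd [M M0 hM]; apply: (@ultra_cvg _ _ ultraU _ M) => n.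
  apply: le_trans (letter_state_le M0 hM _) _; rewrite ler_piMr //.
  by rewrite expr_le1 ?nm_ge0.
exists (fun f => lim ((fun n => letter_state (xi n) f) @ U)); split.
- move=> c f h bf bh; have [M M0 fM] := bnd f bf; have [N N0 hN] := bnd h bh.
  have -> : (fun n => letter_state (xi n) (fun g => c * f g + h g)) =
      (fun n => c * letter_state (xi n) f + letter_state (xi n) h).
    by apply/funext => n; exact: (letter_state_linear _ _ M0 N0).
  apply/cvg_lim => //; apply: cvgD; last exact: phi_bnd.
  by apply: cvgM; [exact: cvg_cst|exact: phi_bnd].
- move=> f bf f0; have [M M0 fM] := bnd f bf.
  apply: limr_ge; first exact: phi_bnd.
  by apply: nearW => n; exact: (letter_state_ge0 M0 fM).
- apply: (ultra_tends ultraU Uoo).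
  by under eq_fun do rewrite letter_state_one //.
- move=> f k bf; have [M M0 fM] := bnd f bf.
  have bfk : bounded (fun g => f (k * g)%g) by exists M => g; exact: fM.
  apply/eqP; rewrite -subr_eq0; apply/eqP.
  rewrite -limB; [|exact: phi_bnd|exact: phi_bnd].
  apply: (ultra_tends ultraU Uoo).
  apply: (@squeeze_cvgr _ _ _ _ (fun n => - (M * 2 * nm (fock_unitary R sg k (xi n) - xi n)))
    (fun n => M * 2 * nm (fock_unitary R sg k (xi n) - xi n))).
  + apply: nearW => n; rewrite -ler_norml.
    rewrite -[X in `|X|]/(letter_state (xi n) (fun g => f (k * g)%g) - letter_state (xi n) f).
    rewrite (letter_state_translate k (xi n) M0 fM); apply: le_trans (letter_state_dist M0 fM _ _) _.
    rewrite ler_wpM2r ?nm_ge0 // ler_wpM2l //.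
    by rewrite nm_fock_unitary; have := xi1 n; lra.
  + rewrite -oppr0 -(mulr0 (M * 2)); apply: cvgN; apply: cvgM; last exact: inv.
    exact: cvg_cst.
  + by rewrite -(mulr0 (M * 2)); apply: cvgM; [exact: cvg_cst|exact: inv].
Qed.

Lemma parallelogram (x y : H) :
  nm (y - x) ^+ 2 + nm (x + y) ^+ 2 = nm x ^+ 2 + nm x ^+ 2 + (nm y ^+ 2 + nm y ^+ 2).
Proof.
apply: complexI; rewrite !rmorphD /= -!ipxx !(ipBr, ipBl, ipDr, ipDl); ring.
Qed.

(** If the convolution operators sum of (1 + fock_unitary s) attain their largest
    conceivable norm on one-letter words, then a vector on which one of them
    nearly does so is almost invariant under each s. *)
Lemma amenable_of_norm :
  (forall S : seq G, 2 * (size S)%:R <=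
     nm ((\sum_(s <- S) (bop1 R + fock_unitary R sg s)) ** letters R)) ->
  amenable R G.
Proof.
move=> hS.
have [enum enumP] : exists enum : nat -> G, forall g, exists n, enum n = g.
  exists (fun n => gpr sg n.+1) => g; have [[//|n] _ ng] := gpr_onto sg g.
  by exists n.
pose S n := [seq enum i | i <- iota 0 n.+1].
pose T n : bop R := (\sum_(s <- S n) (bop1 R + fock_unitary R sg s)) ** letters R.
pose r n : R := n.+1%:R^-1.
have r0 n : 0 < r n by rewrite invr_gt0.
have ex n : exists x : H, nm x <= 1 /\ 2 * (size (S n))%:R - r n <= nm (T n x).
  have [_ [x x1 <-] hx] := sup_adherent (r0 n) (opnorm_has_sup (T n)).
  exists x; split=> //; apply: le_trans (ltW hx); rewrite lerD2r.
  exact: (hS (S n)).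
have /choice [y hy] := ex.
pose xi n := letters R (y n).
have lxi n : letters R (xi n) = xi n by rewrite /xi -bopM pproj_idem.
have xi1 n : nm (xi n) <= 1 by apply: le_trans (pinj_op_le _ _) _; exact: (hy n).1.
have TE n : T n (y n) = \sum_(s <- S n) (xi n + fock_unitary R sg s (xi n)).
  rewrite /T bopM -/(xi n); elim: (S n) => [|s l IH]; first by rewrite !big_nil.
  by rewrite !big_cons bopD IH bopD bop1E.
have large n s : s \in S n -> 2 - r n <= nm (xi n + fock_unitary R sg s (xi n)).
  move=> sS.
  have le2 s' : nm (xi n + fock_unitary R sg s' (xi n)) <= 2.
    by apply: le_trans (nmD _ _) _; rewrite nm_fock_unitary; have := xi1 n; lra.
  have := (hy n).2; rewrite TE (perm_big _ (perm_to_rem sS)) big_cons (perm_size (perm_to_rem sS)).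
  rewrite [size (s :: _)]/=.
  have : nm (\sum_(s' <- rem s (S n)) (xi n + fock_unitary R sg s' (xi n))) <= 2 * (size (rem s (S n)))%:R.
    apply: le_trans (nm_sum _ _) _; elim: (rem s (S n)) => [|s' l IH].
      by rewrite big_nil mulr0.
    rewrite big_cons -[size (s' :: l)]/((size l).+1) -[(size l).+1%:R]natr1.
    by rewrite mulrDr mulr1 addrC; apply: lerD.
  rewrite -[(size (rem s (S n))).+1%:R]natr1 mulrDr mulr1 => h1 h2.
  have := nmD (xi n + fock_unitary R sg s (xi n)) (\sum_(s' <- rem s (S n)) (xi n + fock_unitary R sg s' (xi n))).
  lra.
have r_cvg : r @ \oo --> (0 : R) by exact: cvg_harmonic.
have r1 n : r n <= 1 by rewrite invf_le1 // ler1n.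
have big1 n : 1 - r n <= nm (xi n) ^+ 2.
  have := large n (enum 0%N); rewrite map_f ?mem_iota // => /(_ isT) h.
  have := nmD (xi n) (fock_unitary R sg (enum 0%N) (xi n)); rewrite nm_fock_unitary.
  have := nm_ge0 (xi n); have := r1 n; have := r0 n; nra.
apply: (amenable_of_almost_invariant lxi xi1).
- apply: (@squeeze_cvgr _ _ _ _ (fun n => 1 - r n) (fun=> 1)).
  + by apply: nearW => n; rewrite big1 /= expr_le1 ?nm_ge0.
  + by rewrite -[X in _ --> X]subr0; apply: cvgB => //; exact: cvg_cst.
  + exact: cvg_cst.
- move=> k; have [i ik] := enumP k.
  have sq n : (i <= n)%N -> nm (fock_unitary R sg k (xi n) - xi n) ^+ 2 <= 4 * r n.
    move=> ni; have kS : k \in S n by rewrite -ik map_f // mem_iota ltnS.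
    have par := parallelogram (xi n) (fock_unitary R sg k (xi n)).
    have := large n k kS; rewrite nm_fock_unitary in par.
    have := xi1 n; have := nm_ge0 (xi n); have := r0 n; have := r1 n.
    have := nm_ge0 (xi n + fock_unitary R sg k (xi n)); nra.
  apply: (@squeeze_cvgr _ _ _ _ (fun=> 0) (fun n => Num.sqrt (4 * r n))).
  + exists i => // n /= ni; rewrite nm_ge0 /= -[leLHS]ger0_norm ?nm_ge0 //.
    by rewrite -sqrtr_sqr ler_wsqrtr // sq.
  + exact: cvg_cst.
  + rewrite -(@sqrtr0 R) -(mulr0 4); apply: continuous_cvg; first exact: sqrt_continuous.
    by apply: cvgM => //; exact: cvg_cst.
Qed.

End Mean.

(** * Universal representations and quasi-free actions *)

Lemma closed_eq_lip (R : realType) (V W : normedModType R[i]) (f g : V -> W) (k : R) :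
  (forall x y, nm (f x - f y) <= k * nm (x - y)) ->
  (forall x y, nm (g x - g y) <= k * nm (x - y)) ->
  closed [set x | f x = g x].
Proof.
move=> hf hg; apply/closedP => x h /=; apply/eqP; rewrite -subr_eq0; apply/eqP/nm_le0.
apply/ler_addgt0Pr => r r0; rewrite add0r.
have k0 : 0 < `|k| + 1 by rewrite ltr_wpDl.
have [y /= fgy yx] := h (r / 2 / (`|k| + 1)) (divr_gt0 (divr_gt0 r0 (ltr0n R 2)) k0).
have b : k * nm (y - x) <= r / 2.
  apply: (@le_trans _ _ ((`|k| + 1) * (r / 2 / (`|k| + 1)))); last first.
    by rewrite mulrC divfK ?gt_eqF.
  apply: (@le_trans _ _ ((`|k| + 1) * nm (y - x))).
    by rewrite ler_wpM2r ?nm_ge0 // (le_trans (ler_norm k)) // lerDl.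
  by rewrite ler_wpM2l ?(ltW k0).
apply: le_trans (nm_tri (f y) _ _) _; rewrite [leRHS]splitr; apply: lerD.
  by rewrite nm_dist; apply: le_trans (hf y x) b.
by rewrite fgy; apply: le_trans (hg y x) b.
Qed.

Lemma lip_linear (R : realType) (V W : normedModType R[i]) (f : V -> W) (k : R) :
  linear f -> (forall x, nm (f x) <= k * nm x) -> forall x y, nm (f x - f y) <= k * nm (x - y).
Proof.
move=> lf hf x y; have E := lf (-1) y x; rewrite !scaleN1r in E.
by rewrite addrC -E [- y + x]addrC.
Qed.

Lemma lin0 (R : realType) (V W : normedModType R[i]) (f : V -> W) : linear f -> f 0 = 0.
Proof.
move=> lf; apply: (addIr (f 0)); have := lf 1 0 0.
by rewrite !scale1r addr0 add0r => <-.
Qed.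

Lemma linD (R : realType) (V W : normedModType R[i]) (f : V -> W) : linear f ->
  forall x y, f (x + y) = f x + f y.
Proof. by move=> lf x y; have := lf 1 x y; rewrite !scale1r. Qed.

Lemma linZ (R : realType) (V W : normedModType R[i]) (f : V -> W) : linear f ->
  forall (c : R[i]) x, f (c *: x) = c *: f x.
Proof. by move=> lf c x; have := lf c x 0; rewrite !addr0 lin0 // addr0. Qed.

Section StarHomClosed.
Variables (R : realType) (B D : cstarAlgType R) (e : B).
Hypothesis he : is_unit e.

Lemma star_hom_lip (P : B -> D) : star_hom P -> forall x y, nm (P x - P y) <= 1 * nm (x - y).
Proof. by move=> hP x y; rewrite -star_homB // mul1r; exact: (star_hom_contractive he). Qed.

Lemma star_hom_ext (S : set B) (P Q : B -> D) : generates S -> star_hom P -> star_hom Q ->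
  (forall x, S x -> P x = Q x) -> P =1 Q.
Proof.
move=> gS hP hQ PQ x.
have E : [set y | P y = Q y] = setT.
  apply: gS; last exact: PQ.
    exact: (closed_eq_lip (star_hom_lip hP) (star_hom_lip hQ)).
  split=> /= [|c a b Pa Pb|a b Pa Pb|a Pa].
  - by rewrite !star_hom0.
  - by rewrite !(star_homD, star_homZ) // Pa Pb.
  - by rewrite !star_homM // Pa Pb.
  - by rewrite !star_homS // Pa.
by have : [set y | P y = Q y] x by rewrite E.
Qed.
End StarHomClosed.

(** The image of the unit acts as the identity on the span of rho(A) B, which is
    dense by non-degeneracy. *)
Lemma rigged_unit (R : realType) (A : cstarAlgType R) (X : corrType A) (B : cstarAlgType R)
    (rho : A -> B) (t : X -> B) (a1 : A) :
  is_unit a1 -> rigged rho t -> is_unit (rho a1).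
Proof.
move=> [L1 R1] [[hrho nd] _ _ _].
have L x : rho a1 ** x = x.
  have cl : closed [set x | rho a1 ** x = x].
    apply: (@closed_eq_lip _ _ _ _ _ (nm (rho a1) + 1)) => y z.
      by rewrite -cmulBr; apply: le_trans (nmM _ _) _; rewrite ler_wpM2r ?nm_ge0 ?lerDl.
    by rewrite ler_peMl ?nm_ge0 // lerDr nm_ge0.
  have : closed_span [set z | exists (a : A) (b : B), z = rho a ** b] x by rewrite nd.
  suff sub : [set x | exists n (c : 'I_n -> R[i]) (s : 'I_n -> B),
    (forall i, [set z | exists (a : A) (b : B), z = rho a ** b] (s i)) /\
      x = \sum_i c i *: s i] `<=` [set x | rho a1 ** x = x].
    by move=> /(closure_subset sub); move/closure_id: cl => <-.
  move=> _ [n [c [s [hs ->]]]] /=; rewrite cmul_sumr; apply: eq_bigr => i _.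
  by have [a [b ->]] := hs i; rewrite cmulZr cmulA -star_homM // L1.
have sa1 : star a1 = a1.
  by rewrite -[LHS]R1 -{2}(starK a1) -starM R1 starK.
split=> // x; transitivity (star (rho a1 ** star x)); last by rewrite L starK.
by rewrite starM starK -star_homS // sa1.
Qed.

Section UniversalRepresentation.
Variable R : realType.
Local Notation X := (ell2 R).

(** The data that determine a rigged representation of l^2(N).  They are
    automatically completely contractive and covariant, so that the Toeplitz
    and the Cuntz-Pimsner algebra have the same universal property. *)
Definition ell2_rep (B : cstarAlgType R) (e : B) (t : X -> B) :=
  [/\ is_unit e, linear t & forall x y, star (t x) ** t y = ip x y *: e].

Definition universal_rep (B : cstarAlgType R) (e : B) (t : X -> B) :=
  [/\ ell2_rep e t,
    forall (D : cstarAlgType R) (e' : D) (t' : X -> D), ell2_rep e' t' ->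
      exists P : B -> D, [/\ star_hom P, P e = e' & forall x, P (t x) = t' x] &
    forall (D : cstarAlgType R) (P Q : B -> D), star_hom P -> star_hom Q ->
      P e = Q e -> (forall x, P (t x) = Q (t x)) -> P =1 Q].

Lemma scalars_unit : is_unit ((1 : R[i]) : scalars R).
Proof. by split=> x; [exact: (@mul1r R[i])|exact: (@mulr1 R[i])]. Qed.

Lemma rho_scalar (B : cstarAlgType R) (rho : scalars R -> B) : star_hom rho ->
  forall a, rho a = scalar_map (rho (1 : R[i])) a.
Proof.
move=> hrho a; rewrite /scalar_map -(star_homZ hrho); congr rho.
by rewrite -[RHS]/((a : R[i]) * 1) mulr1.
Qed.

Lemma rigged_ell2_rep (B : cstarAlgType R) (rho : scalars R -> B) (t : X -> B) :
  rigged rho t -> ell2_rep (rho (1 : R[i])) t.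
Proof.
move=> rg; split; first exact: rigged_unit scalars_unit rg.
  by case: rg => _ [].
by move=> x y; have [[hrho _] _ _ ->] := rg; rewrite rho_scalar.
Qed.

Lemma gen_ext (B D : cstarAlgType R) (rho : scalars R -> B) (t : X -> B) (P Q : B -> D) :
  rigged rho t -> generates (range rho `|` range t) -> star_hom P -> star_hom Q ->
  P (rho (1 : R[i])) = Q (rho (1 : R[i])) -> (forall x, P (t x) = Q (t x)) -> P =1 Q.
Proof.
move=> rg gen hP hQ Pe Pt.
have hu := rigged_unit scalars_unit rg.
apply: (star_hom_ext hu gen hP hQ) => _ [[a _ <-]|[x _ <-]] //.
have [[hrho _] _ _ _] := rg.
by rewrite (rho_scalar hrho) /scalar_map (star_homZ hP) (star_homZ hQ) Pe.
Qed.

Lemma toeplitz_universal (T : cstarAlgType R) (rho : scalars R -> T) (t : X -> T) :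
  is_toeplitz_algebra rho t -> universal_rep (rho (1 : R[i])) t.
Proof.
move=> [rg gen univ]; split; first exact: rigged_ell2_rep.
  move=> D e' t' [he' lt' it'].
  have [P [hP Pr Pt]] := univ D _ _ (ell2_rigged he' lt' it').
  by exists P; split=> //; rewrite Pr /scalar_map scale1r.
by move=> D P Q; exact: gen_ext.
Qed.

Lemma cuntz_pimsner_universal (O : cstarAlgType R) (rho : scalars R -> O) (t : X -> O) :
  is_cuntz_pimsner_algebra rho t -> universal_rep (rho (1 : R[i])) t.
Proof.
move=> [[rg _] gen univ]; split; first exact: rigged_ell2_rep.
  move=> D e' t' [he' lt' it'].
  have [P [hP Pr Pt]] := univ D _ _ (ell2_rigged he' lt' it') (ell2_covariant he' lt' it').
  by exists P; split=> //; rewrite Pr /scalar_map scale1r.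
by move=> D P Q; exact: gen_ext.
Qed.

Lemma rep_le (B : cstarAlgType R) (e : B) (t : X -> B) : ell2_rep e t ->
  forall x, nm (t x) <= nm x.
Proof.
move=> [he _ it] x; rewrite -(@ler_pXn2r _ 2) ?nnegrE ?nm_ge0 // -nm_cstar it ipxx.
by rewrite nmZr ?sqr_ge0 // ler_piMr ?sqr_ge0 // nm_unit.
Qed.

Variables (G : groupType) (sg : index_action G).

Lemma ell2_rep_comp (B : cstarAlgType R) (e : B) (t : X -> B) g : ell2_rep e t ->
  ell2_rep e (fun x => t (index_unitary R sg g x)).
Proof.
move=> [he lt it]; split=> // [c x y|x y]; first by rewrite bop_linear lt.
by rewrite it index_unitary_ip.
Qed.

(** Composing t with a unitary of l^2(N) gives another representation; the
    group law holds because homomorphisms are determined on generators. *)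
Lemma quasi_free_action (B : cstarAlgType R) (e : B) (t : X -> B) : universal_rep e t ->
  exists alpha : G -> B -> B, [/\ is_action alpha, forall g, alpha g e = e &
    forall g x, alpha g (t x) = t (index_unitary R sg g x)].
Proof.
move=> [rep univ ext].
have /choice [alpha ha] : forall g, exists P : B -> B,
    [/\ star_hom P, P e = e & forall x, P (t x) = t (index_unitary R sg g x)].
  by move=> g; exact: univ (ell2_rep_comp g rep).
have hs g : star_hom (alpha g) by case: (ha g).
have he g : alpha g e = e by case: (ha g).
have ht g x : alpha g (t x) = t (index_unitary R sg g x) by case: (ha g).
have hid : star_hom (fun b : B => b) by split.
exists alpha; split=> //; split=> // [b|g h b].
  by apply: (ext B _ (fun b => b)) => // x; rewrite ht index_unitary1.
apply: (ext B _ (alpha g \o alpha h)) => //=; first exact: star_hom_comp.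
  by rewrite !he.
by move=> x; rewrite !ht index_unitaryM.
Qed.

(** The homomorphisms b |-> V_g P(b) V_g' and P o alpha_g agree on generators. *)
Lemma quasi_free_covariant (B D : cstarAlgType R) (e : B) (t : X -> B) (alpha : G -> B -> B)
    (P : B -> D) (V : G -> D) (e' : D) :
  universal_rep e t -> is_action alpha -> (forall g, alpha g e = e) ->
  (forall g x, alpha g (t x) = t (index_unitary R sg g x)) ->
  star_hom P -> P e = e' -> is_unit e' ->
  (forall g h, V (g * h)%g = V g ** V h) -> V 1%g = e' ->
  (forall g, star (V g) = V g^-1%g) ->
  (forall g x, V g ** P (t x) = P (t (index_unitary R sg g x)) ** V g) ->
  forall g b, V g ** P b = P (alpha g b) ** V g.
Proof.
move=> [_ _ ext] [hsh _ _] ae ag hP Pe [L1 R1] VM V1 VS Vt g b.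
have VV : V g^-1%g ** V g = e' by rewrite -VM mulVg.
have VV' : V g ** V g^-1%g = e' by rewrite -VM mulgV.
have hQ : star_hom (fun b => V g ** P b ** V g^-1%g).
  split=> [c x y|x y|x].
  - by rewrite star_homD // star_homZ // cmulDr cmulDl cmulZr cmulZl.
  - by rewrite star_homM // !cmulA -[_ ** V g^-1%g ** V g]cmulA VV R1.
  - by rewrite star_homS // !starM !VS invgK cmulA.
have E : (fun b => V g ** P b ** V g^-1%g) =1 P \o alpha g.
  apply: ext => //; first exact: star_hom_comp.
    by rewrite /= ae Pe R1.
  by move=> x; rewrite /= ag Vt -cmulA VV' R1.
by rewrite -[P (alpha g b)]/((P \o alpha g) b) -E -cmulA VV R1.
Qed.

End UniversalRepresentation.

(** * The crossed product correspondence *)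

Section CrossedCorrespondence.
Variables (R : realType) (G : groupType) (sg : index_action G).
Hypothesis nonamenable : ~ amenable R G.
Local Notation X := (ell2 R).
Local Notation one := ((1 : R[i]) : scalars R).

Variables (T : cstarAlgType R) (rhoT : scalars R -> T) (tT : X -> T).
Variable alpha : G -> T -> T.
Variables (O : cstarAlgType R) (rhoO : scalars R -> O) (tO : X -> O).
Variable beta : G -> O -> O.
Variable q : T -> O.
Local Notation eT := (rhoT one).
Local Notation eO := (rhoO one).
Hypothesis rhoT_hom : star_hom rhoT.
Hypothesis rhoO_hom : star_hom rhoO.
Hypothesis uT : universal_rep eT tT.
Hypothesis uO : universal_rep eO tO.
Hypothesis halpha : is_action alpha.
Hypothesis alpha_e : forall g, alpha g eT = eT.
Hypothesis alpha_t : forall g x, alpha g (tT x) = tT (index_unitary R sg g x).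
Hypothesis hbeta : is_action beta.
Hypothesis beta_e : forall g, beta g eO = eO.
Hypothesis beta_t : forall g x, beta g (tO x) = tO (index_unitary R sg g x).
Hypothesis hq : star_hom q.
Hypothesis q_e : q eT = eO.
Hypothesis q_t : forall x, q (tT x) = tO x.
Hypothesis q_equiv : forall g z, beta g (q z) = q (alpha g z).

Variables (TG : cstarAlgType R) (jT : (G -> T) -> TG).
Hypothesis hTG : is_full_crossed_product alpha jT.
Variables (OG : cstarAlgType R) (jO : (G -> O) -> OG).
Hypothesis hOG : is_full_crossed_product beta jO.
Variables (AG : cstarAlgType R) (XG : corrType AG) (iA : AG -> TG) (iX : XG -> TG).
Hypothesis hX : is_crossed_correspondence rhoT tT jT iA iX.

Let unitT : is_unit eT. Proof. by case: uT => -[]. Qed.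
Let unitO : is_unit eO. Proof. by case: uO => -[]. Qed.
Let linT : linear tT. Proof. by case: uT => -[]. Qed.
Let innT x y : star (tT x) ** tT y = ip x y *: eT. Proof. by case: uT => -[]. Qed.
Let linO : linear tO. Proof. by case: uO => -[]. Qed.

Let hiA : star_hom iA. Proof. by case: hX => -[]. Qed.
Let nm_iA a : nm (iA a) = nm a.
Proof. by case: hX => -[_ h _] _ _ _ _; rewrite /nm h. Qed.
Let iA_range : range iA = closure [set jT (rhoT \o f) | f in @fin_supp G (scalars R)].
Proof. by case: hX => -[]. Qed.
Let hiX : linear iX. Proof. by case: hX => _ []. Qed.
Let nm_iX x : nm (iX x) = nm x.
Proof. by case: hX => _ [_ h _] _ _ _; rewrite /nm h. Qed.
Let iX_range : range iX = closure [set jT (tT \o f) | f in @fin_supp G X].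
Proof. by case: hX => _ []. Qed.
Let iX_lact (a : AG) (x : XG) : iX (lact a x) = iA a ** iX x.
Proof. by case: hX. Qed.
Let iX_ract (x : XG) (a : AG) : iX (ract x a) = iX x ** iA a.
Proof. by case: hX. Qed.
Let iA_inner (x y : XG) : iA (inner x y) = star (iX x) ** iX y.
Proof. by case: hX. Qed.

Let iA_inj a b : iA a = iA b -> a = b.
Proof.
move=> h; apply/eqP; rewrite -subr_eq0; apply/eqP/nm_eq0.
by rewrite -nm_iA (star_homB hiA) h subrr nm0.
Qed.

Let iX_inj x y : iX x = iX y -> x = y.
Proof.
move=> h; apply/eqP; rewrite -subr_eq0; apply/eqP/nm_eq0.
by rewrite -nm_iX -scaleN1r (linD hiX) (linZ hiX) h scaleN1r subrr nm0.
Qed.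

Let U := cp_unitary eT jT.
Let emb := cp_emb jT.
Let emb_hom : star_hom emb := cp_emb_hom halpha hTG.
Let UM g h : U (g * h)%g = U g ** U h := cp_unitaryM unitT halpha hTG g h.
Let US g : star (U g) = U g^-1%g := cp_unitaryS unitT halpha hTG g.
Let U1 : is_unit (U 1%g) := cp_unit unitT halpha hTG.
Let Uemb g b : U g ** emb b = emb (alpha g b) ** U g := cp_covariant unitT halpha hTG g b.
Let emb_e : emb eT = U 1%g. Proof. by []. Qed.

Let s x := emb (tT x).

Let s_lin : linear s.
Proof. by move=> c x y; rewrite /s linT; case: emb_hom => ->. Qed.

Let s_inner x y : star (s x) ** s y = ip x y *: U 1%g.
Proof. by rewrite /s -(star_homS emb_hom) -(star_homM emb_hom) innT (star_homZ emb_hom). Qed.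

Let s_rep : ell2_rep (U 1%g) s. Proof. by split. Qed.

Let Us g x : U g ** s x = s (index_unitary R sg g x) ** U g.
Proof. by rewrite /s Uemb alpha_t. Qed.

Let jT_scal (f : G -> scalars R) r : uniq r -> supported r f ->
  jT (rhoT \o f) = \sum_(g <- r) (f g : R[i]) *: U g.
Proof.
move=> ur rf; rewrite (cp_sum unitT halpha hTG ur) => [|g gr]; last first.
  by rewrite /= rf // (star_hom0 rhoT_hom).
apply: eq_bigr => g _; rewrite -/emb -/U -[(rhoT \o f) g]/(rhoT (f g)) (rho_scalar rhoT_hom) /scalar_map (star_homZ emb_hom).
by rewrite cmulZl emb_e -UM mul1g.
Qed.

Let jT_vec (f : G -> X) r : uniq r -> supported r f ->
  jT (tT \o f) = \sum_(g <- r) s (f g) ** U g.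
Proof.
move=> ur rf; rewrite (cp_sum unitT halpha hTG ur) // => g gr.
by rewrite /= rf // (lin0 linT).
Qed.

Let w_ex g : exists a, iA a = U g.
Proof.
have : range iA (U g).
  rewrite iA_range; apply: subset_closure; exists (single g one).
    exact: fin_supp_single.
  rewrite (@jT_scal _ [:: g]) // => [|h]; last by rewrite inE /single => /negbTE ->.
  by rewrite big_seq1 /single eqxx scale1r.
by move=> [a _ <-]; exists a.
Qed.

Let w g : AG := projT1 (cid (w_ex g)).
Let iA_w g : iA (w g) = U g. Proof. exact: projT2 (cid (w_ex g)). Qed.

Let xi_ex x : exists y, iX y = s x.
Proof.
have : range iX (s x).
  rewrite iX_range; apply: subset_closure; exists (single 1%g x).
    exact: fin_supp_single.
  rewrite (@jT_vec _ [:: 1%g]) // => [|h]; last by rewrite inE /single => /negbTE ->.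
  by rewrite big_seq1 /single eqxx; case: U1.
by move=> [y _ <-]; exists y.
Qed.

Let xi x : XG := projT1 (cid (xi_ex x)).
Let iX_xi x : iX (xi x) = s x. Proof. exact: projT2 (cid (xi_ex x)). Qed.

Let wM g h : w (g * h)%g = w g ** w h.
Proof. by apply: iA_inj; rewrite (star_homM hiA) !iA_w UM. Qed.
Let wS g : star (w g) = w g^-1%g.
Proof. by apply: iA_inj; rewrite (star_homS hiA) !iA_w US. Qed.
Let w1 : is_unit (w 1%g).
Proof.
have [L1 R1] := U1.
by split=> a; apply: iA_inj; rewrite (star_homM hiA) iA_w ?L1 ?R1.
Qed.

Let AG_sum (f : G -> scalars R) a r : uniq r -> supported r f ->
  iA a = jT (rhoT \o f) -> a = \sum_(g <- r) (f g : R[i]) *: w g.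
Proof.
move=> ur rf ha; apply: iA_inj; rewrite ha (jT_scal ur rf) (star_hom_sum hiA).
by apply: eq_bigr => g _; rewrite (star_homZ hiA) iA_w.
Qed.

Let XG_sum (f : G -> X) x r : uniq r -> supported r f ->
  iX x = jT (tT \o f) -> x = \sum_(g <- r) ract (xi (f g)) (w g).
Proof.
move=> ur rf hx; apply: iX_inj; rewrite hx (jT_vec ur rf).
elim/big_rec2: _ => [|g y z _ ->]; first by rewrite (lin0 hiX).
by rewrite (linD hiX) iX_ract iX_xi iA_w.
Qed.

Let AG_ind (P : AG -> Prop) : closed [set a | P a] -> P 0 ->
  (forall a b, P a -> P b -> P (a + b)) -> (forall (c : R[i]) a, P a -> P (c *: a)) ->
  (forall g, P (w g)) -> forall a, P a.
Proof.
move=> cP P0 PD PZ Pw a; apply: ((closedP _).1 cP) => r r0.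
have : closure [set jT (rhoT \o f) | f in @fin_supp G (scalars R)] (iA a).
  by rewrite -iA_range; exists a.
move=> /closure_nmP /(_ r r0) [_ [f sf <-] fr].
have /fin_suppP [l ul lf] := sf.
exists (\sum_(g <- l) (f g : R[i]) *: w g) => /=.
  by elim/big_ind: _ => // g _; exact/PZ/Pw.
rewrite -nm_iA (star_homB hiA) (star_hom_sum hiA); apply: le_trans fr.
rewrite (jT_scal ul lf) le_eqVlt; apply/orP; left; apply/eqP; congr (nm (_ - _)).
by apply: eq_bigr => g _; rewrite (star_homZ hiA) iA_w.
Qed.

Let XG_ind (P : XG -> Prop) : closed [set x | P x] -> P 0 ->
  (forall x y, P x -> P y -> P (x + y)) ->
  (forall x g, P (ract (xi x) (w g))) -> forall x, P x.
Proof.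
move=> cP P0 PD Pw a; apply: ((closedP _).1 cP) => r r0.
have : closure [set jT (tT \o f) | f in @fin_supp G X] (iX a).
  by rewrite -iX_range; exists a.
move=> /closure_nmP /(_ r r0) [_ [f sf <-] fr].
have /fin_suppP [l ul lf] := sf.
have [y hy] : exists y, iX y = jT (tT \o f).
  have : range iX (jT (tT \o f)) by rewrite iX_range; apply: subset_closure; exists f.
  by move=> [y _ <-]; exists y.
exists y => /=; first by rewrite (XG_sum ul lf hy); elim/big_ind: _.
rewrite -nm_iX; apply: le_trans fr; rewrite -hy le_eqVlt; apply/orP; left; apply/eqP.
by congr nm; rewrite -scaleN1r (linD hiX) (linZ hiX) scaleN1r.
Qed.

Let UO := cp_unitary eO jO.
Let embO := cp_emb jO.
Let embO_hom : star_hom embO := cp_emb_hom hbeta hOG.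

Let UO1 : is_unit (UO 1%g) := cp_unit unitO hbeta hOG.

Lemma crossed_quotient_exists : exists Q : TG -> OG, star_hom Q /\
  forall b g, Q (emb b ** U g) = embO (q b) ** UO g.
Proof.
apply: (cp_universal unitT halpha hTG (pi := embO \o q) (V := UO)).
- exact: star_hom_comp.
- exact: (cp_unitaryM unitO hbeta hOG).
- exact: (cp_unitaryS unitO hbeta hOG).
- by move=> g b /=; rewrite (cp_covariant unitO hbeta hOG) q_equiv.
Qed.

Let Q : TG -> OG := projT1 (cid crossed_quotient_exists).
Let hQ : star_hom Q. Proof. by case: (projT2 (cid crossed_quotient_exists)). Qed.
Let QE b g : Q (emb b ** U g) = embO (q b) ** UO g.
Proof. by case: (projT2 (cid crossed_quotient_exists)). Qed.
Let Q_emb b : Q (emb b) = embO (q b).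
Proof. by have [_ R1] := U1; have [_ R2] := UO1; rewrite -[emb b]R1 QE R2. Qed.
Let Q_U g : Q (U g) = UO g.
Proof.
have [L1 _] := U1; have [L2 _] := UO1.
by rewrite -[U g]L1 -emb_e QE q_e L2.
Qed.

(** * The Fock representation of the crossed product *)
Lemma fock_exists : exists Phi : OG -> bop R, [/\ star_hom Phi,
  forall g, Phi (UO g) = fock_unitary R sg g & forall n, Phi (embO (tO (basis_vec R n))) = creation R n].
Proof.
have [tF [ltF itF tFS]] := cuntz_representation (bop1_unit R) (@creation_cuntz R).
have repF : ell2_rep (bop1 R) tF by split=> //; exact: bop1_unit.
have [_ univ _] := uO; have [P [hP Pe Pt]] := univ _ _ _ repF.
have cov g x : fock_unitary R sg g ** tF x = tF (index_unitary R sg g x) ** fock_unitary R sg g.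
  apply: (@basis_ext R (bop R) (fun x => fock_unitary R sg g ** tF x)
    (fun x => tF (index_unitary R sg g x) ** fock_unitary R sg g) (nm (fock_unitary R sg g))).
  - by move=> c y z; rewrite ltF cmulDr cmulZr.
  - by move=> c y z; rewrite bop_linear ltF cmulDl cmulZl.
  - move=> y; apply: le_trans (nmM _ _) _; rewrite ler_wpM2l ?nm_ge0 //.
    exact: (rep_le repF).
  - move=> y; apply: le_trans (nmM _ _) _; rewrite mulrC ler_wpM2l ?nm_ge0 //.
    by apply: le_trans (rep_le repF _) _; exact: pinj_op_le.
  - by move=> n; rewrite index_unitary_basis !tFS fock_unitary_creation.
have covP : forall g b, fock_unitary R sg g ** P b = P (beta g b) ** fock_unitary R sg g.
  apply: (quasi_free_covariant uO hbeta beta_e beta_t hP Pe (bop1_unit R)).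
  - exact: fock_unitaryM.
  - exact: fock_unitary1.
  - exact: star_fock_unitary.
  - by move=> g x; rewrite !Pt cov.
have [Phi [hPhi PhiE]] := cp_universal unitO hbeta hOG hP (@fock_unitaryM R G sg) (@star_fock_unitary R G sg) covP.
have [L1 R1] := UO1; have [L2 R2] := bop1_unit R.
exists Phi; split=> // [g|n].
  by rewrite -[UO g]L1 -[UO 1%g]/(embO eO) PhiE Pe L2.
by rewrite -[embO _]R1 PhiE fock_unitary1 R2 Pt tFS.
Qed.

Let Phi : OG -> bop R := projT1 (cid fock_exists).
Let hPhi : star_hom Phi. Proof. by case: (projT2 (cid fock_exists)). Qed.
Let Phi_U g : Phi (UO g) = fock_unitary R sg g. Proof. by case: (projT2 (cid fock_exists)). Qed.
Let Phi_s n : Phi (embO (tO (basis_vec R n))) = creation R n.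
Proof. by case: (projT2 (cid fock_exists)). Qed.

Let Psi a : bop R := Phi (Q (iA a)).
Let hPsi : star_hom Psi.
Proof. exact: (star_hom_comp hPhi (star_hom_comp hQ hiA)). Qed.
Let Psi_w g : Psi (w g) = fock_unitary R sg g. Proof. by rewrite /Psi iA_w Q_U Phi_U. Qed.

Let lin_star (B D : cstarAlgType R) (P : B -> D) : star_hom P -> linear P.
Proof. by case. Qed.

Let star_le (D : cstarAlgType R) (P : AG -> D) (hP : star_hom P) a : nm (P a) <= nm a.
Proof. exact: (star_hom_contractive w1). Qed.

(** Elements of C*(G) are limits of combinations of the unitaries w g. *)
Lemma AG_ext (V : normedModType R[i]) (f h : AG -> V) (k : R) : linear f -> linear h ->
  (forall a, nm (f a) <= k * nm a) -> (forall a, nm (h a) <= k * nm a) ->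
  (forall g, f (w g) = h (w g)) -> f =1 h.
Proof.
move=> lf lh fk hk fh; elim/AG_ind => [||a b|c a|g] //.
- by apply: closed_eq_lip; apply: lip_linear; eassumption.
- by rewrite !lin0.
- by move=> ea eb; rewrite (linD lf) (linD lh) ea eb.
- by move=> ea; rewrite (linZ lf) (linZ lh) ea.
Qed.

Let Psi_commutes (p : bop R) : (forall g, fock_unitary R sg g ** p = p ** fock_unitary R sg g) ->
  forall a, Psi a ** p = p ** Psi a.
Proof.
move=> hp; apply: (@AG_ext _ (fun a => Psi a ** p) (fun a => p ** Psi a) (nm p)).
- by move=> c a b; rewrite (lin_star hPsi) cmulDl cmulZl.
- by move=> c a b; rewrite (lin_star hPsi) cmulDr cmulZr.
- move=> a; apply: le_trans (nmM _ _) _; rewrite mulrC ler_wpM2l ?nm_ge0 //.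
  exact: star_le.
- move=> a; apply: le_trans (nmM _ _) _; rewrite ler_wpM2l ?nm_ge0 //.
  exact: star_le.
- by move=> g; rewrite Psi_w hp.
Qed.

Let compress_hom p : star p = p -> p ** p = p ->
  (forall g, fock_unitary R sg g ** p = p ** fock_unitary R sg g) -> star_hom (fun a => Psi a ** p).
Proof.
move=> sp pp /Psi_commutes hp; split=> [c a b|a b|a].
- by rewrite (lin_star hPsi) cmulDl cmulZl.
- by rewrite (star_homM hPsi) -cmulA [Psi a ** p ** _]cmulA -[Psi a ** p ** Psi b]cmulA -hp !cmulA -[_ ** p ** p]cmulA pp.
- by rewrite starM sp -(star_homS hPsi); exact: hp.
Qed.

(** The vacuum carries the trivial representation of G and the letters carry
    copies of the regular one.  If the former vanished on the kernel of the
    latter, it would be dominated by it; on sums of 1 + g the trivial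
    representation attains the largest possible value, hence so would the
    regular one. *)
Lemma separating_element : exists a, Psi a ** letters R = 0 /\ Psi a ** vacuum R <> 0.
Proof.
apply: contrapT => nex; apply: nonamenable; apply: (amenable_of_norm (sg := sg)) => S.
pose a := \sum_(g <- S) (w 1%g + w g).
have Psi_a : Psi a = \sum_(g <- S) (bop1 R + fock_unitary R sg g).
  rewrite (star_hom_sum hPsi); apply: eq_bigr => g _.
  by rewrite (star_homD hPsi) !Psi_w fock_unitary1.
have hl := compress_hom (star_pproj R _) (pproj_idem R _) (@fock_unitary_letters R G sg).
have hv := compress_hom (star_pproj R _) (pproj_idem R _) (@fock_unitary_vacuum R G sg).
have dom : nm (Psi a ** vacuum R) <= nm (Psi a ** letters R).
  apply: (dominated_of_ker w1 hl hv) => b hb.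
  by apply: contrapT => hb'; apply: nex; exists b.
rewrite -Psi_a; apply: le_trans dom.
have E : (Psi a ** vacuum R) (word_vec R [::]) = (2 * (size S)%:R : R)%:C%C *: word_vec R [::].
  rewrite bopM vacuum_word_vec Psi_a; elim: S {a Psi_a} => [|g S IH].
    by rewrite big_nil mulr0 scale0r.
  rewrite big_cons bopD IH bopD bop1E fock_unitary_word_vec -[size (g :: S)]/((size S).+1).
  rewrite -[(size S).+1%:R]natr1 mulrDr mulr1 rmorphD scalerDl addrC; congr (_ + _).
  by rewrite -[2]/(1 + 1 : R) rmorphD scalerDl rmorph1 scale1r.
have := le_opnorm (Psi a ** vacuum R) (word_vec R [::]).
by rewrite E nmZr ?mulr_ge0 // nm_basis_vec !mulr1.
Qed.

Let a0 : AG := projT1 (cid separating_element).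
Let a0_letters : Psi a0 ** letters R = 0.
Proof. by case: (projT2 (cid separating_element)). Qed.
Let a0_vacuum : Psi a0 (word_vec R [::]) <> 0.
Proof.
have [_ h] := projT2 (cid separating_element); move=> h0; apply: h.
apply: word_basis_ext => l; rewrite bopM vacuum_word_vec; case: l => [//|k l].
exact: bop_0.
Qed.

(** * An element of the Katsura ideal *)

Let sb n := s (basis_vec R n).

Let sb_star n m : star (sb n) ** sb m = (n == m)%:R *: U 1%g.
Proof. by rewrite /sb s_inner ip_basis_vec basis_vecE. Qed.

Let U_sb g n : U g ** sb n = sb (sg g n) ** U g.
Proof. by rewrite /sb Us index_unitary_basis. Qed.

Let sb_le n : nm (sb n) <= 1.
Proof. by rewrite -(@nm_basis_vec R n); exact: (rep_le s_rep). Qed.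

(** For n <> 0 both sides are the canonical trace of c: on a group element g
    they vanish unless g fixes n, that is, unless g = 1. *)
Let trace_sb n : n != 0%N -> forall c,
  star (sb n) ** iA c ** sb n = ip (word_vec R [:: n]) (Psi c (word_vec R [:: n])) *: U 1%g.
Proof.
move=> n0; apply: (@AG_ext _ (fun c => star (sb n) ** iA c ** sb n)
  (fun c => ip (word_vec R [:: n]) (Psi c (word_vec R [:: n])) *: U 1%g) 1).
- by move=> c a b; rewrite (lin_star hiA) cmulDr cmulDl cmulZr cmulZl.
- by move=> c a b; rewrite (lin_star hPsi) bopD bopZ ipDr ipZr scalerDl scalerA.
- move=> a; rewrite mul1r -[leRHS](nm_iA a); apply: le_trans (nmM _ _) _.
  apply: (@le_trans _ _ (nm (star (sb n) ** iA a) * 1)).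
    by rewrite ler_wpM2l ?nm_ge0 ?sb_le.
  rewrite mulr1; apply: le_trans (nmM _ _) _; rewrite nm_star -[leRHS]mul1r.
  by rewrite ler_wpM2r ?nm_ge0 ?sb_le.
- move=> a; rewrite mul1r nmZ.
  apply: (@le_trans _ _ (Normc.normc (ip (word_vec R [:: n]) (Psi a (word_vec R [:: n]))) * 1)).
    by rewrite ler_wpM2l ?normc_ge0 ?nm_unit.
  rewrite mulr1; apply: le_trans (ip_le _ _) _; rewrite nm_basis_vec mul1r.
  by apply: le_trans (le_opnorm _ _) _; rewrite nm_basis_vec mulr1; exact: (star_le hPsi).
move=> g; rewrite iA_w -cmulA U_sb cmulA sb_star Psi_w fock_unitary_word_vec /word_vec ip_basis_vec basis_vecE.
rewrite (can_eq CodeSeq.codeK) /=; have [E|ne] := eqVneq n (sg g n).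
  have g1 : g = 1%g.
    have := gpr_iact sg g n0; rewrite -E => h.
    by apply: (mulIg (gpr sg n)); rewrite mul1g.
  by rewrite cmulZl -UM mul1g g1 iact1 !eqxx.
have -> : ([:: n] == [:: sg g n]) = false.
  by apply/eqP => -[E]; rewrite {1}E eqxx in ne.
by rewrite !scale0r cmul0l.
Qed.

Let a0_sb n : n != 0%N -> iA a0 ** sb n = 0.
Proof.
move=> n0; apply: cstar_eq0; rewrite starM cmulA -[star (sb n) ** _ ** _]cmulA.
rewrite -(star_homS hiA) -(star_homM hiA) trace_sb // (star_homM hPsi) bopM.
have -> : Psi a0 (word_vec R [:: n]) = 0.
  have := congr1 (fun f : bop R => f (word_vec R [:: n])) a0_letters.
  by rewrite bopM letters_word_vec n0.
by rewrite bop_0 ip0r scale0r.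
Qed.

Let iA_sb0 a : iA a ** sb 0 = sb 0 ** iA a.
Proof.
apply: (@AG_ext _ (fun a => iA a ** sb 0) (fun a => sb 0 ** iA a) 1) => [c x y|c x y|x|x|g].
- by rewrite (lin_star hiA) cmulDl cmulZl.
- by rewrite (lin_star hiA) cmulDr cmulZr.
- apply: le_trans (nmM _ _) _; rewrite nm_iA mulrC ler_wpM2r ?nm_ge0 //.
- apply: le_trans (nmM _ _) _; rewrite nm_iA ler_wpM2r ?nm_ge0 //.
- by rewrite iA_w U_sb iact0.
Qed.

Let a0_s x : iA a0 ** s x = sb 0 ** iA a0 ** star (sb 0) ** s x.
Proof.
apply: (@basis_ext R TG (fun x => iA a0 ** s x)
  (fun x => sb 0 ** iA a0 ** star (sb 0) ** s x)
  (nm (iA a0) + nm (sb 0 ** iA a0 ** star (sb 0)))).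
- by move=> c y z; rewrite s_lin cmulDr cmulZr.
- by move=> c y z; rewrite s_lin cmulDr cmulZr.
- move=> y; apply: le_trans (nmM _ _) _; rewrite ler_pM ?nm_ge0 ?lerDl ?nm_ge0 //.
  exact: (rep_le s_rep).
- move=> y; apply: le_trans (nmM _ _) _; rewrite ler_pM ?nm_ge0 ?lerDr ?nm_ge0 //.
  exact: (rep_le s_rep).
move=> n; rewrite -/(sb n) -cmulA sb_star; have [<-|n0] := eqVneq 0%N n.
  by rewrite scale1r iA_sb0; case: U1.
by rewrite scale0r cmul0r a0_sb // eq_sym.
Qed.

(** Both sides send s_n, for n <> 0, to 0, and commute with s_0 in the same way. *)
Lemma lact_a0 : lact a0 = theta (ract (xi (basis_vec R 0)) a0) (xi (basis_vec R 0)) :> (XG -> XG).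
Proof.
apply/funext => z; apply: iX_inj.
rewrite iX_lact /theta !iX_ract iA_inner iX_xi -/(sb 0) cmulA.
elim/XG_ind: z => [||x y ex ey|x g].
- apply: (@closed_eq_lip _ _ _ _ _ (nm (iA a0) + nm (sb 0 ** iA a0 ** star (sb 0)))).
    apply: lip_linear => [c x y|x]; first by rewrite hiX cmulDr cmulZr.
    by apply: le_trans (nmM _ _) _; rewrite nm_iX ler_wpM2r ?nm_ge0 // lerDl nm_ge0.
  apply: lip_linear => [c x y|x]; first by rewrite hiX cmulDr cmulZr.
  by apply: le_trans (nmM _ _) _; rewrite nm_iX ler_wpM2r ?nm_ge0 // lerDr nm_ge0.
- by rewrite (lin0 hiX) !cmul0r.
- by rewrite (linD hiX) !cmulDr ex ey.
- by rewrite iX_ract iX_xi iA_w !cmulA a0_s.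
Qed.

(** Compactness is lact_a0.  For the annihilation of the kernel, the fixed
    vector makes the left action faithful: the kernel is zero. *)
Lemma katsura_a0 : katsura_ideal XG a0.
Proof.
split; first by rewrite lact_a0; exact: compact_theta.
move=> b hb; have : iA b ** sb 0 = 0.
  by rewrite /sb -iX_xi -iX_lact hb (lin0 hiX).
rewrite iA_sb0 => /(congr1 (fun z => star (sb 0) ** z)).
rewrite cmulA sb_star eqxx scale1r cmul0r; have [-> _] := U1 => b0.
have -> : b = 0 by apply: iA_inj; rewrite b0 (star_hom0 hiA).
exact: cmul0r.
Qed.

(** * The comparison map *)

Variables (O' : cstarAlgType R) (rho' : AG -> O') (t' : XG -> O').
Hypothesis hO' : is_cuntz_pimsner_algebra rho' t'.

Let rg' : rigged rho' t'. Proof. by case: hO' => -[]. Qed.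
Let hrho' : star_hom rho'. Proof. by case: rg' => -[]. Qed.
Let lt' : linear t'. Proof. by case: rg' => _ []. Qed.
Let unit' : is_unit (rho' (w 1%g)) := rigged_unit w1 rg'.
Let it' x y : star (t' x) ** t' y = rho' (inner x y). Proof. by case: rg'. Qed.

Let lact_w1 (x : XG) : lact (w 1%g) x = x.
Proof. by apply: iX_inj; rewrite iX_lact iA_w; case: U1. Qed.

Let t'_ract (x : XG) (a : AG) : t' (ract x a) = t' x ** rho' a.
Proof.
have [_ _ h _] := rg'; have := h (w 1%g) a x; rewrite lact_w1 => <-.
by case: unit' => ->.
Qed.

Let t'_lact (a : AG) (x : XG) : t' (lact a x) = rho' a ** t' x.
Proof.
have [_ _ h _] := rg'; have := h a (w 1%g) x.
have -> : ract x (w 1%g) = x :> XG by apply: iX_inj; rewrite iX_ract iA_w; case: U1.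
by move=> <-; case: unit' => _ ->.
Qed.

Let rep' : ell2_rep (rho' (w 1%g)) (fun x => t' (xi x)).
Proof.
split=> // [c x y|x y].
  have -> : xi (c *: x + y) = c *: xi x + xi y.
    by apply: iX_inj; rewrite hiX !iX_xi s_lin.
  exact: lt'.
rewrite it' -(star_homZ hrho'); congr rho'; apply: iA_inj.
by rewrite iA_inner !iX_xi s_inner (star_homZ hiA) iA_w.
Qed.

Let V g := rho' (w g).
Let VM g h : V (g * h)%g = V g ** V h. Proof. by rewrite /V wM (star_homM hrho'). Qed.
Let VS g : star (V g) = V g^-1%g. Proof. by rewrite /V -(star_homS hrho') wS. Qed.

(** O' contains a representation of l^2(N), through xi, and the unitaries V g of
    C*(G), and they form a covariant pair. *)
Lemma comparison_exists : exists pi : OG -> O', star_hom pi /\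
  [/\ forall g, pi (UO g) = V g, forall c : scalars R, pi (embO (rhoO c)) = (c : R[i]) *: V 1%g &
  forall x, pi (embO (tO x)) = t' (xi x)].
Proof.
have [_ univ _] := uO; have [P [hP Pe Pt]] := univ _ _ _ rep'.
have covP : forall g b, V g ** P b = P (beta g b) ** V g.
  apply: (quasi_free_covariant uO hbeta beta_e beta_t hP Pe unit' VM erefl VS) => g x.
  rewrite !Pt /V -t'_lact -t'_ract; congr t'; apply: iX_inj.
  by rewrite iX_lact iX_ract !iX_xi iA_w Us.
have [pi [hpi piE]] := cp_universal unitO hbeta hOG hP VM VS covP.
have [L1 R1] := UO1; have [L2 R2] := unit'.
have pi_emb b : pi (embO b) = P b by rewrite -[embO b]R1 piE R2.
exists pi; split=> //; split=> [g|c|x].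
- by rewrite -[UO g]L1 -[UO 1%g]/(embO eO) piE Pe L2.
- by rewrite pi_emb (rho_scalar rhoO_hom) /scalar_map (star_homZ hP) Pe.
- by rewrite pi_emb Pt.
Qed.

Let pi : OG -> O' := projT1 (cid comparison_exists).
Let hpi : star_hom pi. Proof. by case: (projT2 (cid comparison_exists)). Qed.
Let pi_U g : pi (UO g) = V g. Proof. by case: (projT2 (cid comparison_exists)) => _ []. Qed.
Let pi_e (c : scalars R) : pi (embO (rhoO c)) = (c : R[i]) *: V 1%g.
Proof. by case: (projT2 (cid comparison_exists)) => _ []. Qed.
Let pi_t x : pi (embO (tO x)) = t' (xi x).
Proof. by case: (projT2 (cid comparison_exists)) => _ []. Qed.

Let piQ_A a : pi (Q (iA a)) = rho' a.
Proof.
apply: (@AG_ext _ (fun a => pi (Q (iA a))) rho' 1).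
- exact: (lin_star (star_hom_comp hpi (star_hom_comp hQ hiA))).
- exact: lin_star.
- move=> b; rewrite mul1r.
  exact: (star_le (star_hom_comp hpi (star_hom_comp hQ hiA))).
- by move=> b; rewrite mul1r; exact: star_le.
- by move=> g; rewrite iA_w Q_U pi_U.
Qed.

Let t'_le x : nm (t' x) <= nm x.
Proof.
rewrite -(@ler_pXn2r _ 2) ?nnegrE ?nm_ge0 // -nm_cstar it' -nm_inner.
exact: star_le.
Qed.

Let piQ_X x : pi (Q (iX x)) = t' x.
Proof.
have piQ_hom := star_hom_comp hpi hQ.
have le z : nm (pi (Q z)) <= nm z by exact: (star_hom_contractive U1 piQ_hom).
elim/XG_ind: x => [||x y ex ey|x g].
- apply: (@closed_eq_lip _ _ _ _ _ 1).
    apply: lip_linear => [c x y|x]; first by rewrite hiX (lin_star hQ) (lin_star hpi).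
    by rewrite mul1r -[leRHS]nm_iX; exact: le.
  by apply: lip_linear => // x; rewrite mul1r; exact: t'_le.
- by rewrite (lin0 hiX) (lin0 lt') (star_hom0 hQ) (star_hom0 hpi).
- by rewrite (linD hiX) (linD lt') (star_homD hQ) (star_homD hpi) ex ey.
- by rewrite iX_ract iX_xi iA_w QE q_t (star_homM hpi) pi_t pi_U t'_ract.
Qed.

Let pi_onto : range pi = setT.
Proof.
have [_ gen _] := hO'; apply: gen.
- move=> d /(lift_closure_range UO1 hpi) [x <- _]; by exists x.
- split=> [|c _ _ [x _ <-] [y _ <-]|_ _ [x _ <-] [y _ <-]|_ [x _ <-]].
  + by exists 0 => //; exact: (star_hom0 hpi).
  + by exists (c *: x + y) => //; exact: (lin_star hpi).
  + by exists (x ** y) => //; exact: (star_homM hpi).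
  + by exists (star x) => //; exact: (star_homS hpi).
- by move=> _ [[a _ <-]|[x _ <-]]; [exists (Q (iA a))|exists (Q (iX x))].
Qed.

Let pi_gen : generator_preserving rhoT tT jT iA iX rhoO tO jO rho' t' pi.
Proof.
split=> [f a /fin_suppP [r ur rf] ha|f x /fin_suppP [r ur rf] hx].
- rewrite (AG_sum ur rf ha) (star_hom_sum hrho') (cp_sum unitO hbeta hOG ur) => [|g gr]; last first.
    by rewrite /= rf // (star_hom0 rhoO_hom).
  rewrite (star_hom_sum hpi); apply: eq_bigr => g _; rewrite (star_homM hpi) pi_e pi_U (star_homZ hrho').
  by rewrite cmulZl -VM mul1g.
- rewrite (XG_sum ur rf hx) (cp_sum unitO hbeta hOG ur) => [|g gr]; last first.
    by rewrite /= rf // (lin0 linO).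
  rewrite (star_hom_sum hpi); elim/big_rec2: _ => [|g y z _ ->]; first by rewrite (lin0 lt').
  by rewrite (linD lt') t'_ract (star_homM hpi) pi_t pi_U.
Qed.

(** The element a0 - s_0 a0 s_0' of the crossed product is killed by
    covariance, but it acts on the vacuum as the non-zero scalar given by the
    trivial representation of a0. *)
Let pi_not_injective : ~ injective pi.
Proof.
pose z := Q (iA a0 - sb 0 ** iA a0 ** star (sb 0)).
have piz : pi z = 0.
  have sb0E : pi (Q (sb 0)) = t' (xi (basis_vec R 0)) by rewrite /sb -iX_xi piQ_X.
  rewrite /z (star_homB hQ) (star_homB hpi) !(star_homM hQ) !(star_homM hpi) (star_homS hQ) (star_homS hpi) piQ_A sb0E.
  have [[_ [psi [[psi_theta _ _ _] psi_rho]]] _ _] := hO'.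
  rewrite -{1}(psi_rho _ katsura_a0) lact_a0 psi_theta t'_ract subrr //.
have z0 : Phi z (word_vec R [::]) <> 0.
  rewrite /z (star_homB hQ) (star_homB hPhi) !(star_homM hQ) !(star_homM hPhi) (star_homS hQ) (star_homS hPhi) -/(Psi a0).
  have -> : Phi (Q (sb 0)) = creation R 0 by rewrite /sb /s Q_emb q_t Phi_s.
  rewrite bopB !bopM star_creation_word_vec bop_0 bop_0 subr0.
  exact: a0_vacuum.
move=> inj; apply: z0; have -> : z = 0 by apply: inj; rewrite piz (star_hom0 hpi).
by rewrite (star_hom0 hPhi).
Qed.

Theorem comparison_not_injective : exists pi : OG -> O',
  [/\ star_hom pi, generator_preserving rhoT tT jT iA iX rhoO tO jO rho' t' pi,
    range pi = setT & ~ injective pi].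
Proof. by exists pi. Qed.

End CrossedCorrespondence.

(** * The theorem *)

Theorem theorem1 (R : realType) (G : groupType)
    (hcount : countable [set: G]) (hnonam : ~ amenable R G)
    (* the Toeplitz algebra of (C, l^2(N)) *)
    (T : cstarAlgType R) (rhoT : scalars R -> T) (tT : ell2 R -> T)
    (hT : is_toeplitz_algebra rhoT tT) :
  exists alpha : G -> T -> T,
    generalized_gauge_action rhoT tT alpha /\
    forall (O : cstarAlgType R) (rhoO : scalars R -> O) (tO : ell2 R -> O),
      is_cuntz_pimsner_algebra rhoO tO ->
    exists beta : G -> O -> O,
      induced_action rhoT tT rhoO tO alpha beta /\
      forall (TG : cstarAlgType R) (jT : (G -> T) -> TG),
        is_full_crossed_product alpha jT ->
      forall (OG : cstarAlgType R) (jO : (G -> O) -> OG),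
        is_full_crossed_product beta jO ->
      forall (AG : cstarAlgType R) (XG : corrType AG)
          (iA : AG -> TG) (iX : XG -> TG),
        is_crossed_correspondence rhoT tT jT iA iX ->
      forall (O' : cstarAlgType R) (rho' : AG -> O') (t' : XG -> O'),
        is_cuntz_pimsner_algebra rho' t' ->
      exists pi : OG -> O',
        [/\ star_hom pi,
            generator_preserving rhoT tT jT iA iX rhoO tO jO rho' t' pi,
            range pi = setT &
            ~ injective pi].
Proof.
have [sg] := index_action_exists hcount.
have rhoT_hom : star_hom rhoT by case: hT => -[[]].
have uT := toeplitz_universal hT.
have [alpha [halpha alpha_e alpha_t]] := quasi_free_action sg uT.
exists alpha; split.
  split=> // g.
    have fix_rho a : alpha g (rhoT a) = rhoT a.
      have hs : star_hom (alpha g) by case: halpha.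
      by rewrite (rho_scalar rhoT_hom) /scalar_map (star_homZ hs) alpha_e.
    by apply/seteqP; split=> [_ [_ [a _ <-] <-]|_ [a _ <-]]; [exists a|exists (rhoT a)].
  apply/seteqP; split=> [_ [_ [x _ <-] <-]|_ [x _ <-]].
    by rewrite alpha_t; exists (index_unitary R sg g x).
  exists (tT (index_unitary R sg g^-1%g x)); first by exists (index_unitary R sg g^-1%g x).
  by rewrite alpha_t -bopM -index_unitaryM mulgV index_unitary1.
move=> O rhoO tO hO.
have rhoO_hom : star_hom rhoO by case: hO => -[[[]]].
have uO := cuntz_pimsner_universal hO.
have [beta [hbeta beta_e beta_t]] := quasi_free_action sg uO.
have [q [hq q_e q_t]] : exists q : T -> O, [/\ star_hom q,
    q (rhoT (1 : R[i])) = rhoO (1 : R[i]) & forall x, q (tT x) = tO x].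
  by have [_ univ _] := uT; have [rO _ _] := uO; exact: univ rO.
have q_equiv g z : beta g (q z) = q (alpha g z).
  have [_ _ ext] := uT; have [ha _ _] := halpha; have [hb _ _] := hbeta.
  apply: (ext O (beta g \o q) (q \o alpha g)); try exact: star_hom_comp.
    by rewrite /= q_e beta_e alpha_e q_e.
  by move=> x; rewrite /= q_t beta_t alpha_t q_t.
exists beta; split.
  split=> //; exists q; split=> // a.
  by rewrite (rho_scalar rhoT_hom) (rho_scalar rhoO_hom) /scalar_map (star_homZ hq) q_e.
move=> TG jT hTG OG jO hOG AG XG iA iX hX O' rho' t' hO'.
exact: (comparison_not_injective hnonam rhoT_hom rhoO_hom uT uO halpha alpha_t
  hbeta beta_e beta_t hq q_e q_t q_equiv hTG hOG hX hO').
Qed.
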